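(* Let $d\ge 1$, let $X_1,X_2,\ldots$ be i.i.d. random variables in $\mathbb{R}^d$, and let $h=h_n>0$ be a sequence of bandwidths. Let $\varphi:\mathbb{R}^d\to\mathbb{R}$ and $K:\mathbb{R}^d\to\mathbb{R}$. Assume: (A1) for some $s>0$ and $M>0$, the support of $\varphi$ is a compact set $Q\subset\mathbb{R}^d$ and $\varphi$ belongs to $\mathcal{H}(s,M)$ on $\mathbb{R}^d$; (A2) for some integer $r\ge 1$, $X_1$ has a bounded density $f$ on $\mathbb{R}^d$ whose $r$th order derivatives are bounded; (A3) there is $b>0$ such that $f(x)\ge b$ for every $x\in Q$; (A4) $K$ is a kernel of order $r$ (in particular $\int K(x)\,dx=1$), there exist $m_1>0$, $m_2>0$ such that $|K(x)|\le m_1\exp(-m_2|x|)$ for every $x\in\mathbb{R}^d$, and $K(x)=K(-x)$ for every $x$. Let $I(\varphi)=\int\varphi(x)\,dx$ and let $\widehat I(\varphi)$, $\widehat I_c(\varphi)$ be the kernel-based estimators defined in the context. Then, as $n\to\infty$: (i) if $h^{s}+n^{1/2}h^{r}+n^{-1/2}h^{-d}\to 0$, then $$n^{1/2}\bigl(\widehat I(\varphi)-I(\varphi)\bigr)=O_{\mathbb{P}}\bigl(h^{s}+n^{1/2}h^{r}+n^{-1/2}h^{-d}\bigr);$$ (ii) if $h^{s}+n^{1/2}h^{r}+n^{-1/2}h^{-d/2}+n^{-1}h^{-3d/2}\to 0$, then $$n^{1/2}\bigl(\widehat I_c(\varphi)-I(\varphi)\bigr)=O_{\mathbb{P}}\b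igl(h^{s}+n^{1/2}h^{r}+n^{-1/2}h^{-d/2}+n^{-1}h^{-3d/2}\bigr).$$
   Context: $|\cdot|$ is the Euclidean norm. For a multi-index $l=(l_1,\ldots,l_d)$ of natural integers, $x^l=x_1^{l_1}\cdots x_d^{l_d}$ and $\varphi^{(l)}$ is the corresponding partial derivative. Nikolski class: for $s=k+\alpha$ with $k\in\mathbb{N}$ (including $0$), $0<\alpha\le 1$, and $M>0$, $\mathcal{H}(s,M)$ (on $\mathbb{R}^d$) is the set of bounded, $k$ times differentiable functions $\varphi:\mathbb{R}^d\to\mathbb{R}$ such that, for every $u\in\mathbb{R}^d$ and every $l$ with $\sum_i l_i\le k$, $$\int\bigl(\varphi^{(l)}(x+u)-\varphi^{(l)}(x)\bigr)^2dx\le M|u|^{2\alpha}.$$ Kernel of order $r\in\mathbb{N}^*$: a bounded function $K:\mathbb{R}^d\to\mathbb{R}$ with $\int K(x)\,dx=1$ and $\int x^lK(x)\,dx=0$ for all $l$ with $0<\sum_i l_i\le r-1$. Estimators (for $n\ge 3$): $$\widehat f^{(i)}(x)=\frac{1}{(n-1)h^d}\sum_{1\le j\le n,\,j\ne i}K\bigl(h^{-1}(x-X_j)\bigr),$$ $$\widehat v^{(i)}(x)=\frac{1}{(n-1)(n-2)}\sum_{1\le j\le n,\,j\ne i}\bigl(h^{-d}K(h^{-1}(x-X_j))-\widehat f^{(i)}(x)\bigr)^2,$$ $$\widehat I(\varphi)=\frac1n\sum_{i=1}^n\frac{\varphi(X_i)}{\widehat f^{(i)}(X_i)},\qquad \widehat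 I_c(\varphi)=\frac1n\sum_{i=1}^n\frac{\varphi(X_i)}{\widehat f^{(i)}(X_i)}\left(1-\frac{\widehat v^{(i)}(X_i)}{\widehat f^{(i)}(X_i)^2}\right).$$ *)

(* Defs.v *)
From HB Require Import structures.
From mathcomp Require Import all_boot all_order all_algebra.
From mathcomp Require Import all_classical all_reals all_analysis.

Set Implicit Arguments.
Unset Strict Implicit.
Unset Printing Implicit Defensive.
Import Order.TTheory GRing.Theory Num.Theory.
Import numFieldNormedType.Exports.
Local Open Scope classical_set_scope.
Local Open Scope ring_scope.

(* R^d is 'rV[R]_d.  The norm `|x| of the library on 'rV[R]_d is the sup norm;
   it induces the usual topology and the usual (Frechet) differentiability.
   The Euclidean norm is enorm, defined below. *)

Definition rV_display : measure_display.
Proof. exact: default_measure_display. Qed.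

Section measurable_rV.
Context {R : realType} {n : nat}.

Let coord (i : 'I_n) (x : 'rV[R]_n) : R := x ord0 i.

Let rV_set0 : g_sigma_preimage coord set0.
Proof. exact: sigma_algebra0. Qed.

Let rV_setC A : g_sigma_preimage coord A -> g_sigma_preimage coord (~` A).
Proof. exact: sigma_algebraC. Qed.

Let rV_bigcup (F : _^nat) : (forall i, g_sigma_preimage coord (F i)) ->
  g_sigma_preimage coord (\bigcup_i (F i)).
Proof. exact: sigma_algebra_bigcup. Qed.

(* Borel sigma-algebra of R^n, as the sigma-algebra generated by the
   coordinates (as the library does for n.-tuple) *)
HB.instance Definition _ :=
  @isMeasurable.Build rV_display 'rV[R]_n (g_sigma_preimage coord)
    rV_set0 rV_setC rV_bigcup.

End measurable_rV.

Section lebesgue_rV.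
Context {R : realType}.

Lemma measurable_fun_rVP d (T : measurableType d) n (f : T -> 'rV[R]_n) :
  measurable_fun setT f <->
  forall i, measurable_fun setT (fun x => f x ord0 i : R).
Proof.
split=> [mf i|mf].
  move=> _ A mA; rewrite setTI.
  have := mf measurableT ([set x | A (x ord0 i : R)]); rewrite setTI; apply.
  apply: sub_sigma_algebra; rewrite -bigcup_seq/=; exists i => /=.
    by rewrite mem_index_enum.
  by exists A => //; rewrite setTI.
move=> _ A mA; rewrite setTI.
have : preimage_set_system setT f (g_sigma_preimage
    (fun (i : 'I_n) (x : 'rV[R]_n) => x ord0 i : R)) (f @^-1` A).
  by exists A => //; rewrite setTI.
rewrite -g_sigma_preimage_comp.
apply: smallest_sub; first exact: sigma_algebra_measurable.
rewrite -bigcup_seq; apply: bigcup_sub => i _ B [C mC <-].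
exact: mf.
Qed.

Definition consrV n (p : measurableTypeR R * 'rV[R]_n) : 'rV[R]_n.+1 :=
  \row_i (if unlift ord0 i is Some j then p.2 ord0 j else p.1).

Definition unconsrV n (x : 'rV[R]_n.+1) : measurableTypeR R * 'rV[R]_n :=
  (x ord0 ord0, \row_j x ord0 (lift ord0 j)).

Lemma consrVK n : cancel (@consrV n) (@unconsrV n).
Proof.
move=> [a v]; rewrite /unconsrV mxE unlift_none; congr pair.
by apply/rowP => j; rewrite !mxE liftK.
Qed.

Lemma measurable_coord n (i : 'I_n) :
  measurable_fun setT (fun x : 'rV[R]_n => x ord0 i : R).
Proof. by move: i; apply/measurable_fun_rVP; exact: measurable_id. Qed.

Lemma measurable_consrV n : measurable_fun setT (@consrV n).
Proof.
apply/measurable_fun_rVP => i; case: (unliftP ord0 i) => [j|] ->.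
  apply: (eq_measurable_fun (fun p : measurableTypeR R * 'rV[R]_n => p.2 ord0 j : R)).
    by move=> p _; rewrite mxE liftK.
  exact: (measurableT_comp (measurable_coord j) measurable_snd).
apply: (eq_measurable_fun (fun p : measurableTypeR R * 'rV[R]_n => p.1)).
  by move=> p _; rewrite mxE unlift_none.
exact: measurable_fst.
Qed.

Lemma measurable_unconsrV n : measurable_fun setT (@unconsrV n).
Proof.
apply/measurable_fun_pairP; split; first exact: measurable_coord.
apply/measurable_fun_rVP => j /=.
apply: (eq_measurable_fun (fun x : 'rV[R]_n.+1 => x ord0 (lift ord0 j) : R)).
  by move=> p _; rewrite mxE.
exact: measurable_coord.
Qed.

Section succ.
Context {n : nat} (mu : {sigma_finite_measure set 'rV[R]_n -> \bar R}).

Definition lebesgue_rV_succ : set 'rV[R]_n.+1 -> \bar R :=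
  pushforward (lebesgue_measure \x mu)%E (@consrV n).

Let succ0 : lebesgue_rV_succ set0 = 0%E.
Proof. by rewrite /lebesgue_rV_succ /pushforward preimage_set0 measure0. Qed.

Let succ_ge0 A : (0 <= lebesgue_rV_succ A)%E.
Proof. by rewrite /lebesgue_rV_succ /pushforward; exact: measure_ge0. Qed.

Let succ_sigma_additive : semi_sigma_additive lebesgue_rV_succ.
Proof.
exact: (@measure_semi_sigma_additive _ _ _
  (measure_function_pushforward__canonical__measure_function_Measure
    (lebesgue_measure \x mu)%E (@measurable_consrV n))).
Qed.

HB.instance Definition _ := isMeasure.Build _ _ _ lebesgue_rV_succ
  succ0 succ_ge0 succ_sigma_additive.

Let succ_sigma_finite : sigma_finite setT lebesgue_rV_succ.
Proof.
have /sigma_finiteP[F [TF ndF Foo]] := sigma_finiteT (@lebesgue_measure R).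
have /sigma_finiteP[G [TG ndG Goo]] := sigma_finiteT mu.
exists (fun k => @unconsrV n @^-1` (F k `*` G k)) => [|k].
  rewrite -preimage_bigcup; apply/seteqP; split => // x _.
  have [i _ Fi] : (\bigcup_k F k) (unconsrV x).1 by rewrite -TF.
  have [j _ Gj] : (\bigcup_k G k) (unconsrV x).2 by rewrite -TG.
  exists (maxn i j) => //; split.
    by move: Fi; exact/subsetPset/ndF/leq_maxl.
  by move: Gj; exact/subsetPset/ndG/leq_maxr.
have [mF Fk] := Foo k; have [mG Gk] := Goo k; split.
  rewrite -[X in measurable X]setTI; apply: measurable_unconsrV => //.
  exact: measurableX.
rewrite /lebesgue_rV_succ /pushforward -comp_preimage.
rewrite (_ : _ \o _ = id) ?preimage_id; last first.
  by apply/funext => p /=; exact: consrVK.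
by rewrite product_measure1E// lte_mul_pinfty// ge0_fin_numE.
Qed.

HB.instance Definition _ := Measure_isSigmaFinite.Build _ _ _ lebesgue_rV_succ
  succ_sigma_finite.

End succ.

(* Lebesgue measure on R^n, as an iterated product measure; see
   lebesgue_rV_box for its value on boxes *)
Fixpoint lebesgue_rV n : {sigma_finite_measure set 'rV[R]_n -> \bar R} :=
  match n with
  | 0 => \d_(0 : 'rV[R]_0)
  | n.+1 => lebesgue_rV_succ (lebesgue_rV n)
  end.

Lemma lebesgue_rV_box n (A : 'I_n -> set R) : (forall i, measurable (A i)) ->
  (lebesgue_rV n [set x | forall i, A i (x ord0 i)] =
   \prod_(i < n) lebesgue_measure (A i))%E.
Proof.
elim: n A => [|n IHn] A mA /=.
  by rewrite big_ord0 diracE mem_set// => -[].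
rewrite big_ord_recl -(IHn (fun i => A (lift ord0 i)))//.
have mB : measurable [set x : 'rV[R]_n | forall i, A (lift ord0 i) (x ord0 i)].
  rewrite (_ : mkset _ = \bigcap_(i in setT)
      ((fun x : 'rV[R]_n => x ord0 i : R) @^-1` A (lift ord0 i))).
    apply: fin_bigcap_measurable => // i _.
    by rewrite -[X in measurable X]setTI; exact: measurable_coord.
  by apply/seteqP; split => x /= xA i => [_|]; exact: xA.
rewrite -product_measure1E; [|exact: (mA ord0)|exact: mB].
rewrite /lebesgue_rV_succ /pushforward; congr (_ _).
apply/seteqP; split=> -[a v]; rewrite /consrV/=.
  move=> h; split; first by have := h ord0; rewrite mxE unlift_none.
  by move=> i; have := h (lift ord0 i); rewrite mxE liftK.
by move=> [a0 h] i; rewrite mxE; case: (unliftP ord0 i) => [j|] ->.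
Qed.

End lebesgue_rV.

Section multivariate.
Context {R : realType} {d : nat}.
Implicit Types (x : 'rV[R]_d) (phi : 'rV[R]_d -> R) (l : 'I_d -> nat).

Definition enorm x : R := Num.sqrt (\sum_(i < d) x ord0 i ^+ 2).

Definition msize l : nat := \sum_(i < d) l i.

Definition monomial l x : R := \prod_(i < d) x ord0 i ^+ l i.

Definition partial (i : 'I_d) phi : 'rV[R]_d -> R :=
  fun x => 'D_(delta_mx ord0 i) phi x.

(* The partial derivative of multi-index l.  The (fixed) order in which the
   derivatives are taken is irrelevant for functions that are differentiable
   msize l times. *)
Definition mpartial l phi : 'rV[R]_d -> R :=
  foldr (fun i g => iter (l i) (partial i) g) phi (enum 'I_d).

(* k times differentiable everywhere in the Frechet sense, the derivatives of
   order k not being assumed continuous: the differential of phi is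
   differentiable k - 1 times iff the first partial derivatives are *)
Fixpoint times_differentiable (k : nat) phi : Prop :=
  if k is k'.+1 then
    (forall x, differentiable phi x) /\
    (forall i, times_differentiable k' (partial i phi))
  else True.

(* Measurability, implicit in the integral condition, is stated for phi only:
   if k > 0 then phi is continuous and its derivatives are pointwise limits of
   difference quotients, hence are measurable. *)
Definition nikolski (s M : R) phi : Prop :=
  [/\ bounded_fun phi, measurable_fun setT phi &
    exists (k : nat) (alpha : R),
      [/\ s = k%:R + alpha, 0 < alpha <= 1, times_differentiable k phi &
        forall (u : 'rV[R]_d) l, (msize l <= k)%N ->
          (\int[lebesgue_rV d]_x
              ((mpartial l phi (x + u) - mpartial l phi x) ^+ 2)%:E
            <= (M * enorm u `^ (2 * alpha))%:E)%E]].

Definition kernel_of_order (r : nat) (K : 'rV[R]_d -> R) : Prop :=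
  [/\ bounded_fun K, measurable_fun setT K,
    forall l, (msize l <= r.-1)%N ->
      (lebesgue_rV d).-integrable setT (fun x => (monomial l x * K x)%:E),
    \int[lebesgue_rV d]_x K x = 1 &
    forall l, (0 < msize l <= r.-1)%N ->
      \int[lebesgue_rV d]_x (monomial l x * K x) = 0].

End multivariate.

Section estimators.
Context {R : realType} {d n : nat}.
Variables (K : 'rV[R]_d -> R) (h : R) (X : 'I_n -> 'rV[R]_d).

Definition fhat (i : 'I_n) (x : 'rV[R]_d) : R :=
  ((n%:R - 1) * h ^+ d)^-1 * \sum_(j < n | j != i) K (h^-1 *: (x - X j)).

Definition vhat (i : 'I_n) (x : 'rV[R]_d) : R :=
  ((n%:R - 1) * (n%:R - 2))^-1 *
  \sum_(j < n | j != i) (h ^- d * K (h^-1 *: (x - X j)) - fhat i x) ^+ 2.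

(* Division by zero yields zero here: when some fhat i (X i) vanishes, the
   corresponding terms of Ihat and Ihat_c are zero. *)
Definition Ihat (phi : 'rV[R]_d -> R) : R :=
  n%:R^-1 * \sum_(i < n) (phi (X i) / fhat i (X i)).

Definition Ihat_c (phi : 'rV[R]_d -> R) : R :=
  n%:R^-1 * \sum_(i < n)
    (phi (X i) / fhat i (X i) * (1 - vhat i (X i) / fhat i (X i) ^+ 2)).

End estimators.

Section probability.
Context {R : realType} {disp disp' : measure_display}.
Context {Omega : measurableType disp} {T : measurableType disp'}.
Variable P : probability Omega R.
Local Open Scope ereal_scope.

Definition mutually_independent (X : nat -> {RV P >-> T}) : Prop :=
  forall (J : seq nat) (A : nat -> set T), uniq J ->
    (forall j, measurable (A j)) ->
    P (\bigcap_(j in [set` J]) (X j @^-1` A j)) =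
    \prod_(j <- J) P (X j @^-1` A j).

Definition identically_distributed (X : nat -> {RV P >-> T}) : Prop :=
  forall (i j : nat) (A : set T), measurable A ->
    distribution P (X i) A = distribution P (X j) A.

Definition has_density (mu : {measure set T -> \bar R}) (X : {RV P >-> T})
    (f : T -> R) : Prop :=
  [/\ measurable_fun setT f, (forall x, (0 <= f x)%R) &
    forall A, measurable A -> distribution P X A = \int[mu]_(x in A) (f x)%:E].

(* Z n = O_P(a n) as n tends to infinity *)
Definition bounded_in_probability (Z : nat -> Omega -> R) (a : nat -> R) :=
  forall eps : R, (0 < eps)%R -> exists2 C : R, (0 < C)%R &
    \forall n \near \oo,
      P [set w | (C * `|a n| < `|Z n w|)%R] <= eps%:E.

End probability.

(* Main.v *)
Require Import Defs.
From HB Require Import structures.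
From mathcomp Require Import all_boot all_order all_algebra.
From mathcomp Require Import all_classical all_reals all_analysis.
From mathcomp Require Import measurable_realfun ring lra.

Set Implicit Arguments.
Unset Strict Implicit.
Unset Printing Implicit Defensive.
Import Order.TTheory GRing.Theory Num.Theory.
Import numFieldNormedType.Exports.
Local Open Scope classical_set_scope.
Local Open Scope ring_scope.

(** Write [k x y = h ^- d * K (h^-1 *: (x - y))], let [g] be the leave-one-out density
estimate at a sample point, and [S] its fluctuation around its conditional mean
[kernel_mean]. Then [g = f + bias + S], where the bias is of order [h ^+ r] and [S] of
order [(n h^d)^(-1/2)].

Plain estimator. The identity [1/g = 2/f - g/f^2 + (g-f)^2/(f^2 g)] splits the error
into a part that is linear in [g] ([linear_term]) and an average of terms of order
[S^2 + bias^2], which has mean [1/(n h^d)] up to the bias. The linear part is a sum over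
pairs; its Hoeffding projection on one variable is, up to the bias, the difference
between [psi = phi/f] and its smoothing by the kernel. That difference has mean square
[(h^s + h^r)^2], so that the linear part is of order [n^(-1/2) (h^s + h^r) + h^r], plus
[1/(n h^(d/2))] for its degenerate part ([expect_sqr_linear_term]). A plain average of
[phi/f] would have an error of order [n^(-1/2)]; the gain comes from this cancellation.

Corrected estimator. One more order of the expansion is used
([reciprocal_expansion2]). The estimated variance is exactly what removes from [S^2] its
diagonal part ([sqr_fluctuation_sub_variance]); the off-diagonal part averages to a sum
over triples whose variance is smaller because it is centered
([expect_sqr_quadratic_term]), and the rest is of order [(n h^d)^(-3/2)].

Both expansions need [g >= b/2] wherever [phi] does not vanish. If this fails at one
point then [S] is at least [b/4] in absolute value there, and the sixth moment of [S]
makes the probability of this event of order [n (n h^d)^(-3)], negligible with respect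
to either rate. Markov's inequality on the complementary event gives the theorem
([tail_bound], [plain_sample_tail], [corrected_sample_tail]).

Analysis. The mean square of [psi] minus its smoothing is bounded in [smoothing_error].
The Nikolski condition controls, in mean square, the Taylor remainder of [phi]
([integral_sqr_taylor_rem_le]); the bounded derivatives of [f] control its Taylor
remainder uniformly ([taylor_rem_le]). Then [psi] is locally a polynomial in the
increment, up to a small error ([quotient_local_approximation]), and integration against
a kernel of order [r] keeps the value of this polynomial at zero increment up to terms of
order [h^r] ([kernel_almost_reproduces]). Derivatives of
the highest order are not assumed continuous or integrable, which is why the fundamental
theorem of calculus is replaced by the inequality [increment_le_integral_derive].

Probability. Independence and identical distribution enter only through [resampling]:
the law of the sample is invariant when one coordinate is redrawn. Orthogonality of
degenerate kernels and the exponential moments of [S] follow from it. *)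

(** * Increments and integrals of derivatives *)

(** Local-to-global along an interval: the supremum of the points that are reachable from
[a] is reachable, and is not less than [b]. *)
Lemma interval_chain (R : realType) (P : R -> R -> Prop) (a b : R) : a <= b ->
  (forall x y z, x <= y -> y <= z -> P x y -> P y z -> P x z) ->
  (forall x, a <= x <= b -> exists2 e : R, 0 < e &
     forall y, `|y - x| < e -> (x <= y -> P x y) /\ (y <= x -> P y x)) ->
  P a b.
Proof.
move=> ab Ptr Ploc.
set S := [set x | a <= x <= b /\ P a x].
have Sa : S a.
  split; first by rewrite lexx.
  have [|e e0 /(_ a)] := Ploc a; first by rewrite lexx.
  by rewrite subrr normr0 => /(_ e0)[/(_ (lexx _))].
have Sub : ubound S b by move=> x [/andP[]].
have hS : has_sup S by split; [exists a|exists b].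
set c := sup S.
have ac : a <= c by exact: sup_upper_bound.
have cb : c <= b by apply: ge_sup => //; exists a.
have [|e e0 He] := Ploc c; first by rewrite ac cb.
have [x Sx xc] := sup_adherent e0 hS; rewrite -/c in xc.
have xlec : x <= c by exact: sup_upper_bound.
have [/andP[ax xb] Pax] := Sx.
have Pac : P a c.
  apply: (Ptr a x c) => //.
  have [|_] := He x; last exact.
  by rewrite distrC ger0_norm ?subr_ge0// ltrBlDl addrC -ltrBlDl; lra.
have [<- //|cnb] := eqVneq c b.
have bc' : c < b by rewrite lt_neqAle cnb cb.
pose y := Num.min (c + e / 2) b.
have cy : c < y by rewrite /y lt_min bc' andbT; lra.
have Sy : S y.
  split; first by rewrite (le_trans ac (ltW cy))/= /y ge_min lexx orbT.
  apply: (Ptr a c y) => //; first exact: ltW.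
  have [|+ _] := He y; last by apply; exact: ltW.
  rewrite ger0_norm ?subr_ge0 ?(ltW cy)// ltrBlDl.
  by rewrite /y gt_min; apply/orP; left; lra.
by have := sup_upper_bound hS Sy; rewrite -/c leNgt cy.
Qed.

Lemma is_derive_lip_near (R : realType) (G : R -> R) (x a c : R) :
  is_derive x 1 G a -> `|a| < c ->
  exists2 e : R, 0 < e & forall y, `|y - x| < e -> `|G y - G x| <= c * `|y - x|.
Proof.
move=> /is_derive1_caratheodory[g [Gg cg ga]] ac.
have : \forall y \near x, `|g y| < c.
  by apply: (cvgr_norm_lt _ cg); rewrite ga.
move=> /nbhs_ballP[e/= e0 He]; exists e => // y yx.
rewrite Gg normrM ler_wpM2r//; apply/ltW/He.
by rewrite /ball/= distrC.
Qed.

Section ftc_inequality.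
Context {R : realType}.
Let lam := @lebesgue_measure R.
Variables (G g : R -> R).
Hypothesis dG : forall x : R, 0 <= x <= 1 -> is_derive x 1 G (g x).
Hypothesis mg : measurable_fun [set: R] g.

(** Level sets of the derivative, at scale [e]. On [E e j] the function is locally Lipschitz
with constant [j.+1%:R * e], and the sum of these constants weighted by the measures of the
level sets is a Lebesgue sum for the integral of the absolute value of the derivative. *)
Let E (e : R) (j : nat) : set R :=
  `[0, 1]%classic `&` [set x | j%:R * e <= `|g x| < j.+1%:R * e].

Let mE e j : measurable (E e j : set (measurableTypeR R)).
Proof.
apply: measurableI; first exact: measurable_itv.
rewrite (_ : [set x | _] = setT `&` (fun x => `|g x|) @^-1` `[j%:R * e, j.+1%:R * e[).
  by apply: measurableT_comp => //; exact: measurable_itv.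
by apply/seteqP; split => x /=; rewrite in_itv/= => // -[].
Qed.

Let sumE e : 0 < e ->
  (\sum_(0 <= j <oo) (j.+1%:R * e)%:E * lam (E e j) <=
   \int[lam]_(x in `[0%R, 1%R]) (`|g x|)%:E + e%:E)%E.
Proof.
move=> e0.
have UE : `[0%R, 1%R]%classic = \bigcup_j E e j.
  apply/seteqP; split => [x x01|x [j _ []//]].
  exists (Num.truncn (`|g x| / e)) => //; split=> //=.
  by rewrite -ler_pdivlMr// -ltr_pdivrMr// truncn_itv// divr_ge0// ltW.
have tE : trivIset setT (E e).
  apply/trivIsetP => i j _ _ ij; apply/seteqP; split => // x [[_ /= +] [_ /=]].
  rewrite -!ler_pdivlMr// -!ltr_pdivrMr// => /truncn_def iE /truncn_def jE.
  by move: ij; rewrite -iE -jE eqxx.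
have -> : (\int[lam]_(x in `[0%R, 1%R]) (`|g x|)%:E + e%:E =
   \int[lam]_(x in `[0%R, 1%R]) (`|g x| + e)%:E)%E.
  under [RHS]eq_integral do rewrite EFinD.
  rewrite ge0_integralD//=.
  - by rewrite integral_cst//= lebesgue_measure_itv/= lte01 oppr0 adde0 mule1.
  - apply/measurable_EFinP; apply: measurableT_comp => //.
    exact: measurable_funTS.
  - by move=> x _; rewrite lee_fin ltW.
rewrite UE ge0_integral_bigcup//.
- apply: lee_nneseries => [j _ _|j _]; first by rewrite mule_ge0// lee_fin mulr_ge0// ltW.
  rewrite -integral_cst//; apply: ge0_le_integral => //.
  + by move=> x _; rewrite lee_fin mulr_ge0// ltW.
  + apply/measurable_EFinP; apply: measurable_funD => //.
    by apply: measurableT_comp => //; exact: measurable_funTS.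
  + move=> x [_ /= /andP[h _]]; rewrite lee_fin.
    by rewrite -natr1 mulrDl mul1r lerD2r.
- apply/measurable_EFinP; apply: measurable_funD => //.
  by apply: measurableT_comp => //; exact: measurable_funTS.
- by move=> x _; rewrite lee_fin addr_ge0// ltW.
Qed.

(** The level sets may be enlarged to open sets: near a point of [E e j] every small
interval is covered by [U j], so its increment is charged to the measure of [U j] in it;
[interval_chain] adds up these local bounds. *)
Let oneside (e : R) (U : nat -> set R) : 0 < e -> (forall j, open (U j)) ->
  (forall j, E e j `<=` U j) ->
  ((`|G 1 - G 0|)%:E <=
    \sum_(0 <= j <oo) (j.+1%:R * e)%:E * lam (U j `&` `]0%R, 1%R]%classic) + e%:E)%E.
Proof.
move=> e0 oU EU.
pose W a b : \bar R := (\sum_(0 <= j <oo) (j.+1%:R * e)%:E * lam (U j `&` `]a, b]%classic))%E.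
have mU j a b : measurable (U j `&` `]a, b] : set (measurableTypeR R)).
  by apply: measurableI; [exact: open_measurable|exact: measurable_itv].
have W0 j a b : (0 <= (j.+1%:R * e)%:E * lam (U j `&` `]a, b]%classic))%E.
  by rewrite mule_ge0// lee_fin mulr_ge0// ltW.
pose P a b := ((`|G b - G a|)%:E <= W a b + (e * (b - a))%:E)%E.
suff : P 0 1 by rewrite /P subr0 mulr1.
apply: (@interval_chain R P) => // [x y z xy yz|x x01].
  rewrite /P => Pxy Pyz.
  have -> : W x z = (W x y + W y z)%E.
    rewrite /W -nneseriesD//; apply: eq_eseriesr => j _.
    rewrite -ge0_muleDr//; congr (_ * _)%E.
    rewrite -measureU//.
      rewrite -setIUr; congr (lam (_ `&` _)); apply/seteqP; split => t /=; rewrite !in_itv/=.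
        by case: (leP t y) => ty /andP[xt tz]; [left|right]; rewrite ?xt ?ty ?tz.
      by case=> /andP[xt ty]; apply/andP; split => //; [exact: le_trans yz|exact: le_lt_trans xt].
    apply/seteqP; split => // t [[_ /=]]; rewrite !in_itv/= => /andP[_ ty] [_ /=].
    by rewrite ltNge ty.
  have -> : (e * (z - x))%:E = ((e * (y - x))%:E + (e * (z - y))%:E)%E.
    by rewrite -EFinD; congr EFin; ring.
  rewrite addeACA; apply: le_trans (leeD Pxy Pyz).
  rewrite -EFinD lee_fin; apply: le_trans (ler_normD _ _).
  by rewrite [X in _ <= `|X|]addrC subrKA.
pose j := Num.truncn (`|g x| / e).
have Ej : E e j x.
  split=> //=.
  by rewrite -ler_pdivlMr// -ltr_pdivrMr// truncn_itv// divr_ge0// ltW.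
have [d1 d10 H1] : exists2 d : R, 0 < d & forall y, `|y - x| < d -> U j y.
  have /nbhs_ballP[d/= d0 Hd] : nbhs x (U j) by apply: open_nbhs_nbhs; split=> //; exact: EU.
  by exists d => // y yx; apply: Hd; rewrite /ball/= distrC.
have [_ /= /andP[_ gj]] := Ej.
have [d2 d20 H2] := is_derive_lip_near (dG x01) gj.
have key (a b : R) : a <= b -> `|a - x| < d1 -> `|b - x| < d1 ->
    `|G b - G a| <= j.+1%:R * e * (b - a) -> P a b.
  move=> ab a1 b1 GH; rewrite /P.
  apply: (@le_trans _ _ (W a b)); last by rewrite leeDl// lee_fin mulr_ge0 ?subr_ge0// ltW.
  have -> : W a b = (\sum_(0 <= i < j.+1) (i.+1%:R * e)%:E * lam (U i `&` `]a, b]%classic) + \sum_(j.+1 <= i <oo) (i.+1%:R * e)%:E * lam (U i `&` `]a, b]%classic))%E.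
    by rewrite /W (nneseries_split 0 j.+1)// add0n.
  rewrite big_nat_recr//= -addeA; apply: (@le_trans _ _ ((j.+1%:R * e)%:E * lam (U j `&` `]a, b]%classic)))%E; last first.
    rewrite addeCA leeDl// adde_ge0 ?sume_ge0// nneseries_ge0//.
  have -> : U j `&` `]a, b]%classic = `]a, b]%classic.
    apply/setIidPr => y /=; rewrite in_itv/= => /andP[ay yb].
    by apply: H1; move: a1 b1; rewrite !ltr_norml; lra.
  rewrite /lam lebesgue_measure_itv/= lte_fin; case: ltP => ab'.
    by rewrite -EFinD -EFinM lee_fin.
  have -> : a = b by apply/le_anti/andP.
  by rewrite mule0 subrr normr0.
exists (Num.min d1 d2) => [|y]; first by rewrite lt_min d10 d20.
rewrite lt_min => /andP[y1 y2].
have xx : `|x - x| < d1 by rewrite subrr normr0.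
split => xy; apply: key => //.
  by apply: le_trans (H2 _ y2) _; rewrite ger0_norm// subr_ge0.
by rewrite distrC; apply: le_trans (H2 _ y2) _; rewrite distrC ger0_norm// subr_ge0.
Qed.

(** The derivative may fail to be integrable, so that the increment need not be its
integral. The level sets of the derivative are enclosed in open sets of nearly the same
measure, which control the increments over small intervals. *)
Theorem increment_le_integral_derive :
  ((`|G 1 - G 0|)%:E <= \int[lam]_(x in `[0%R, 1%R]) (`|g x|)%:E)%E.
Proof.
apply/lee_addgt0Pr => e e0.
pose e' := e / 3.
have e'0 : 0 < e' by rewrite /e'; lra.
pose d j : R := (e' / (2 ^ j.+1)%:R) / (j.+1%:R * e').
have d0 j : 0 < d j by rewrite !(divr_gt0, mulr_gt0)// ltr0n expn_gt0.
have lamE j : (lam (E e' j) < +oo)%E.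
  apply: (@le_lt_trans _ _ (lam `[0%R, 1%R]%classic)).
    apply: le_measure; rewrite ?inE; [exact: mE|exact: measurable_itv|exact: subIsetl].
  by rewrite /lam lebesgue_measure_itv/= lte01 oppr0 adde0 ltry.
have /choice[U HU] j : exists V, [/\ open V, E e' j `<=` V & (lam (V `\` E e' j) < (d j)%:E)%E].
  by apply: lebesgue_regularity_outer => //; exact: mE.
have := @oneside e' U e'0 (fun j => let: And3 a _ _ := HU j in a)
  (fun j => let: And3 _ a _ := HU j in a).
move=> /le_trans; apply.
apply: (@le_trans _ _ (\int[lam]_(x in `[0%R, 1%R]) (`|g x|)%:E + e'%:E + e'%:E + e'%:E)%E); last first.
  by rewrite -2!addeA; apply: leeD2l; rewrite -EFinD lee_fin /e'; lra.
rewrite leeD2r//.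
apply: (@le_trans _ _ (\sum_(0 <= j <oo) (j.+1%:R * e')%:E * lam (E e' j) + e'%:E)%E); last first.
  by rewrite leeD2r// sumE.
apply: le_trans (epsilon_trick _ _ (ltW e'0)); last first.
  by move=> j; rewrite mule_ge0// lee_fin mulr_ge0// ltW.
apply: lee_nneseries => [j _ _|j _].
  by rewrite mule_ge0// lee_fin mulr_ge0// ltW.
have [oU EU lU] := HU j.
have c0 : (0 <= j.+1%:R * e')%R by rewrite mulr_ge0// ltW.
have mU := open_measurable oU.
apply: (@le_trans _ _ ((j.+1%:R * e')%:E * (lam (E e' j) + (d j)%:E))%E).
  rewrite lee_wpmul2l ?lee_fin//.
  apply: (@le_trans _ _ (lam (U j))).
    apply: le_measure; rewrite ?inE; [exact: measurableI|exact: mU|exact: subIsetl].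
  have -> : lam (U j) = (lam (U j `\` E e' j) + lam (U j `&` E e' j))%E by apply: measureDI => //; exact: mE.
  rewrite addeC; apply: leeD; last exact: ltW.
  apply: le_measure; rewrite ?inE; [exact: measurableI|exact: mE|exact: subIsetr].
rewrite ge0_muleDr// ?lee_fin ?(ltW (d0 j))// leeD2l// -EFinM lee_fin /d.
by rewrite mulrC divfK// mulf_neq0// ?pnatr_eq0// gt_eqF.
Qed.
End ftc_inequality.

(** Either side may be infinite; finiteness is only established by later estimates. *)
Lemma cauchy_schwarz_integral d (T : measurableType d) (R : realType)
    (mu : {measure set T -> \bar R}) (f g : T -> R) :
  measurable_fun [set: T] f -> measurable_fun [set: T] g ->
  ((\int[mu]_x (`|f x * g x|)%:E) ^+ 2 <=
   (\int[mu]_x (f x ^+ 2)%:E) * \int[mu]_x (g x ^+ 2)%:E)%E.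
Proof.
move=> mf mg.
have := hoelder mu mf mg (ltr0n _ 2) (ltr0n _ 2).
have -> : ((2%:R : R)^-1 + 2^-1 = 1)%R by field.
move=> /(_ erefl).
have sq (x : \bar R) : (0 <= x -> x ^+ 2 = x `^ 2)%E.
  case: x => [x|_|//]; last by rewrite poweRyr// expe2 mulyy.
  by rewrite lee_fin => x0; rewrite poweR_EFin powR_mulrn// EFin_expe.
have N2 (u : T -> R) : (\int[mu]_x (u x ^+ 2)%:E = ('N[mu]_2%:R%:E[EFin \o u]) ^+ 2)%E.
  rewrite sq ?Lnorm_ge0// poweR_Lnorm//; apply: eq_integral => x _ /=.
  by rewrite powR_mulrn// -normrX ger0_norm// sqr_ge0.
rewrite !N2 Lnorm1 => H.
by rewrite !expe2 muleACA; apply: lee_pmul => //; exact: integral_ge0.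
Qed.

Lemma sqr_integral_abs_le d (T : measurableType d) (R : realType)
    (mu : {measure set T -> \bar R}) (D : set T) (f : T -> R) :
  measurable D -> (mu D <= 1)%E -> measurable_fun [set: T] f ->
  ((\int[mu]_(x in D) (`|f x|)%:E) ^+ 2 <= \int[mu]_(x in D) (f x ^+ 2)%:E)%E.
Proof.
move=> mD D1 mf.
have mI : measurable_fun [set: T] (\1_D : T -> R) by exact: measurable_indic.
have := cauchy_schwarz_integral mu (measurable_funM mf mI) mI.
have -> : (\int[mu]_x `|(f x * \1_D x) * \1_D x|%:E = \int[mu]_(x in D) `|f x|%:E)%E.
  rewrite [RHS]integral_mkcond; apply: eq_integral => x _.
  by rewrite patchE /= indicE; case: ifPn => xD; rewrite ?(mulr1, mulr0, normr0).
have -> : (\int[mu]_x ((f x * \1_D x) ^+ 2)%:E = \int[mu]_(x in D) (f x ^+ 2)%:E)%E.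
  rewrite [RHS]integral_mkcond; apply: eq_integral => x _.
  by rewrite patchE /= indicE; case: ifPn => xD; rewrite ?(mulr1, mulr0, expr0n).
have -> : (\int[mu]_x ((\1_D x : R) ^+ 2)%:E = mu D)%E.
  rewrite -[in RHS](setIT D) -integral_indic//; apply: eq_integral => x _.
  by rewrite indicE; case: (_ \in _); rewrite ?(expr1n, expr0n).
move=> /le_trans; apply; rewrite -[leRHS]mule1 lee_wpmul2l//.
by apply: integral_ge0 => x _; rewrite lee_fin sqr_ge0.
Qed.

Lemma sqr_increment_le_integral_derive (R : realType) (G g : R -> R) :
  (forall x : R, 0 <= x <= 1 -> is_derive x 1 G (g x)) ->
  measurable_fun [set: R] g ->
  (((G 1 - G 0) ^+ 2)%:E <= \int[lebesgue_measure]_(x in `[0%R, 1%R]) (g x ^+ 2)%:E)%E.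
Proof.
move=> dG mg; apply: le_trans (sqr_integral_abs_le _ _ _) => //; last first.
  by rewrite /= lebesgue_measure_itv/= lte01 oppr0 adde0.
rewrite -(real_normK (num_real _)) EFin_expe !expe2.
by apply: lee_pmul; rewrite ?lee_fin//; exact: increment_le_integral_derive.
Qed.

(** * Derivatives along lines and mixed partial derivatives *)

Section line_derivative.
Context {R : realType} {d : nat}.
Implicit Types (x u : 'rV[R]_d) (g : 'rV[R]_d -> R).

Lemma derive_partialE g x u : differentiable g x ->
  'D_u g x = \sum_i u ord0 i * partial i g x.
Proof.
move=> dg; rewrite deriveE// {1}(row_sum_delta u) linear_sum.
by apply: eq_bigr => i _; rewrite linearZ/= /partial deriveE.
Qed.

Lemma is_derive_line g x u (t : R) : differentiable g (x + t *: u) ->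
  is_derive t (1 : R) (fun t : R => g (x + t *: u))
    (\sum_i u ord0 i * partial i g (x + t *: u)).
Proof.
move=> dg; rewrite -derive_partialE//.
set F := fun t : R => g (x + t *: u).
have E : (fun h : R => h^-1 *: ((F \o shift t) (h *: (1 : R)) - F t)) =
         (fun h : R => h^-1 *: ((g \o shift (x + t *: u)) (h *: u) - g (x + t *: u))).
  apply/funext => h; rewrite /F /= /shift/=; congr (_ *: (g _ - _)).
  by rewrite [h *: (1 : R)]mulr1 scalerDl addrCA.
have dF : derivable g (x + t *: u) u by exact: diff_derivable.
have ddF : derivable F t (1 : R) by rewrite /derivable E.
by split => //; rewrite /derive E.
Qed.

End line_derivative.

Section mixed_partials.
Context {R : realType} {d : nat}.
Implicit Types (x u v : 'rV[R]_d) (g : 'rV[R]_d -> R).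

Lemma differentiable_expansion g x (e : R) : differentiable g x -> 0 < e ->
  exists2 r : R, 0 < r & forall v, `|v| < r -> `|g (x + v) - g x - 'd g x v| <= e * `|v|.
Proof.
move=> dg e0.
have := diff_locallyx dg; set o := 'o _ => H.
have /(littleoP [littleo of o])/nbhs_norm0P[r r0 Hr] := e0.
exists r => // v vr.
suff <- : o v = g (x + v) - g x - 'd g x v by exact: Hr.
by rewrite [x + v]addrC H -addrA -opprD [X in X - _]addrC addrK.
Qed.

(** The mean value theorem along [u] turns the second difference into a first difference of
the derivative along [u], which is then expanded at [x]. *)
Lemma second_difference_approx g x u v (e : R) : (forall y, differentiable g y) ->
  differentiable ('D_u g) x -> 0 < e ->
  exists2 r : R, 0 < r & forall t : R, 0 < t < r ->
    `|g (x + t *: v + t *: u) - g (x + t *: v) - g (x + t *: u) + g x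
       - t ^+ 2 * 'D_v ('D_u g) x| <= e * t ^+ 2.
Proof.
move=> dg dp e0; set p := 'D_u g.
pose N := `|u| + `|v| + 1.
have N0 : 0 < N by rewrite /N ltr_wpDl// addr_ge0.
have [|r r0 Hr] := differentiable_expansion dp (e := e / (2 * N)).
  by rewrite divr_gt0// mulr_gt0.
exists (r / N) => [|t /andP[t0 tr]]; first exact: divr_gt0.
have tN : t * N < r by rewrite -ltr_pdivlMr.
pose G (s : R) := g (x + t *: v + s *: (t *: u)) - g (x + s *: (t *: u)).
pose DG (s : R) := t * (p (x + t *: v + s *: (t *: u)) - p (x + s *: (t *: u))).
have dline y s : is_derive s (1 : R) (fun s : R => g (y + s *: (t *: u)))
    (t * p (y + s *: (t *: u))).
  apply: is_derive_eq; first exact: is_derive_line.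
  rewrite -derive_partialE// deriveE// linearZ/= /p deriveE//.
have dG (s : R) : is_derive s (1 : R) G (DG s).
  by rewrite /DG mulrBr; apply: is_deriveB.
have cG : {within `[(0:R), 1], continuous G}.
  apply: continuous_subspaceT => s.
  by apply: differentiable_continuous; apply/derivable1_diffP; case: (dG s).
have [s] := MVT_segment ler01 (fun s _ => dG s) cG.
rewrite in_itv/= => /andP[s0 s1].
rewrite subr0 mulr1 /G !scale1r !scale0r !addr0 => E.
have -> : g (x + t *: v + t *: u) - g (x + t *: v) - g (x + t *: u) + g x =
    DG s by rewrite -E; ring.
have b1 : `|t *: v + s *: (t *: u)| <= t * N.
  rewrite (le_trans (ler_normD _ _))// !normrZ (gtr0_norm t0) (ger0_norm s0) /N.
  have : s * (t * `|u|) <= 1 * (t * `|u|) by rewrite ler_wpM2r// mulr_ge0// ltW.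
  by nra.
have b2 : `|s *: (t *: u)| <= t * N.
  rewrite !normrZ (gtr0_norm t0) (ger0_norm s0) /N.
  have : s * (t * `|u|) <= 1 * (t * `|u|) by rewrite ler_wpM2r// mulr_ge0// ltW.
  have := normr_ge0 v; by nra.
have := Hr _ (le_lt_trans b1 tN); have := Hr _ (le_lt_trans b2 tN).
rewrite addrA -/p [in X in _ -> X -> _]linearD/= => h1 h2; rewrite -/p in h1 h2.
set L1 := 'd p x (s *: (t *: u)) in h1 h2; set L2 := 'd p x (t *: v) in h2.
set A := p (x + t *: v + s *: (t *: u)) in h2; set B := p (x + s *: (t *: u)) in h1.
have -> : DG s - t ^+ 2 * 'D_v p x =
   t * ((A - p x - (L2 + L1)) - (B - p x - L1)).
  have -> : L2 = t * 'D_v p x by rewrite /L2 linearZ/= -deriveE.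
  by rewrite /DG -/A -/B; ring.
rewrite normrM (gtr0_norm t0) expr2 mulrCA ler_pM2l//.
rewrite (le_trans (ler_normB _ _))//.
have k1 : e / (2 * N) * `|t *: v + s *: (t *: u)| <= e / (2 * N) * (t * N).
  by rewrite ler_wpM2l// divr_ge0 ?ltW// mulr_gt0.
have k2 : e / (2 * N) * `|s *: (t *: u)| <= e / (2 * N) * (t * N).
  by rewrite ler_wpM2l// divr_ge0 ?ltW// mulr_gt0.
have k3 : e / (2 * N) * (t * N) = e * t / 2 by field; rewrite gt_eqF.
by rewrite k3 in k1 k2; lra.
Qed.

Let second_differences_close (S g1 g2 g3 a b T e : R) : 0 < T ->
  `|S - g1 - g2 + g3 - T * a| <= e / 2 * T ->
  `|S - g2 - g1 + g3 - T * b| <= e / 2 * T -> `|a - b| <= e.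
Proof.
move=> T0 h1 h2; rewrite -(ler_pM2l T0) -[X in X * `|_|](gtr0_norm T0) -normrM.
have -> : T * (a - b) = (S - g2 - g1 + g3 - T * b) - (S - g1 - g2 + g3 - T * a).
  by ring.
by rewrite (le_trans (ler_normB _ _))//; lra.
Qed.

(** Young's theorem: the second difference of a function along two directions
is symmetric in the two directions, and the mean value theorem in one direction
identifies its leading term. *)
Lemma mixed_derivatives_commute g x u v : (forall y, differentiable g y) ->
  differentiable ('D_u g) x -> differentiable ('D_v g) x ->
  'D_v ('D_u g) x = 'D_u ('D_v g) x.
Proof.
move=> dg du dv; apply/eqP; rewrite -subr_eq0 -normr_eq0 eq_le normr_ge0 andbT.
apply/ler_addgt0Pr => e e0; rewrite add0r.
have e2 : 0 < e / 2 by rewrite divr_gt0.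
have [r1 r10 H1] := second_difference_approx v dg du e2.
have [r2 r20 H2] := second_difference_approx u dg dv e2.
pose t := Num.min r1 r2 / 2.
have t0 : 0 < t by rewrite divr_gt0// lt_min r10.
have tm : t < Num.min r1 r2.
  have : 0 < Num.min r1 r2 by rewrite lt_min r10.
  by rewrite /t; move: (Num.min _ _) => m; lra.
move: tm; rewrite lt_min => /andP[t1 t2].
have {}H1 := H1 t; have {}H2 := H2 t; rewrite t0 t1 in H1; rewrite t0 t2 in H2.
have {}H1 := H1 isT; have {}H2 := H2 isT.
rewrite (addrAC x (t *: u)) in H2.
have t20 : 0 < t ^+ 2 by rewrite exprn_gt0.
exact: second_differences_close t20 H1 H2.
Qed.

End mixed_partials.

Section mpartial_theory.
Context {R : realType} {d : nat}.
Implicit Types (g : 'rV[R]_d -> R) (i j : 'I_d) (l : 'I_d -> nat) (s : seq 'I_d).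

Lemma times_differentiableS k g :
  times_differentiable k.+1 g -> times_differentiable k g.
Proof. by elim: k g => // k IH g [dg dp]; split => // i; exact: IH. Qed.

Lemma times_differentiableW k m g : (m <= k)%N ->
  times_differentiable k g -> times_differentiable m g.
Proof.
by move=> /subnK <-; elim: (k - m)%N => // n IH /times_differentiableS.
Qed.

Lemma times_differentiable_iter k n i g : times_differentiable (n + k) g ->
  times_differentiable k (iter n (partial i) g).
Proof.
elim: n k => // n IH k; rewrite addSnnS => /IH.
by rewrite iterS => -[_]; exact.
Qed.

Lemma partialC i j g : times_differentiable 2 g ->
  partial i (partial j g) = partial j (partial i g).
Proof.
move=> [dg dp]; apply/funext => x; apply: mixed_derivatives_commute => //.
  by have [] := dp j.
by have [] := dp i.
Qed.

Lemma iter_partialC n i j g : times_differentiable n.+1 g ->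
  iter n (partial j) (partial i g) = partial i (iter n (partial j) g).
Proof.
elim: n => // n IH dg; rewrite !iterS IH; last exact: times_differentiableS.
apply/esym/partialC; apply: times_differentiable_iter.
by rewrite addn2.
Qed.

(** The derivative of multi-index [l] restricted to the coordinates listed in [s]: the
induction on the list of coordinates that defines [mpartial]. *)
Definition partials s l g :=
  foldr (fun i g => iter (l i) (partial i) g) g s.

Lemma times_differentiable_partials k s l g :
  times_differentiable (\sum_(i <- s) l i + k) g ->
  times_differentiable k (partials s l g).
Proof.
elim: s k => [|i s IH] k; first by rewrite big_nil.
rewrite big_cons -addnA addnCA => /IH; exact: times_differentiable_iter.
Qed.

Definition incr i l : 'I_d -> nat := fun j => (l j + (j == i))%N.

Lemma partials_partial_notin s l i g : i \notin s ->
  times_differentiable (\sum_(j <- s) l j).+1 g ->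
  partials s l (partial i g) = partial i (partials s l g) /\
  partials s (incr i l) g = partials s l g.
Proof.
elim: s => [//|j s IH]; rewrite inE negb_or big_cons => /andP[ij si] dg.
have [|e1 e2] := IH si.
  by apply: times_differentiableW dg; rewrite ltnS leq_addl.
split.
  rewrite /= e1 iter_partialC//.
  by apply: times_differentiable_partials; rewrite addnS addnC.
by rewrite /= e2 /incr eq_sym (negbTE ij) addn0.
Qed.

Lemma partials_partial_in s l i g : uniq s -> i \in s ->
  times_differentiable (\sum_(j <- s) l j).+1 g ->
  partials s l (partial i g) = partials s (incr i l) g.
Proof.
elim: s => [//|j s IH]; rewrite cons_uniq inE big_cons => /andP[js us] /orP[/eqP ij|si] dg.
  subst j; have [|e1 e2] := partials_partial_notin (l := l) js (g := g).
    by apply: times_differentiableW dg; rewrite ltnS leq_addl.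
  by rewrite /= e1 e2 /incr eqxx addn1 -iterSr.
rewrite /= IH//; last by apply: times_differentiableW dg; rewrite ltnS leq_addl.
rewrite /incr; case: eqVneq => [ji|]; last by rewrite addn0.
by rewrite ji si in js.
Qed.

Lemma msize_incr i l : msize (incr i l) = (msize l).+1.
Proof.
by rewrite /msize big_split/= -big_mkcond/= big_pred1_eq addn1.
Qed.

Lemma mpartial_partial l i g : times_differentiable (msize l).+1 g ->
  mpartial l (partial i g) = mpartial (incr i l) g.
Proof.
move=> dg; apply: partials_partial_in; rewrite ?enum_uniq ?mem_enum//.
by rewrite big_enum.
Qed.

Lemma mpartial0 l g : msize l = 0%N -> mpartial l g = g.
Proof.
move/eqP; rewrite /msize sum_nat_eq0 => /forallP l0.
rewrite /mpartial; elim: (enum _) => //= i s ->.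
by have /eqP -> := l0 i.
Qed.

Lemma times_differentiable_mpartial k l g :
  times_differentiable (msize l + k) g -> times_differentiable k (mpartial l g).
Proof.
by move=> dg; apply: times_differentiable_partials; rewrite big_enum.
Qed.

End mpartial_theory.

(** * The Euclidean norm and measurability of partial derivatives *)

Section enorm_theory.
Context {R : realType} {d : nat}.
Implicit Types (u v : 'rV[R]_d).

Lemma enorm_ge0 u : 0 <= enorm u.
Proof. exact: sqrtr_ge0. Qed.

Lemma sqr_enorm u : enorm u ^+ 2 = \sum_i u ord0 i ^+ 2.
Proof. by rewrite sqr_sqrtr// sumr_ge0// => i _; exact: sqr_ge0. Qed.

Lemma enormZ (t : R) u : enorm (t *: u) = `|t| * enorm u.
Proof.
rewrite /enorm; under eq_bigr do rewrite mxE exprMn.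
by rewrite -big_distrr/= sqrtrM ?sqr_ge0// sqrtr_sqr.
Qed.

Lemma enormN u : enorm (- u) = enorm u.
Proof. by rewrite -scaleN1r enormZ normrN1 mul1r. Qed.

Lemma coord_le_enorm u i : `|u ord0 i| <= enorm u.
Proof.
rewrite -(@ler_pXn2r _ 2)// ?nnegrE ?enorm_ge0// sqr_enorm real_normK ?num_real//.
by rewrite (bigD1 i)//= lerDl sumr_ge0// => j _; exact: sqr_ge0.
Qed.

Lemma measurable_funDrV e (T : measurableType e) (h k : T -> 'rV[R]_d) :
  measurable_fun [set: T] h -> measurable_fun [set: T] k ->
  measurable_fun [set: T] (fun x => h x + k x).
Proof.
move=> /measurable_fun_rVP mh /measurable_fun_rVP mk; apply/measurable_fun_rVP => i.
by under eq_fun do rewrite mxE; exact: measurable_funD.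
Qed.

Lemma measurable_funZrV e (T : measurableType e) (c : T -> R) (h : T -> 'rV[R]_d) :
  measurable_fun [set: T] c -> measurable_fun [set: T] h ->
  measurable_fun [set: T] (fun x => c x *: h x).
Proof.
move=> mc /measurable_fun_rVP mh; apply/measurable_fun_rVP => i.
by under eq_fun do rewrite mxE; exact: measurable_funM.
Qed.

Lemma measurable_monomial (l : 'I_d -> nat) :
  measurable_fun [set: 'rV[R]_d] (monomial l).
Proof.
apply: measurable_prod => i _; apply: measurable_funX.
exact: measurable_coord.
Qed.

Lemma measurable_enorm : measurable_fun [set: 'rV[R]_d] enorm.
Proof.
have mS : measurable_fun [set: 'rV[R]_d] (fun u => \sum_i u ord0 i ^+ 2).
  by apply: measurable_sum => i; apply: measurable_funX; exact: measurable_coord.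
have -> : enorm = (fun u : 'rV[R]_d => (\sum_i u ord0 i ^+ 2) `^ 2^-1) :> (_ -> R).
  apply/funext => u; rewrite powR12_sqrt// sumr_ge0// => i _; exact: sqr_ge0.
exact: measurableT_comp (measurable_powR _) mS.
Qed.

(** A partial derivative is the pointwise limit of difference quotients along [1 / n]. *)
Lemma measurable_partial (g : 'rV[R]_d -> R) i : measurable_fun [set: 'rV[R]_d] g ->
  (forall x, differentiable g x) -> measurable_fun [set: 'rV[R]_d] (partial i g).
Proof.
move=> mg dg.
pose q n x : R := n.+1%:R * (g (x + n.+1%:R^-1 *: delta_mx ord0 i) - g x).
apply: (measurable_fun_cvg (h := q)) => [n|x _].
  apply: measurable_funM => //; apply: measurable_funB => //.
  apply: measurableT_comp => //; apply: measurable_funDrV => //.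
have : derivable g x (delta_mx ord0 i) by exact: diff_derivable.
rewrite /derivable => /cvg_ex[a ga].
have -> : partial i g x = a by exact: cvg_lim.
have hc : (forall n, @harmonic R n != 0) /\ (@harmonic R n @[n --> \oo] --> 0).
  split=> [n|]; last exact: cvg_harmonic.
  by rewrite /harmonic/= gt_eqF// invr_gt0.
have := (cvgr_dnbhsP _ _ _).1 ga _ hc.
apply: cvg_trans; apply: near_eq_cvg; near=> n => /=.
by rewrite /q /harmonic/= invrK [_ + x]addrC.
Unshelve. all: by end_near.
Qed.

Lemma measurable_mpartial k l (g : 'rV[R]_d -> R) : (msize l <= k)%N ->
  times_differentiable k g -> measurable_fun [set: 'rV[R]_d] g ->
  measurable_fun [set: 'rV[R]_d] (mpartial l g).
Proof.
rewrite /msize /mpartial -big_enum /=.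
elim: (enum 'I_d) k g => [//|i s IH] k g; rewrite big_cons /= => lk dg mg.
have lk' : (\sum_(j <- s) l j <= k - l i)%N by rewrite leq_subRL ?(leq_trans (leq_addr _ _) lk).
have := IH _ _ lk' (times_differentiableW (leq_subr _ _) dg) mg.
have := times_differentiable_partials (k := l i) (s := s) (l := l) (g := g).
move=> /(_ (times_differentiableW _ dg)); rewrite addnC lk => /(_ isT).
rewrite /partials; move: (foldr _ _ _) => p; clear -i.
elim: (l i) p => [//|n IH] p dp mp; rewrite iterSr.
have [d1 d2] := dp; apply: IH; [exact: d2|exact: measurable_partial].
Qed.

End enorm_theory.

(** * Taylor remainders in mean square *)

Section taylor.
Context {R : realType} {d : nat}.
Implicit Types (g : 'rV[R]_d -> R) (x u : 'rV[R]_d).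

(** The [j]-th differential at [x] applied to [j] copies of [u], by iterated first
differentials: sums over lists of coordinates rather than over multi-indices, so that
no multinomial coefficient appears. *)
Fixpoint taylor_term (j : nat) g x u : R :=
  if j is j'.+1 then \sum_i u ord0 i * taylor_term j' (partial i g) x u else g x.

Definition taylor_poly k g x u : R :=
  \sum_(j < k.+1) (j`!)%:R^-1 * taylor_term j g x u.

Definition taylor_rem k g x u : R := g (x + u) - taylor_poly k g x u.

Lemma taylor_termZ j g x (t : R) u :
  taylor_term j g x (t *: u) = t ^+ j * taylor_term j g x u.
Proof.
elim: j g => [|j IH] g /=; first by rewrite mul1r.
rewrite big_distrr/=; apply: eq_bigr => i _.
by rewrite IH mxE exprS; ring.
Qed.

Lemma taylor_term0 j g x : taylor_term j.+1 g x 0 = 0.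
Proof. by rewrite -(scale0r (0 : 'rV[R]_d)) taylor_termZ expr0n mul0r. Qed.

Lemma taylor_polyx0 k g x : taylor_poly k g x 0 = g x.
Proof.
rewrite /taylor_poly big_ord_recl big1 => [|j _].
  by rewrite addr0 fact0 invr1 mul1r.
by rewrite lift0 taylor_term0 mulr0.
Qed.

Lemma measurable_taylor_term j k g u : (j <= k)%N -> times_differentiable k g ->
  measurable_fun [set: 'rV[R]_d] g ->
  measurable_fun [set: 'rV[R]_d] (fun x => taylor_term j g x u).
Proof.
elim: j k g => [//|j IH] [//|k] g jk [dg dp] mg /=.
apply: measurable_sum => i; apply: measurable_funM => //.
by apply: (IH k); [|exact: dp|exact: measurable_partial].
Qed.

Lemma taylor_remS_at0 k g x u : taylor_rem k.+1 g x (0 *: u) = 0.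
Proof. by rewrite /taylor_rem scale0r taylor_polyx0 addr0 subrr. Qed.

(** This recursion on the order is what Taylor estimates by iterated integration need; no
formula for the remainder is used. *)
Lemma is_derive_taylor_rem k g x u (t : R) : (forall y, differentiable g y) ->
  is_derive t (1 : R) (fun t : R => taylor_rem k.+1 g x (t *: u))
    (\sum_i u ord0 i * taylor_rem k (partial i g) x (t *: u)).
Proof.
move=> dg; rewrite /taylor_rem; under eq_bigr do rewrite mulrBr.
rewrite big_split/= sumrN.
have E : (fun t : R => taylor_poly k.+1 g x (t *: u)) =
  (fun t : R => g x + \sum_(j < k.+1)
     ((j.+1)`!%:R^-1 * taylor_term j.+1 g x u) *: (t ^+ j.+1 : R)).
  apply/funext => s; rewrite /taylor_poly big_ord_recl fact0 invr1 mul1r.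
  congr (_ + _); apply: eq_bigr => j _; rewrite lift0 taylor_termZ.
  by rewrite /GRing.scale/=; ring.
apply: is_deriveB; first exact: is_derive_line.
rewrite E.
have -> : \sum_i u ord0 i * taylor_poly k (partial i g) x (t *: u) =
   0 + \sum_(j < k.+1) ((j.+1)`!%:R^-1 * taylor_term j.+1 g x u) *: (j.+1%:R * t ^+ j : R).
  rewrite add0r /taylor_poly; under eq_bigr do rewrite big_distrr/=.
  rewrite exchange_big/=; apply: eq_bigr => j _.
  rewrite /GRing.scale/= big_distrr/= big_distrl/=; apply: eq_bigr => i _.
  rewrite taylor_termZ factS natrM; field.
  by rewrite nat1r !pnatr_eq0 -lt0n fact_gt0.
apply: is_deriveD.
have -> : (fun t : R => \sum_(j < k.+1) ((j.+1)`!%:R^-1 * taylor_term j.+1 g x u) *: (t ^+ j.+1 : R)) =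
  \sum_(j < k.+1) (fun t : R => ((j.+1)`!%:R^-1 * taylor_term j.+1 g x u) *: (t ^+ j.+1 : R)).
  by apply/funext => s; rewrite fct_sumE.
apply: is_derive_sum => j.
apply: is_deriveZ.
have -> : (fun t : R => t ^+ j.+1) = (@id R) ^+ j.+1.
  by apply/funext => s; rewrite exprfctE.
apply: is_derive_eq.
by rewrite /GRing.scale/= mulr1 mulr_natl.
Qed.

End taylor.

Section taylor_remainder_bound.
Context {R : realType} {d : nat}.
Implicit Types (g : 'rV[R]_d -> R) (x u : 'rV[R]_d).

Lemma sqr_sum_le (I : finType) (a : I -> R) :
  (\sum_i a i) ^+ 2 <= #|I|%:R * \sum_i a i ^+ 2.
Proof.
rewrite expr2 big_distrl/=; under eq_bigr do rewrite big_distrr/=.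
apply: (@le_trans _ _ (\sum_i \sum_j (a i ^+ 2 / 2 + a j ^+ 2 / 2))).
  apply: ler_sum => i _; apply: ler_sum => j _.
  by have := sqr_ge0 (a i - a j); lra.
rewrite (eq_bigr (fun i => #|I|%:R * (a i ^+ 2 / 2) + \sum_j a j ^+ 2 / 2)); last first.
  by move=> i _; rewrite big_split/= sumr_const mulr_natl.
rewrite big_split/= -big_distrr/= -big_distrl/= sumr_const.
set S := \sum_i a i ^+ 2; rewrite -[X in _ + X]mulr_natl -mulrDr.
by rewrite ler_wpM2l//; lra.
Qed.

Let powR_nonneg_bound (a : R) u (t : R) : 0 <= a -> 0 <= t <= 1 ->
  enorm (t *: u) `^ a <= enorm u `^ a.
Proof.
move=> a0 /andP[t0 t1]; apply: ge0_ler_powR; rewrite ?nnegrE ?enorm_ge0//.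
by rewrite enormZ ger0_norm// ler_piMl// enorm_ge0.
Qed.

(** Only the modulus of continuity of the highest derivatives enters: the
remainder of order [k] is an iterated integral along the segment of increments
of derivatives of order [k], and the order of integration is exchanged at each
step. *)
Lemma integral_sqr_taylor_rem_le (nu : {sigma_finite_measure set 'rV[R]_d -> \bar R})
    (k : nat) (M a : R) g : 0 <= M -> 0 <= a ->
  measurable_fun [set: 'rV[R]_d] g -> times_differentiable k g ->
  (forall l, msize l = k -> forall u,
    (\int[nu]_x ((mpartial l g (x + u) - mpartial l g x) ^+ 2)%:E
       <= (M * enorm u `^ a)%:E)%E) ->
  forall u, (\int[nu]_x (taylor_rem k g x u ^+ 2)%:E
     <= (d%:R ^+ (2 * k) * M * enorm u ^+ (2 * k) * enorm u `^ a)%:E)%E.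
Proof.
move=> M0 a0; elim: k g => [|k IH] g mg dg Hg u.
  have := Hg (fun=> 0%N); rewrite /msize big1// => /(_ erefl u).
  rewrite mpartial0; last by rewrite /msize big1.
  rewrite muln0 !expr0 mul1r mulr1; apply: le_trans; rewrite le_eqVlt; apply/orP; left.
  apply/eqP; apply: eq_integral => x _; congr ((_ ^+ 2)%:E).
  by rewrite /taylor_rem /taylor_poly big_ord_recl big_ord0 fact0 invr1 mul1r addr0.
have dg1 x : differentiable g x by case: dg.
have dg2 i : times_differentiable k (partial i g) by case: dg => _ /(_ i).
have mpg i : measurable_fun [set: 'rV[R]_d] (partial i g) by exact: measurable_partial.
have {}IH i v : (\int[nu]_x (taylor_rem k (partial i g) x v ^+ 2)%:E
     <= (d%:R ^+ (2 * k) * M * enorm v ^+ (2 * k) * enorm v `^ a)%:E)%E.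
  apply: IH => // l lk w.
  by rewrite mpartial_partial ?lk//; apply: Hg; rewrite msize_incr lk.
have mrem i : measurable_fun [set: 'rV[R]_d * measurableTypeR R]
    (fun p => taylor_rem k (partial i g) p.1 ((p.2 : R) *: u)).
  apply: measurable_funB.
    apply: measurableT_comp => //; apply: measurable_funDrV => //.
    by apply: measurable_funZrV => //; exact: measurable_snd.
  apply: measurable_sum => j; under eq_fun do rewrite taylor_termZ.
  apply: measurable_funM => //; apply: measurable_funM.
    by apply: measurable_funX; exact: measurable_snd.
  apply: (measurableT_comp (f := fun x => taylor_term j (partial i g) x u)) => //.
  by apply: (measurable_taylor_term (k := k)) => //; rewrite -ltnS.
pose F (p : 'rV[R]_d * measurableTypeR R) : R :=
  d%:R * enorm u ^+ 2 * \sum_i taylor_rem k (partial i g) p.1 ((p.2 : R) *: u) ^+ 2.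
have F0 p : 0 <= F p.
  apply: mulr_ge0; first by rewrite mulr_ge0 ?sqr_ge0.
  by apply: sumr_ge0 => i _; exact: sqr_ge0.
have mF : measurable_fun [set: 'rV[R]_d * measurableTypeR R] F.
  apply: measurable_funM => //; apply: measurable_sum => i.
  exact: measurable_funX.
pose FI p : \bar R := ((F p)%:E * ((\1_(`[0%R, 1%R]%classic : set R) (p.2 : R) : R)%:E))%E.
have mI : measurable_fun [set: 'rV[R]_d * measurableTypeR R]
    (fun p => \1_(`[0%R, 1%R]%classic : set R) (p.2 : R) : R).
  apply: (measurableT_comp (f := \1_(`[0%R, 1%R]%classic : set R) : R -> R)); last exact: measurable_snd.
  exact: measurable_indic.
have mFI : measurable_fun [set: 'rV[R]_d * measurableTypeR R] FI.
  by apply: emeasurable_funM; apply/measurable_EFinP.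
have FI0 p : (0 <= FI p)%E by rewrite mule_ge0// lee_fin.
have FIE x : (\int[lebesgue_measure]_t FI (x, t) = \int[lebesgue_measure]_(t in `[0%R, 1%R]) (F (x, t))%:E)%E.
  rewrite [RHS]integral_mkcond; apply: eq_integral => t _.
  rewrite patchE /FI /= indicE; case: ifPn => _; by rewrite ?(mule1, mule0).
apply: (@le_trans _ _ (\int[nu]_x \int[lebesgue_measure]_t FI (x, t)))%E.
  apply: ge0_le_integral => //.
  - by move=> x _; rewrite lee_fin sqr_ge0.
  - apply/measurable_EFinP; apply: measurable_funX.
    apply: measurable_funB; first by apply: measurableT_comp => //; exact: measurable_funDrV.
    apply: measurable_sum => j; apply: measurable_funM => //.
    by apply: (measurable_taylor_term (k := k.+1)) => //; rewrite -ltnS.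
  - exact: (@measurable_fun_fubini_tonelli_F _ _ _ _ _ (@lebesgue_measure R) _ mFI FI0).
  - move=> x _; rewrite FIE.
    pose DG (t : R) := \sum_i u ord0 i * taylor_rem k (partial i g) x (t *: u).
    have mDG : measurable_fun [set: R] DG.
      apply: measurable_sum => i; apply: measurable_funM => //.
      exact: (measurableT_comp (mrem i) (pair1_measurable x)).
    have := sqr_increment_le_integral_derive
      (G := fun t : R => taylor_rem k.+1 g x (t *: u)) (g := DG).
    rewrite taylor_remS_at0 subr0 scale1r => H.
    apply: le_trans (H _ _) _ => // [t _|].
      exact: is_derive_taylor_rem.
    apply: ge0_le_integral => //.
    + by move=> t _; rewrite lee_fin sqr_ge0.
    + apply/measurable_EFinP; apply: measurable_funX; exact: measurable_funTS.
    + apply/measurable_EFinP; apply: measurable_funTS.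
      exact: (measurableT_comp mF (pair1_measurable x)).
    + move=> t _; rewrite lee_fin /DG /F /=.
      apply: le_trans (sqr_sum_le _) _; rewrite card_ord -mulrA ler_wpM2l//.
      rewrite big_distrr/=; apply: ler_sum => i _; rewrite exprMn ler_wpM2r ?sqr_ge0//.
      by rewrite -(real_normK (num_real (u ord0 i))) lerXn2r ?nnegrE ?enorm_ge0// coord_le_enorm.
rewrite fubini_tonelli//.
set B := (X in (_ <= X%:E)%E).
have B0 : 0 <= B by rewrite /B !mulr_ge0 ?exprn_ge0 ?enorm_ge0 ?powR_ge0.
apply: (@le_trans _ _ (\int[lebesgue_measure]_(t in `[0%R, 1%R]) B%:E)%E); last first.
  by rewrite integral_cst//= lebesgue_measure_itv/= lte01 oppr0 adde0 mule1.
rewrite [leRHS]integral_mkcond; apply: ge0_le_integral => //.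
- by move=> t _; apply: integral_ge0.
- exact: (@measurable_fun_fubini_tonelli_G _ _ _ _ _ nu _ mFI FI0).
- apply/(measurable_restrictT _ _).1 => //; exact: measurable_cst.
move=> t _; rewrite patchE; case: ifPn => t01; last first.
  rewrite (_ : (fun x => FI (x, t)) = cst 0%E) ?integral_cst ?mul0e//.
  by apply/funext => x; rewrite /FI/= indicE (negbTE t01) mule0.
have {}t01 : 0 <= t <= 1 by move: t01; rewrite inE/= in_itv.
have -> : (\int[nu]_x FI (x, t) = (d%:R * enorm u ^+ 2)%:E *
    \sum_i \int[nu]_x (taylor_rem k (partial i g) x (t *: u) ^+ 2)%:E)%E.
  have mr i : measurable_fun [set: 'rV[R]_d] (fun x => (taylor_rem k (partial i g) x (t *: u) ^+ 2)%:E).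
    by apply/measurable_EFinP; apply: measurable_funX; exact: (measurableT_comp (mrem i) (pair2_measurable t)).
  rewrite -ge0_integral_sum//; last by move=> i x _; rewrite lee_fin sqr_ge0.
  rewrite -ge0_integralZl_EFin//.
  - apply: eq_integral => x _; rewrite /FI /F /= indicE mem_set ?mule1/= ?in_itv//.
    by rewrite EFinM sumEFin.
  - by move=> x _; rewrite sume_ge0// => i _; rewrite lee_fin sqr_ge0.
  - by apply: emeasurable_sum.
  - by rewrite mulr_ge0// sqr_ge0.
have -> : B%:E = ((d%:R * enorm u ^+ 2)%:E * \sum_(i < d) (d%:R ^+ (2 * k) * M * enorm u ^+ (2 * k) * enorm u `^ a)%:E)%E.
  rewrite sumEFin -EFinM; congr EFin; rewrite sumr_const card_ord -[X in _ = _ * X]mulr_natr /B.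
  by rewrite !mulnS !exprD; ring.
rewrite lee_wpmul2l ?lee_fin ?mulr_ge0 ?enorm_ge0//.
apply: lee_sum => i _; apply: le_trans (IH i _) _; rewrite lee_fin.
have [t0 t1] := andP t01.
apply: ler_pM; rewrite ?powR_ge0 ?mulr_ge0 ?exprn_ge0 ?enorm_ge0//; last exact: powR_nonneg_bound.
rewrite ler_wpM2l ?mulr_ge0 ?exprn_ge0// lerXn2r ?nnegrE ?enorm_ge0//.
by rewrite enormZ ger0_norm// ler_piMl// enorm_ge0.
Qed.

End taylor_remainder_bound.

(** * Affine substitution and exponential decay on R^n *)

Section lebesgue_rV_integration.
Context {R : realType}.
Local Notation leb := (@lebesgue_measure R).

(** Both sides are measures that agree on intervals. *)
Lemma lebesgue_measure_affine (x h : R) (A : set (measurableTypeR R)) : 0 < h -> measurable A ->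
  (leb A = h%:E * leb ((fun v : R => (x - h * v)%R) @^-1` A))%E.
Proof.
move=> h0 mA.
pose T (v : measurableTypeR R) : measurableTypeR R := (x - h * v)%R.
have mT : measurable_fun setT T by apply: measurable_funB => //; exact: measurable_funM.
pose nu := mscale (NngNum (ltW h0)) (measure_function_pushforward__canonical__measure_function_Measure leb mT).
rewrite (@lebesgue_measure_unique R nu)//.
move=> X [[a b] _ <-].
change (leb `]a, b]%classic = h%:E * leb (T @^-1` `]a, b]%classic))%E.
have -> : T @^-1` `]a, b]%classic = `[(x - b) / h, (x - a) / h[%classic.
  apply/seteqP; split => v /=; rewrite !in_itv/= /T ler_pdivrMr// ltr_pdivlMr// => /andP[? ?]; apply/andP; split; lra.
rewrite !lebesgue_measure_itv/= !lte_fin ltr_pM2r ?invr_gt0// ltrD2l ltrN2.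
case: ifPn => ab; last by rewrite mule0.
by rewrite -!EFinD -EFinM; congr EFin; field; rewrite gt_eqF.
Qed.

Lemma ge0_integral_affine (x h : R) (g : R -> \bar R) : 0 < h ->
  measurable_fun [set: R] g -> (forall y, 0 <= g y)%E ->
  (\int[leb]_v g (x - h * v)%R = (h^-1)%:E * \int[leb]_y g y)%E.
Proof.
move=> h0 mg g0.
pose T (v : measurableTypeR R) : measurableTypeR R := (x - h * v)%R.
have mT : measurable_fun setT T by apply: measurable_funB => //; exact: measurable_funM.
have hi0 : (0 <= h^-1)%R by rewrite invr_ge0 ltW.
rewrite -[LHS](@ge0_integral_pushforward _ _ _ _ R T mT leb setT g)//.
pose nu := mscale (NngNum hi0) leb.
rewrite (eq_measure_integral nu) => [|A mA _].
  by rewrite ge0_integral_mscale.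
change (leb (T @^-1` A) = (h^-1)%:E * leb A)%E.
rewrite (lebesgue_measure_affine x h0 mA) muleA -EFinM.
by rewrite mulVf ?gt_eqF// mul1e.
Qed.

Lemma ge0_integral_rVS n (g : 'rV[R]_n.+1 -> \bar R) :
  measurable_fun [set: 'rV[R]_n.+1] g -> (forall y, 0 <= g y)%E ->
  (\int[lebesgue_rV n.+1]_x g x =
   \int[leb]_a \int[lebesgue_rV n]_v g (consrV (a, v)))%E.
Proof.
move=> mg g0.
transitivity (\int[(leb \x lebesgue_rV n)%E]_p g (consrV p))%E.
  rewrite -(@ge0_integral_pushforward _ _ _ _ R (@consrV R n) (@measurable_consrV R n) (leb \x lebesgue_rV n)%E setT g)//.
rewrite fubini_tonelli1//.
by apply: measurableT_comp => //; exact: measurable_consrV.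
Qed.

Lemma ge0_integral_rV_affine n (x : 'rV[R]_n) (h : R) (g : 'rV[R]_n -> \bar R) : 0 < h ->
  measurable_fun [set: 'rV[R]_n] g -> (forall y, 0 <= g y)%E ->
  (\int[lebesgue_rV n]_v g (x - h *: v)%R = (h ^- n)%:E * \int[lebesgue_rV n]_y g y)%E.
Proof.
move=> h0; elim: n x g => [|n IH] x g mg g0.
  rewrite expr0 invr1 mul1e; apply: eq_integral => v _; congr g.
  by apply/rowP => -[].
have mT : measurable_fun [set: 'rV[R]_n.+1] (fun v => x - h *: v).
  apply/measurable_fun_rVP => i; under eq_fun do rewrite !mxE.
  by apply: measurable_funB => //; apply: measurable_funM => //; exact: measurable_coord.
rewrite ge0_integral_rVS//; last exact: measurableT_comp.
have mgc : measurable_fun setT (fun p => g (consrV p)).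
  by apply: measurableT_comp => //; exact: measurable_consrV.
transitivity (\int[leb]_a ((h ^- n)%:E * \int[lebesgue_rV n]_v g (consrV ((x ord0 ord0 - h * a)%R, v))))%E.
  apply: eq_integral => a _.
  rewrite -(IH (\row_j x ord0 (lift ord0 j)) (fun v => g (consrV ((x ord0 ord0 - h * a)%R, v))))//; last first.
    exact: (measurableT_comp mgc (pair1_measurable _)).
  apply: eq_integral => v _; congr g; apply/rowP => i; rewrite !mxE.
  by case: (unliftP ord0 i) => [j|] ->; rewrite ?liftK ?unlift_none/= ?mxE.
have mF : measurable_fun [set: R] (fun a => \int[lebesgue_rV n]_v g (consrV (a, v)))%E.
  exact: (@measurable_fun_fubini_tonelli_F _ _ _ _ _ (lebesgue_rV n) _ mgc (fun=> g0 _)).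
have F0 a : (0 <= \int[lebesgue_rV n]_v g (consrV (a, v)))%E by exact: integral_ge0.
rewrite (@ge0_integral_affine (x ord0 ord0) h (fun b => (h ^- n)%:E * \int[lebesgue_rV n]_v g (consrV (b, v)))%E)//.
- rewrite ge0_integralZl_EFin// ?ge0_integral_rVS// ?invr_ge0 ?exprn_ge0 ?ltW//.
  by rewrite muleA -EFinM -invfM -exprS.
- by apply: emeasurable_funM.
- by move=> b; rewrite mule_ge0// lee_fin invr_ge0 exprn_ge0// ltW.
Qed.
End lebesgue_rV_integration.

Section exponential_integrals.
Context {R : realType}.
Local Notation leb := (@lebesgue_measure R).

Lemma measurable_expR_abs (c : R) : measurable_fun [set: R] (fun t => expR (- (c * `|t|))).
Proof.
apply: measurableT_comp => //; apply: measurableT_comp => //.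
by apply: measurable_funM => //; exact: measurableT_comp.
Qed.

Lemma integral_expR_abs_lty (c : R) : 0 < c ->
  (\int[leb]_t (expR (- (c * `|t|)))%:E < +oo)%E.
Proof.
move=> c0; pose p (t : R) := (exponential_pdf c t)%:E.
have mp : measurable_fun [set: R] p.
  by apply/measurable_EFinP; exact: measurable_exponential_pdf.
have p0 t : (0 <= p t)%E by rewrite lee_fin exponential_pdf_ge0// ltW.
have mpN : measurable_fun [set: R] (fun t => p (0 - 1 * t)%R).
  apply: (measurableT_comp mp).
  by apply: measurable_funB => //; exact: measurable_funM.
have I1 : (\int[leb]_t p t = 1)%E by exact: integral_exponential_pdf.
have I2 : (\int[leb]_t p (0 - 1 * t)%R = 1)%E.
  by rewrite ge0_integral_affine// I1 invr1 mule1.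
apply: (@le_lt_trans _ _ (\int[leb]_t ((c^-1)%:E * (p t + p (0 - 1 * t)%R)))%E).
  apply: ge0_le_integral => //.
  - by apply/measurable_EFinP; exact: measurable_expR_abs.
  - by apply: emeasurable_funM => //; exact: emeasurable_funD.
  - move=> t _; rewrite /p -EFinD -EFinM lee_fin /exponential_pdf sub0r mul1r.
    rewrite ler_pdivlMl// !patchE; have [t0|t0] := leP 0 t.
      rewrite mem_set/= ?in_itv/= ?t0// ger0_norm// -mulNr lerDl.
      by case: ifPn => // _; rewrite mulr_ge0 ?expR_ge0// ltW.
    rewrite memNset/= ?in_itv/= ?andbT ?leNgt ?t0//.
    rewrite mem_set/= ?in_itv/= ?andbT ?oppr_ge0 ?ltW// add0r ltr0_norm//.
    by rewrite -leNgt mulNr.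
rewrite ge0_integralZl_EFin//.
- rewrite ge0_integralD// I1 I2 -EFinD -EFinM; exact: ltry.
- by move=> t _; rewrite adde_ge0.
- exact: emeasurable_funD.
- by rewrite invr_ge0 ltW.
Qed.

Lemma integral_rV_prod_expR_abs_lty n (c : R) : 0 < c ->
  (\int[lebesgue_rV n]_v (\prod_(i < n) expR (- (c * `|v ord0 i|)))%:E < +oo)%E.
Proof.
move=> c0; elim: n => [|n IH].
  rewrite (@eq_integral _ _ _ _ _ (cst 1%E)); last by move=> v _; rewrite big_ord0.
  by rewrite integral_cst//= mul1e diracT ltry.
have mP k : measurable_fun [set: 'rV[R]_k] (fun v => \prod_(i < k) expR (- (c * `|v ord0 i|))).
  by apply: measurable_prod => i _; apply: (measurableT_comp (measurable_expR_abs c)); exact: measurable_coord.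
rewrite ge0_integral_rVS//; last 2 first.
- by apply/measurable_EFinP; exact: mP.
- by move=> v; rewrite lee_fin prodr_ge0// => i _; exact: expR_ge0.
under eq_integral => a _.
  under eq_integral => v _.
    rewrite big_ord_recl mxE unlift_none/=.
    under eq_bigr do rewrite mxE liftK/=.
    rewrite EFinM; over.
  rewrite ge0_integralZl_EFin ?expR_ge0//; last 2 first.
  - by move=> v _; rewrite lee_fin prodr_ge0// => i _; exact: expR_ge0.
  - by apply/measurable_EFinP; exact: mP.
  over.
set J := (\int[_]_v _)%E in IH *.
have J0 : (0 <= J)%E.
  by apply: integral_ge0 => v _; rewrite lee_fin prodr_ge0// => i _; exact: expR_ge0.
rewrite ge0_integralZr//.
- have I0 : (0 <= \int[leb]_t (expR (- (c * `|t|)))%:E)%E.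
    by apply: integral_ge0 => t _; rewrite lee_fin expR_ge0.
  by apply: lte_mul_pinfty => //; rewrite ge0_fin_numE// integral_expR_abs_lty.
- by apply/measurable_EFinP; exact: measurable_expR_abs.
Qed.

Lemma expR_poly_bound (N : nat) (m : R) : 0 < m ->
  exists2 C : R, 0 < C & forall y, 0 <= y -> (1 + y) ^+ N * expR (- (m * y)) <= C * expR (- (m / 2 * y)).
Proof.
move=> m0; case: N => [|N].
  exists 1 => // y y0; rewrite !mul1r ler_expR lerN2 ler_wpM2r//; lra.
pose e := m / (2 * N.+1%:R).
have e0 : 0 < e by rewrite divr_gt0// mulr_gt0.
exists ((1 + e^-1) ^+ N.+1) => [|y y0]; first by rewrite exprn_gt0// addr_gt0// invr_gt0.
have -> : - (m * y) = - (m / 2 * y) - N.+1%:R * (e * y).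
  by rewrite /e; field; rewrite nat1r pnatr_eq0.
rewrite expRD mulrCA [leRHS]mulrC ler_wpM2l ?expR_ge0// expRN.
rewrite ler_pdivrMr ?expR_gt0// expRM_natl -exprMn lerXn2r ?nnegrE ?addr_ge0//.
  by rewrite mulr_ge0 ?expR_ge0// addr_ge0// invr_ge0 ltW.
apply: (@le_trans _ _ ((1 + e^-1) * (1 + e * y))).
  have -> : (1 + e^-1) * (1 + e * y) = 1 + y + (e^-1 + e * y) by field; rewrite gt_eqF.
  rewrite lerDl; apply: addr_ge0; first by rewrite invr_ge0 ltW.
  by apply: mulr_ge0 => //; exact: ltW.
by rewrite ler_wpM2l ?expR_ge1Dx// addr_ge0// invr_ge0 ltW.
Qed.

(** Half of the exponential rate absorbs the polynomial growth; the Euclidean norm dominates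
the average of the absolute values of the coordinates, so the other half is dominated by a product of
one-dimensional exponentials. *)
Lemma exp_decay_moment_lty d (K : 'rV[R]_d -> R) (m1 m2 : R) (N : nat) :
  0 < m2 -> measurable_fun [set: 'rV[R]_d] K ->
  (forall x, `|K x| <= m1 * expR (- (m2 * enorm x))) ->
  (\int[lebesgue_rV d]_v ((1 + enorm v) ^+ N * `|K v|)%:E < +oo)%E.
Proof.
move=> m20 mK HK.
have [C C0 HC] := expR_poly_bound N m20.
pose c := m2 / 2 / (d%:R + 1).
have c0 : 0 < c by rewrite !divr_gt0// ltr_wpDl.
have m10 : 0 <= m1.
  by have := le_trans (normr_ge0 _) (HK 0); rewrite pmulr_lge0// expR_gt0.
have mP : measurable_fun [set: 'rV[R]_d] (fun v => \prod_(i < d) expR (- (c * `|v ord0 i|))).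
  by apply: measurable_prod => i _; apply: (measurableT_comp (measurable_expR_abs c)); exact: measurable_coord.
apply: (@le_lt_trans _ _ (\int[lebesgue_rV d]_v ((m1 * C)%:E * (\prod_(i < d) expR (- (c * `|v ord0 i|)))%:E))%E).
  apply: ge0_le_integral => //.
  - by move=> v _; rewrite lee_fin mulr_ge0// exprn_ge0// addr_ge0// enorm_ge0.
  - apply/measurable_EFinP; apply: measurable_funM; last exact: measurableT_comp.
    by apply: measurable_funX; apply: measurable_funD => //; exact: measurable_enorm.
  - by apply: emeasurable_funM => //; apply/measurable_EFinP.
  move=> v _; rewrite -EFinM lee_fin.
  apply: (@le_trans _ _ (m1 * ((1 + enorm v) ^+ N * expR (- (m2 * enorm v))))).
    by rewrite mulrCA ler_wpM2l// exprn_ge0// addr_ge0// enorm_ge0.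
  rewrite -mulrA ler_wpM2l//; apply: le_trans (HC _ (enorm_ge0 v)) _.
  have -> : \prod_(i < d) expR (- (c * `|v ord0 i|)) = expR (- (c * \sum_(i < d) `|v ord0 i|)).
    by rewrite big_distrr/= -sumrN expR_sum.
  apply: ler_wpM2l; first exact: ltW.
  rewrite ler_expR lerN2 /c.
  rewrite -mulrA ler_wpM2l//; first by rewrite divr_ge0// ltW.
  rewrite ler_pdivrMl ?ltr_wpDl//.
  apply: (@le_trans _ _ (\sum_(i < d) enorm v)); first by apply: ler_sum => i _; exact: coord_le_enorm.
  by rewrite sumr_const card_ord -[leLHS]mulr_natl ler_wpM2r ?enorm_ge0// lerDl.
rewrite ge0_integralZl_EFin//.
- apply: lte_mul_pinfty => //; last exact: integral_rV_prod_expR_abs_lty.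
  by rewrite lee_fin mulr_ge0// ltW.
- by move=> v _; rewrite lee_fin prodr_ge0// => i _; exact: expR_ge0.
- by apply/measurable_EFinP; exact: mP.
- by rewrite mulr_ge0// ltW.
Qed.

End exponential_integrals.

(** * Uniform Taylor remainders *)

Section partial_mpartial.
Context {R : realType} {d : nat}.
Implicit Types (g : 'rV[R]_d -> R) (i : 'I_d) (l : 'I_d -> nat).

Lemma partials_partialC s l i g : times_differentiable (\sum_(j <- s) l j).+1 g ->
  partials s l (partial i g) = partial i (partials s l g).
Proof.
elim: s => [//|j s IH]; rewrite big_cons => dg.
rewrite /= IH; last by apply: times_differentiableW dg; rewrite ltnS leq_addl.
by rewrite iter_partialC//; apply: times_differentiable_partials; rewrite addnS addnC.
Qed.

Lemma partial_mpartial l i g : times_differentiable (msize l).+1 g ->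
  partial i (mpartial l g) = mpartial (incr i l) g.
Proof.
move=> dg; rewrite -mpartial_partial//; apply/esym/partials_partialC.
by rewrite big_enum.
Qed.

Lemma lipschitz_of_bounded_partials g (B : R) : (forall x, differentiable g x) ->
  (forall i x, `|partial i g x| <= B) ->
  forall x u, `|g (x + u) - g x| <= d%:R * B * enorm u.
Proof.
move=> dg HB x u; pose G (t : R) := g (x + t *: u).
have dG t : is_derive t (1 : R) G (\sum_i u ord0 i * partial i g (x + t *: u)).
  exact: is_derive_line.
have cG : {within `[(0:R), 1], continuous G}.
  apply: continuous_subspaceT => s.
  by apply: differentiable_continuous; apply/derivable1_diffP; case: (dG s).
have [t _] := MVT_segment ler01 (fun s _ => dG s) cG.
rewrite subr0 mulr1 /G scale1r scale0r addr0 => ->.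
apply: le_trans (ler_norm_sum _ _ _) _.
apply: (@le_trans _ _ (\sum_(i < d) enorm u * B)).
  by apply: ler_sum => i _; rewrite normrM ler_pM// coord_le_enorm.
by rewrite sumr_const card_ord -[leLHS]mulr_natl; lra.
Qed.

(** There are finitely many multi-indices of a given order. *)
Lemma uniform_multiindex_bound k (P : ('I_d -> nat) -> R -> Prop) :
  (forall l B B', P l B -> B <= B' -> P l B') ->
  (forall l, (msize l <= k)%N -> exists B, P l B) ->
  exists2 B : R, 0 <= B & forall l, (msize l <= k)%N -> P l B.
Proof.
move=> Pmon Pex.
have /choice[b Hb] (F : {ffun 'I_d -> 'I_k.+1}) : exists B : R,
    (msize (fun i => F i : nat) <= k)%N -> P (fun i => F i : nat) B.
  have [Fk|Fk] := leqP (msize (fun i => F i : nat)) k; last by exists 0.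
  by have [B HB] := Pex _ Fk; exists B.
exists (\sum_F `|b F|) => [|l lk]; first by rewrite sumr_ge0.
have lE i : (l i <= k)%N.
  by apply: leq_trans lk; rewrite /msize (bigD1 i)//= leq_addr.
pose F : {ffun 'I_d -> 'I_k.+1} := [ffun i => inord (l i)].
have FE : (fun i => F i : nat) = l.
  by apply/funext => i; rewrite ffunE inordK// ltnS.
have := Hb F; rewrite FE => /(_ lk)/Pmon; apply.
rewrite (bigD1 F)//=; apply: le_trans (ler_norm _) _.
by rewrite lerDl sumr_ge0.
Qed.

(** A function with bounded derivatives of order [k + 1] has derivatives of order
[k] that are uniformly Lipschitz, and the Dirac mass at [x] turns the
mean-square remainder bound into a uniform one. *)
Lemma taylor_rem_le (k : nat) g : measurable_fun [set: 'rV[R]_d] g ->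
  times_differentiable k.+1 g ->
  (forall l, msize l = k.+1 -> bounded_fun (mpartial l g)) ->
  exists2 C : R, 0 <= C & forall x u, `|taylor_rem k g x u| <= C * enorm u ^+ k.+1.
Proof.
move=> mg dg Hb.
have [B B0 HB] : exists2 B : R, 0 <= B & forall l, (msize l <= k.+1)%N ->
    msize l = k.+1 -> forall x, `|mpartial l g x| <= B.
  apply: uniform_multiindex_bound => [l B B' HB BB' lk x|l _].
    by rewrite (le_trans (HB lk x)).
  have [lk|nlk] := eqVneq (msize l) k.+1; last by exists 0 => lk; rewrite lk eqxx in nlk.
  have [B0 [_ HB]] := Hb l lk.
  by exists (B0 + 1) => _ x; apply: HB => //; rewrite ltrDl.
have C0 : 0 <= d%:R * B by rewrite mulr_ge0.
exists (d%:R ^+ k * (d%:R * B)) => [|x u]; first by rewrite mulr_ge0 ?exprn_ge0.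
have dm l : (msize l <= k)%N -> measurable_fun [set: 'rV[R]_d] (mpartial l g).
  by move=> lk; apply: (measurable_mpartial (k := k.+1)) => //; exact: leqW.
have := @integral_sqr_taylor_rem_le R d (dirac x) k ((d%:R * B) ^+ 2) 2 g.
move=> /(_ (sqr_ge0 _) (ltW (ltr0n _ 2)) mg (times_differentiableS dg)).
have dirE (q : 'rV[R]_d -> R) : measurable_fun [set: 'rV[R]_d] q ->
    (\int[dirac x]_y (q y)%:E = (q x)%:E)%E.
  by move=> mq; rewrite integral_dirac// ?diracT ?mul1e//; apply/measurable_EFinP.
have shift_m (q : 'rV[R]_d -> R) v : measurable_fun [set: 'rV[R]_d] q ->
    measurable_fun [set: 'rV[R]_d] (fun y => q (y + v)) .
  by move=> mq; apply: (measurableT_comp mq); exact: measurable_funDrV.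
have mrem : measurable_fun [set: 'rV[R]_d] (fun y => taylor_rem k g y u).
  apply: measurable_funB; first exact: shift_m.
  apply: measurable_sum => j; apply: measurable_funM => //.
  apply: (measurable_taylor_term (k := k)) => //; first by rewrite -ltnS.
  exact: times_differentiableS.
move=> /(_ _ u); rewrite dirE; last exact: measurable_funX.
rewrite lee_fin powR_mulrn ?enorm_ge0// => H.
have E : taylor_rem k g x u ^+ 2 <= (d%:R ^+ k * (d%:R * B) * enorm u ^+ k.+1) ^+ 2.
  apply: le_trans (H _) _ => [l lk v|].
    rewrite dirE; last first.
      by apply: measurable_funX; apply: measurable_funB; [apply: shift_m|]; apply: dm; rewrite lk.
    rewrite lee_fin powR_mulrn ?enorm_ge0// -exprMn -(real_normK (num_real (_ - _))).
    rewrite lerXn2r ?nnegrE ?mulr_ge0 ?enorm_ge0//.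
    have d1 : times_differentiable 1 (mpartial l g).
      by apply: times_differentiable_mpartial; rewrite lk addn1.
    apply: lipschitz_of_bounded_partials; first by case: d1.
    move=> i y; rewrite partial_mpartial ?lk//.
    by apply: HB; rewrite msize_incr lk.
  rewrite le_eqVlt; apply/orP; left; apply/eqP.
  by rewrite (mulnC 2 k) !exprM [enorm u ^+ k.+1]exprS; ring.
rewrite -(@ler_pXn2r _ 2)// ?nnegrE ?mulr_ge0 ?exprn_ge0 ?enorm_ge0//.
by rewrite real_normK ?num_real.
Qed.

End partial_mpartial.

(** * Polynomials in the increment with variable coefficients *)

(** Every random quantity of the probabilistic part belongs to this class, so that its
moments are finite. *)
Definition bounded_measurable d (T : measurableType d) (R : realType) (c : T -> R) : Prop :=
  measurable_fun [set: T] c /\ exists B : R, forall x, `|c x| <= B.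

Section polynomial_fields.
Context {R : realType} {d : nat}.
Local Notation V := 'rV[R]_d.
Implicit Types (C : (V -> R) -> Prop) (p q : V -> V -> R) (l : 'I_d -> nat) (u v x : V).

Lemma monomial0 u : monomial (fun=> 0%N) u = 1.
Proof. by rewrite /monomial big1. Qed.

Lemma monomialD l1 l2 u :
  monomial (fun i => l1 i + l2 i)%N u = monomial l1 u * monomial l2 u.
Proof. by rewrite /monomial -big_split/=; apply: eq_bigr => i _; rewrite exprD. Qed.

Lemma monomial_incr i l u : monomial (incr i l) u = u ord0 i * monomial l u.
Proof.
rewrite monomialD mulrC; congr (_ * _).
rewrite /monomial (bigD1 i)//= eqxx expr1 big1 ?mulr1// => j ji.
by rewrite (negbTE ji) expr0.
Qed.

Lemma monomialZ l (t : R) u : monomial l (t *: u) = t ^+ msize l * monomial l u.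
Proof.
rewrite /monomial /msize -prodrXr -big_split/=; apply: eq_bigr => i _.
by rewrite mxE exprMn.
Qed.

Lemma monomial_at0 l : monomial l (0 : V) = (msize l == 0%N)%:R.
Proof.
rewrite -(scale0r (0 : V)) monomialZ expr0n; case: eqP => l0; last by rewrite mul0r.
rewrite mul1r /monomial big1// => i _.
move/eqP: l0; rewrite /msize sum_nat_eq0 => /forallP/(_ i)/= /eqP ->.
by rewrite expr0.
Qed.

Lemma normr_monomial_le l u : `|monomial l u| <= enorm u ^+ msize l.
Proof.
rewrite /monomial normr_prod /msize -prodrXr; apply: ler_prod => i _.
by rewrite normr_ge0/= normrX lerXn2r ?nnegrE ?enorm_ge0// coord_le_enorm.
Qed.

(** The class [C] of coefficients is a parameter because the coefficients coming from [f]
are bounded whereas those coming from [phi] are only square integrable. *)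
Definition polyfield C (N : nat) p : Prop :=
  exists (J : finType) (c : J -> V -> R) (l : J -> 'I_d -> nat),
    [/\ forall j, C (c j), forall j, (msize (l j) <= N)%N &
        forall x u, p x u = \sum_j c j x * monomial (l j) u].

Lemma polyfieldW C N N' p : (N <= N')%N -> polyfield C N p -> polyfield C N' p.
Proof.
move=> NN [J [c [l [Cc lN E]]]]; exists J, c, l; split=> // j.
exact: leq_trans NN.
Qed.

Lemma polyfield_coef C c : C c -> polyfield C 0 (fun x _ => c x).
Proof.
move=> Cc; exists unit, (fun=> c), (fun _ _ => 0%N); split=> // [_|x u].
  by rewrite /msize big1.
by rewrite (big_pred1 tt) ?monomial0 ?mulr1// => -[].
Qed.

Lemma polyfield0 C N : polyfield C N (fun _ _ => 0).
Proof.
by exists void, (fun=> fun=> 0), (fun _ _ => 0%N); split=> [[]|[]|x u]//; rewrite big1// => -[].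
Qed.

Lemma polyfieldD C N p q : polyfield C N p -> polyfield C N q ->
  polyfield C N (fun x u => p x u + q x u).
Proof.
move=> [J [c [l [Cc lN E]]]] [J' [c' [l' [Cc' lN' E']]]].
exists (J + J')%type, (fun a => match a with inl j => c j | inr j => c' j end),
  (fun a => match a with inl j => l j | inr j => l' j end).
by split=> [[]|[]|x u]//; rewrite big_sumType/= E E'.
Qed.

Lemma polyfield_sum C N (I : Type) (s : seq I) (P : I -> V -> V -> R) :
  (forall i, polyfield C N (P i)) -> polyfield C N (fun x u => \sum_(i <- s) P i x u).
Proof.
move=> CP; elim: s => [|i s IH].
  by rewrite (_ : (fun _ _ => _) = (fun _ _ => 0)) //; [exact: polyfield0|apply/funext => x; apply/funext => u; rewrite big_nil].
rewrite (_ : (fun _ _ => _) = (fun x u => P i x u + \sum_(i <- s) P i x u)).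
  exact: polyfieldD.
by apply/funext => x; apply/funext => u; rewrite big_cons.
Qed.

Lemma polyfieldM (C1 C2 C : (V -> R) -> Prop) N1 N2 p q :
  (forall c1 c2, C1 c1 -> C2 c2 -> C (fun x => c1 x * c2 x)) ->
  polyfield C1 N1 p -> polyfield C2 N2 q ->
  polyfield C (N1 + N2) (fun x u => p x u * q x u).
Proof.
move=> CM [J [c [l [Cc lN E]]]] [J' [c' [l' [Cc' lN' E']]]].
exists (J * J')%type, (fun a x => c a.1 x * c' a.2 x), (fun a i => l a.1 i + l' a.2 i)%N.
split=> [a|a|x u]; first exact: CM.
  by rewrite /msize big_split; apply: leq_add; [exact: lN|exact: lN'].
rewrite E E' big_distrlr/= pair_bigA/=; apply: eq_bigr => a _.
by rewrite monomialD mulrACA.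
Qed.

Lemma polyfield_coefM (C C' : (V -> R) -> Prop) N (a : V -> R) p :
  (forall c, C c -> C' (fun x => a x * c x)) -> polyfield C N p ->
  polyfield C' N (fun x u => a x * p x u).
Proof.
move=> CC [J [c [l [Cc lN E]]]]; exists J, (fun j x => a x * c j x), l.
split=> // [j|x u]; first exact: CC.
by rewrite E big_distrr/=; apply: eq_bigr => j _; rewrite mulrA.
Qed.

Lemma polyfield_coord C N i p : polyfield C N p ->
  polyfield C N.+1 (fun x u => u ord0 i * p x u).
Proof.
move=> [J [c [l [Cc lN E]]]]; exists J, c, (fun j => incr i (l j)).
split=> // [j|x u]; first by rewrite msize_incr ltnS.
by rewrite E big_distrr/=; apply: eq_bigr => j _; rewrite monomial_incr mulrCA.
Qed.

Lemma polyfield_taylor_term C j (g : V -> R) : times_differentiable j g ->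
  (forall l, (msize l <= j)%N -> C (mpartial l g)) ->
  polyfield C j (taylor_term j g).
Proof.
elim: j g => [|j IH] g dg Hg /=.
  apply: polyfield_coef; rewrite -(@mpartial0 _ _ (fun=> 0%N) g) ?/msize ?big1//.
  by apply: Hg; rewrite /msize big1.
apply: polyfield_sum => i; apply: polyfield_coord; apply: IH.
  by case: dg => _ /(_ i).
move=> l lj; rewrite mpartial_partial; last by apply: times_differentiableW dg; rewrite ltnS.
by apply: Hg; rewrite msize_incr.
Qed.

Lemma polyfield_taylor_poly C k (g : V -> R) :
  (forall (a : R) c, C c -> C (fun x => a * c x)) ->
  times_differentiable k g ->
  (forall l, (msize l <= k)%N -> C (mpartial l g)) ->
  polyfield C k (taylor_poly k g).
Proof.
move=> CZ dg Hg; apply: polyfield_sum => j.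
apply: (@polyfield_coefM C C k (fun=> (j`!)%:R^-1)); first by move=> c; exact: CZ.
have jk : (j <= k)%N by rewrite -ltnS.
apply: (polyfieldW jk); apply: polyfield_taylor_term.
  exact: times_differentiableW dg.
by move=> l lj; apply: Hg; exact: leq_trans jk.
Qed.

Lemma polyfield_bound N p : polyfield (@bounded_measurable _ V R) N p ->
  exists2 B : R, 0 <= B & forall x u, `|p x u| <= B * (1 + enorm u) ^+ N.
Proof.
move=> [J [c [l [Cc lN E]]]].
have /choice[B HB] j : exists B : R, forall x, `|c j x| <= B by case: (Cc j).
have B0 j : 0 <= B j by apply: le_trans (HB j 0).
exists (\sum_j B j) => [|x u]; first by rewrite sumr_ge0.
rewrite E big_distrl/=; apply: le_trans (ler_norm_sum _ _ _) _.
apply: ler_sum => j _; rewrite normrM ler_pM//.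
apply: le_trans (normr_monomial_le _ _) _.
have e0 := enorm_ge0 u.
apply: (@le_trans _ _ ((1 + enorm u) ^+ msize (l j))).
  by rewrite lerXn2r ?nnegrE ?addr_ge0// lerDr.
by rewrite ler_weXn2l// lerDl.
Qed.

Lemma polyfield_lipschitz_bound N p : polyfield (@bounded_measurable _ V R) N p ->
  exists2 B : R, 0 <= B & forall x u, `|p x u - p x 0| <= B * (enorm u * (1 + enorm u) ^+ N).
Proof.
move=> [J [c [l [Cc lN E]]]].
have /choice[B HB] j : exists B : R, forall x, `|c j x| <= B by case: (Cc j).
have B0 j : 0 <= B j by apply: le_trans (HB j 0).
exists (\sum_j B j) => [|x u]; first by rewrite sumr_ge0.
have e0 := enorm_ge0 u.
rewrite !E -sumrB big_distrl/=; apply: le_trans (ler_norm_sum _ _ _) _.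
apply: ler_sum => j _; rewrite -mulrBr normrM ler_pM// monomial_at0.
have [l0|l0] := eqVneq (msize (l j)) 0%N.
  have /eqP := l0; rewrite /msize sum_nat_eq0 => /forallP lj0.
  have -> : monomial (l j) u = 1.
    by rewrite /monomial big1// => i _; have /eqP -> := lj0 i.
  by rewrite subrr normr0 mulr_ge0// exprn_ge0// addr_ge0.
rewrite subr0; apply: le_trans (normr_monomial_le _ _) _.
case: (msize (l j)) l0 (lN j) => // n _ nN; rewrite exprS ler_wpM2l//.
apply: (@le_trans _ _ ((1 + enorm u) ^+ n)).
  by rewrite lerXn2r ?nnegrE ?addr_ge0// lerDr.
by rewrite ler_weXn2l ?lerDl// ltnW.
Qed.

End polynomial_fields.

(** * Smoothing by a kernel of order r *)

Lemma Rintegral_sum d (T : measurableType d) (R : realType)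
    (mu : {measure set T -> \bar R}) (I : Type) (s : seq I) (F : I -> T -> R) :
  (forall i, mu.-integrable [set: T] (EFin \o F i)) ->
  \int[mu]_x (\sum_(i <- s) F i x) = \sum_(i <- s) \int[mu]_x F i x.
Proof.
move=> iF; elim: s => [|i s IH].
  rewrite big_nil -[RHS](@Rintegral_set0 _ _ _ mu (fun=> 0)).
  under eq_Rintegral do rewrite big_nil.
  by rewrite Rintegral_set0 /Rintegral integral0.
under eq_Rintegral do rewrite big_cons.
rewrite RintegralD// ?IH ?big_cons//.
rewrite (_ : EFin \o _ = fun x => (\sum_(j <- s) (EFin \o F j) x)%E); last first.
  by apply/funext => x /=; rewrite sumEFin.
by apply: integrable_sum.
Qed.

Section kernel_smoothing.
Context {R : realType} {d : nat}.
Local Notation V := 'rV[R]_d.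
Local Notation leb := (lebesgue_rV d).
Variables (K : V -> R) (r : nat) (m1 m2 : R).
Hypotheses (r_ge1 : (1 <= r)%N) (mK : measurable_fun [set: V] K).
Hypothesis K_int1 : \int[leb]_x K x = 1.
Hypothesis K_mom : forall l, (0 < msize l <= r.-1)%N -> \int[leb]_x (monomial l x * K x) = 0.
Hypotheses (m2_gt0 : 0 < m2) (K_exp : forall x, `|K x| <= m1 * expR (- (m2 * enorm x))).

Definition kernel_moment N : R := \int[leb]_v ((1 + enorm v) ^+ N * `|K v|).

Let measurable_growth N : measurable_fun [set: V] (fun v => (1 + enorm v) ^+ N).
Proof.
by apply: measurable_funX; apply: measurable_funD => //; exact: measurable_enorm.
Qed.

Lemma growth_ge0 N (v : V) : 0 <= (1 + enorm v) ^+ N.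
Proof. by rewrite exprn_ge0// addr_ge0// enorm_ge0. Qed.

Lemma integrable_kernel_moment N :
  leb.-integrable [set: V] (fun v => ((1 + enorm v) ^+ N * `|K v|)%:E).
Proof.
apply/integrableP; split.
  apply/measurable_EFinP; apply: measurable_funM; first exact: measurable_growth.
  exact: measurableT_comp.
apply: le_lt_trans (exp_decay_moment_lty N m2_gt0 mK K_exp).
rewrite le_eqVlt; apply/orP; left; apply/eqP; apply: eq_integral => v _.
by rewrite /= ger0_norm// mulr_ge0// growth_ge0.
Qed.

Lemma kernel_moment_ge0 N : 0 <= kernel_moment N.
Proof. by apply: Rintegral_ge0 => v _; rewrite mulr_ge0// growth_ge0. Qed.

Lemma integrable_kernelM N (B : R) (F : V -> R) : measurable_fun [set: V] F ->
  (forall v, `|F v| <= B * (1 + enorm v) ^+ N) ->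
  leb.-integrable [set: V] (fun v => (K v * F v)%:E).
Proof.
move=> mF HF.
apply: (@le_integrable _ _ _ _ _ _ _ (fun v => (B%:E * ((1 + enorm v) ^+ N * `|K v|)%:E)%E)) => //.
- by apply/measurable_EFinP; exact: measurable_funM.
- move=> v _; rewrite /= lee_fin normrM; apply: (@le_trans _ _ (B * (1 + enorm v) ^+ N * `|K v|)).
    by rewrite mulrC ler_wpM2r.
  by rewrite -mulrA ler_norm.
- exact: integrableZl (integrable_kernel_moment N).
Qed.

Lemma norm_integral_kernelM N (B : R) (F : V -> R) : measurable_fun [set: V] F ->
  (forall v, `|F v| <= B * (1 + enorm v) ^+ N) ->
  `|\int[leb]_v (K v * F v)| <= B * kernel_moment N.
Proof.
move=> mF HF; have iKF := integrable_kernelM mF HF.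
apply: le_trans (le_normr_Rintegral _ iKF) _ => //.
rewrite /kernel_moment -RintegralZl//; last exact: integrable_kernel_moment.
apply: le_Rintegral => //.
- exact: integrable_norm.
- exact: integrableZl (integrable_kernel_moment N).
- move=> v _; rewrite normrM [leRHS]mulrA mulrC ler_wpM2r//.
Qed.

(** The moment conditions of a kernel of order [r], together with its unit mass. *)
Lemma integral_kernel_monomial l : (msize l <= r.-1)%N ->
  \int[leb]_v (K v * monomial l v) = (msize l == 0%N)%:R.
Proof.
move=> lr; under eq_Rintegral do rewrite mulrC.
have [l0|l0] := eqVneq (msize l) 0%N; last by rewrite K_mom// lt0n l0.
rewrite -K_int1; apply: eq_Rintegral => v _.
have /eqP := l0; rewrite /msize sum_nat_eq0 => /forallP lj0.
have -> : monomial l v = 1.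
  by rewrite /monomial big1// => i _; have /eqP -> := lj0 i.
by rewrite mul1r.
Qed.

Lemma integrable_kernel_monomial l :
  leb.-integrable [set: V] (fun v => (K v * monomial l v)%:E).
Proof.
apply: (integrable_kernelM (N := msize l) (B := 1)); first exact: measurable_monomial.
move=> v; rewrite mul1r; apply: le_trans (normr_monomial_le _ _) _.
by rewrite lerXn2r ?nnegrE ?enorm_ge0 ?addr_ge0 ?enorm_ge0// lerDr.
Qed.

Lemma integral_kernel_polyfield (J : finType) (c : J -> R) (l : J -> 'I_d -> nat) (h : R) :
  \int[leb]_v (K v * \sum_j c j * monomial (l j) (- (h *: v))) =
  \sum_j c j * (- h) ^+ msize (l j) * \int[leb]_v (K v * monomial (l j) v).
Proof.
have E v : K v * \sum_j c j * monomial (l j) (- (h *: v)) =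
   \sum_j c j * (- h) ^+ msize (l j) * (K v * monomial (l j) v).
  rewrite big_distrr/=; apply: eq_bigr => j _.
  by rewrite -scaleNr monomialZ; ring.
under eq_Rintegral do rewrite E.
rewrite Rintegral_sum.
  by apply: eq_bigr => j _; rewrite RintegralZl//; exact: integrable_kernel_monomial.
by move=> j; exact: (integrableZl _ _ (integrable_kernel_monomial (l j))).
Qed.

Lemma kernel_reproduces C p x (h : R) : polyfield C r.-1 p ->
  \int[leb]_v (K v * p x (- (h *: v))) = p x 0.
Proof.
move=> [J [c [l [_ lN E]]]]; under eq_Rintegral do rewrite E.
rewrite (integral_kernel_polyfield (fun j => c j x)) E.
apply: eq_bigr => j _; rewrite integral_kernel_monomial// monomial_at0.
by case: eqP => [->|]; rewrite ?expr0 ?mulr0// !mulr1.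
Qed.

(** Monomials of degree less than [r] contribute exactly their value at zero; those of degree
at least [r] carry a factor [h ^+ r] since [h] is at most one. *)
Lemma kernel_almost_reproduces C N p : polyfield C N p ->
  exists (J : finType) (c : J -> V -> R) (B : R), [/\ forall j, C (c j), 0 <= B &
   forall x (h : R), 0 < h <= 1 ->
     `|\int[leb]_v (K v * p x (- (h *: v))) - p x 0| <= h ^+ r * B * \sum_j `|c j x| ].
Proof.
move=> [J [c [l [Cc lN E]]]].
exists J, c, (\sum_j `|\int[leb]_v (K v * monomial (l j) v)|); split=> // [|x h /andP[h0 h1]].
  by rewrite sumr_ge0.
under eq_Rintegral do rewrite E.
rewrite (integral_kernel_polyfield (fun j => c j x)) E -sumrB big_distrr/=.
apply: le_trans (ler_norm_sum _ _ _) _; apply: ler_sum => j _.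
have rhs0 : 0 <= h ^+ r * (\sum_i `|\int[leb]_v (K v * monomial (l i) v)|) * `|c j x|.
  rewrite mulr_ge0// mulr_ge0//; first by rewrite exprn_ge0// ltW.
  exact: sumr_ge0.
rewrite monomial_at0; have [lr|lr] := leqP (msize (l j)) r.-1.
  rewrite integral_kernel_monomial//; case: eqP => [->|_].
    by rewrite expr0 !mulr1 subrr normr0.
  by rewrite !mulr0 subrr normr0.
have rl : (r <= msize (l j))%N by rewrite -(prednK r_ge1).
rewrite (_ : msize (l j) == 0%N = false) ?mulr0 ?subr0; last first.
  by apply/negbTE; rewrite -lt0n (leq_trans r_ge1).
rewrite !normrM normrX normrN (gtr0_norm h0) -mulrA mulrC ler_wpM2r//.
rewrite ler_pM ?exprn_ge0 ?(ltW h0)//; first by rewrite ler_wiXn2l// ltW.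
by rewrite (bigD1 j)//= lerDl sumr_ge0.
Qed.

Lemma integrable_kernel_polyfield C N p x (h : R) : polyfield C N p ->
  leb.-integrable [set: V] (fun v => (K v * p x (- (h *: v)))%:E).
Proof.
move=> [J [c [l [Cc lN E]]]].
rewrite (_ : (fun v => _) = (fun v => (\sum_j ((c j x * (- h) ^+ msize (l j))%:E * (K v * monomial (l j) v)%:E))%E)).
  apply: integrable_sum => // j _.
  exact: (integrableZl _ _ (integrable_kernel_monomial (l j))).
apply/funext => v; rewrite E big_distrr/= -sumEFin; apply: eq_bigr => j _.
by rewrite -EFinM -scaleNr monomialZ; congr EFin; ring.
Qed.

Let measurable_homothety (h : R) : measurable_fun [set: V] (fun v => - (h *: v)).
Proof.
apply/measurable_fun_rVP => i; under eq_fun do rewrite !mxE.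
by apply: measurableT_comp => //; apply: measurable_funM => //; exact: measurable_coord.
Qed.

Lemma measurable_polyfield_inc C N p x (h : R) : polyfield C N p ->
  measurable_fun [set: V] (fun v => p x (- (h *: v))).
Proof.
move=> [J [c [l [Cc lN E]]]].
rewrite (_ : (fun v => _) = fun v => \sum_j c j x * monomial (l j) (- (h *: v))).
  apply: measurable_sum => j; apply: measurable_funM => //.
  exact: (measurableT_comp (measurable_monomial (l j)) (measurable_homothety h)).
by apply/funext => v; rewrite E.
Qed.

Lemma measurable_smoothing (g : V -> R) x (h : R) : measurable_fun [set: V] g ->
  measurable_fun [set: V] (fun v => g (x - h *: v)).
Proof.
move=> mg; apply: (measurableT_comp mg); exact: measurable_funDrV.
Qed.

(** The bias of kernel smoothing: the Taylor polynomial is reproduced and the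
remainder is of order [h ^+ r]. *)
Lemma kernel_bias (f : V -> R) : bounded_fun f -> measurable_fun [set: V] f ->
  times_differentiable r f ->
  (forall l, msize l = r -> bounded_fun (mpartial l f)) ->
  exists2 C : R, 0 <= C & forall x (h : R), 0 < h <= 1 ->
    `|\int[leb]_v (K v * f (x - h *: v)) - f x| <= C * h ^+ r.
Proof.
move=> [B0 [_ HB]] mf df fb.
have rE : r.-1.+1 = r by rewrite prednK.
have := taylor_rem_le (k := r.-1) mf; rewrite rE => /(_ df fb)[C C0 HC].
exists (C * kernel_moment r) => [|x h /andP[h0 h1]].
  by rewrite mulr_ge0// kernel_moment_ge0.
have pT : polyfield (fun=> True) r.-1 (taylor_poly r.-1 f).
  by apply: polyfield_taylor_poly => //; apply: times_differentiableW df; exact: leq_pred.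
have i1 : leb.-integrable [set: V] (fun v => (K v * f (x - h *: v))%:E).
  apply: (@integrable_kernelM 0 (B0 + 1)); first exact: measurable_smoothing.
  by move=> v; rewrite expr0 mulr1; apply: (HB (B0 + 1)) => //; rewrite ltrDl.
have i2 := integrable_kernel_polyfield x h pT.
rewrite -(taylor_polyx0 r.-1 f x) -(kernel_reproduces x h pT) -RintegralB//.
under eq_Rintegral do rewrite -mulrBr.
rewrite mulrAC; apply: norm_integral_kernelM.
  apply: measurable_funB; first exact: measurable_smoothing.
  exact: measurable_polyfield_inc pT.
move=> v; apply: le_trans (HC _ _) _; rewrite enormN enormZ (gtr0_norm h0).
rewrite exprMn -mulrA ler_wpM2l// ler_wpM2l ?exprn_ge0 ?(ltW h0)//.
by rewrite lerXn2r ?nnegrE ?addr_ge0 ?enorm_ge0// lerDr.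
Qed.

End kernel_smoothing.

(** * Local approximation of a quotient *)

Lemma measurable_funV d (T : measurableType d) (R : realType) (f : T -> R) :
  measurable_fun [set: T] f -> measurable_fun [set: T] (fun x => (f x)^-1).
Proof.
move=> mf; have -> : (fun x => (f x)^-1) = (fun x => f x * (f x ^+ 2) `^ (-1)).
  apply/funext => x; rewrite powR_inv1 ?sqr_ge0//.
  by have [->|f0] := eqVneq (f x) 0; rewrite ?invr0 ?mul0r//; field.
apply: measurable_funM => //; apply: (measurableT_comp (measurable_powR _)).
exact: measurable_funX.
Qed.

Lemma bounded_measurableM d (T : measurableType d) (R : realType) (a c : T -> R) :
  bounded_measurable a -> bounded_measurable c -> bounded_measurable (fun x => a x * c x).
Proof.
move=> [ma [A HA]] [mc [B HB]]; split; first exact: measurable_funM.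
by exists (A * B) => x; rewrite normrM ler_pM.
Qed.

Lemma bounded_measurable_cst d (T : measurableType d) (R : realType) (a : R) :
  bounded_measurable (fun _ : T => a).
Proof. by split=> //; exists `|a|. Qed.

Section quotient_approximation.
Context {R : realType} {d : nat}.
Local Notation V := 'rV[R]_d.

Lemma polyfield_exp N (w : V -> V -> R) m : polyfield (@bounded_measurable _ V R) N w ->
  polyfield (@bounded_measurable _ V R) (m * N) (fun x u => w x u ^+ m).
Proof.
move=> pw; elim: m => [|m IH].
  by rewrite mul0n; apply: (polyfield_coef (c := fun=> 1)); exact: bounded_measurable_cst.
rewrite mulSn (_ : (fun _ _ => _) = fun x u => w x u * w x u ^+ m).
  by apply: polyfieldM pw IH; exact: bounded_measurableM.
by apply/funext => x; apply/funext => u; rewrite exprS.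
Qed.

Variables (C : (V -> R) -> Prop) (k r : nat) (phi f : V -> R) (A : set V) (b B L : R).
Hypotheses (r_ge1 : (1 <= r)%N) (b_gt0 : 0 < b).
Hypothesis C_scale : forall (e : R) c, C c -> C (fun x => e * c x).
Hypothesis C_bounded : forall c a, C c -> bounded_measurable a -> C (fun x => c x * a x).
Hypotheses (mA : measurable A) (mf : measurable_fun [set: V] f).
Hypotheses (df : times_differentiable r f) (dphi : times_differentiable k phi).
Hypothesis C_phi : forall l, (msize l <= k)%N -> C (mpartial l phi).
Hypothesis phi_bounded : forall x, `|phi x| <= B.
Hypothesis f_ge : forall x, A x -> b <= f x.
Hypothesis f_bounded : forall l, (msize l <= r.-1)%N ->
  exists B', forall x, A x -> `|mpartial l f x| <= B'.
Hypothesis f_rem : forall x u, `|taylor_rem r.-1 f x u| <= L * enorm u ^+ r.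
Hypothesis phi_out : forall x, ~ A x -> forall u, taylor_poly k phi x u = 0.

Let a x : R := \1_A x / f x.

Let ba : bounded_measurable a.
Proof.
split.
  apply: measurable_funM; first exact: measurable_indic.
  exact: measurable_funV.
exists b^-1 => x; rewrite /a indicE; have [xA|xA] := boolP (x \in A); last first.
  by rewrite mul0r normr0 invr_ge0 ltW.
have fb : b <= f x by apply: f_ge; rewrite inE in xA.
have f0 : 0 < f x by exact: lt_le_trans fb.
by rewrite mul1r ger0_norm ?invr_ge0 ?(ltW f0)// lef_pV2 ?posrE.
Qed.

Let q x u := a x * taylor_poly r.-1 f x u.
Let w x u := \1_A x - q x u.
Let Qt x u := a x * \sum_(m < r) w x u ^+ m.
Let p x u := taylor_poly k phi x u * Qt x u.

Let pq : polyfield (@bounded_measurable _ V R) r.-1 q.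
Proof.
have df' : times_differentiable r.-1 f by apply: times_differentiableW df; exact: leq_pred.
pose CA (c : V -> R) := measurable_fun [set: V] c /\ exists B', forall x, A x -> `|c x| <= B'.
have pT : polyfield CA r.-1 (taylor_poly r.-1 f).
  apply: polyfield_taylor_poly => // [e c [mc [B' HB]]|l lr].
    split; first exact: measurable_funM.
    by exists (`|e| * B') => x Ax; rewrite normrM ler_wpM2l// HB.
  split; last exact: f_bounded.
  exact: (measurable_mpartial lr).
apply: polyfield_coefM pT => c [mc [B' HB]]; split.
  by apply: measurable_funM => //; case: ba.
have [_ [Ba HBa]] := ba; exists (Ba * `|B'|) => x.
rewrite normrM; have [Ax|Ax] := pselect (A x).
  by rewrite ler_pM// (le_trans (HB x Ax))// ler_norm.
rewrite /a indicE memNset// mul0r normr0 mul0r mulr_ge0//.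
exact: le_trans (HBa 0).
Qed.

Let pw : polyfield (@bounded_measurable _ V R) r.-1 w.
Proof.
apply: polyfieldD.
  apply: (polyfieldW (leq0n _)); apply: polyfield_coef.
  by split; [exact: measurable_indic|exists 1 => x; rewrite indicE; case: (_ \in _); rewrite ?normr1 ?normr0].
rewrite (_ : (fun _ _ => _) = fun x u => -1 * q x u).
  apply: (polyfield_coefM (a := fun=> -1)) pq => c bc.
  exact: bounded_measurableM (bounded_measurable_cst _ _) bc.
by apply/funext => x; apply/funext => u; rewrite mulN1r.
Qed.

Let pQt : polyfield (@bounded_measurable _ V R) (r * r.-1) Qt.
Proof.
apply: polyfield_coefM.
  by move=> c bc; exact: bounded_measurableM ba bc.
apply: polyfield_sum => m; apply: (polyfieldW _ (polyfield_exp m pw)).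
by rewrite leq_mul2r ltnW ?orbT.
Qed.

Let w_at0 x : w x 0 = 0.
Proof.
rewrite /w /q taylor_polyx0 /a indicE; have [xA|xA] := boolP (x \in A); last by rewrite !mul0r subr0.
have : b <= f x by apply: f_ge; move: xA; rewrite inE.
by move=> fb; rewrite mul1r mulVf ?subrr// gt_eqF// (lt_le_trans b_gt0).
Qed.

(** The reciprocal of [f (x + u)] is approximated by the geometric sum
[Qt x u], and [q * Qt = 1 - w ^+ r] with [w] of order one in the increment; the
product of [Qt] with the Taylor polynomial of [phi] then approximates the
quotient, and derivatives of the quotient never appear. *)
Lemma quotient_local_approximation : exists N p (D : R),
  [/\ polyfield C N p, forall x, p x 0 = phi x / f x, 0 <= D &
   forall x u, `|phi (x + u) / f (x + u) - p x u| <=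
     D * (1 + enorm u) ^+ N * (\1_A x * enorm u ^+ r + `|taylor_rem k phi x u|)].
Proof.
have [Bw Bw0 HBw] := polyfield_lipschitz_bound pw.
have [BQ BQ0 HBQ] := polyfield_bound pQt.
have L0 : 0 <= `|L| by [].
have B0 : 0 <= B by exact: le_trans (phi_bounded 0).
have phi0 x : ~ A x -> phi x = 0 by move=> /phi_out/(_ 0); rewrite taylor_polyx0.
exists (k + r * r.-1)%N, p, (B / b * (Bw ^+ r + `|L| * BQ) + BQ + b^-1); split.
- by apply: polyfieldM pQt; [exact: C_bounded|exact: polyfield_taylor_poly].
- move=> x; rewrite /p taylor_polyx0 /Qt; have [xA|xA] := pselect (A x); last first.
    by rewrite phi0// !mul0r.
  rewrite /a indicE mem_set// mul1r (bigD1 (Ordinal r_ge1))//= expr0 big1 ?addr0 ?mulr1// => i i0.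
  by rewrite w_at0 expr0n; case: eqP => // i0'; case/eqP: i0; apply/val_inj.
- by rewrite !(addr_ge0, mulr_ge0, exprn_ge0)// invr_ge0 ltW.
move=> x u; set y := x + u; set G := (1 + enorm u).
have e0 := enorm_ge0 u.
have G1 : 1 <= G by rewrite /G lerDl.
have GN m n : (m <= n)%N -> G ^+ m <= G ^+ n by move=> mn; exact: ler_weXn2l.
have G0 m : 0 <= G ^+ m by rewrite exprn_ge0// (le_trans ler01).
set N := (k + _)%N; set Rm := taylor_rem k phi x u.
have HQ : `|Qt x u| <= BQ * G ^+ N.
  by apply: le_trans (HBQ x u) _; rewrite ler_wpM2l// GN// leq_addl.
have phiE : phi y = taylor_poly k phi x u + Rm by rewrite /Rm /taylor_rem addrC subrK.
have bi0 : 0 <= b^-1 by rewrite invr_ge0 ltW.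
have c1 : 0 <= B / b * (Bw ^+ r + `|L| * BQ).
  by rewrite !mulr_ge0// addr_ge0 ?mulr_ge0 ?exprn_ge0.
have quot : `|phi y / f y| <= `|phi y| / b.
  have [->|y0] := eqVneq (phi y) 0; first by rewrite mul0r normr0 mul0r.
  have Ay : A y by apply: contrapT => /phi0 /eqP; exact/negP.
  have fy : 0 < f y := lt_le_trans b_gt0 (f_ge Ay).
  by rewrite normrM ler_wpM2l// ger0_norm ?invr_ge0 ?(ltW fy)// lef_pV2 ?posrE// f_ge.
have [xA|xA] := pselect (A x); last first.
  have E : phi y = Rm by rewrite phiE phi_out// add0r.
  rewrite /p phi_out// mul0r subr0 indicE memNset// mul0r add0r.
  apply: le_trans quot _; rewrite E mulrC ler_wpM2r//.
  apply: (@le_trans _ _ (b^-1 * 1)); first by rewrite mulr1.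
  by rewrite ler_pM// ?lerDr ?addr_ge0// -(expr0 G) GN.
rewrite indicE mem_set// mul1r.
have fx : 0 < f x := lt_le_trans b_gt0 (f_ge xA).
have qE : q x u = taylor_poly r.-1 f x u / f x by rewrite /q /a indicE mem_set// mul1r mulrC.
have wE : w x u = 1 - q x u by rewrite /w indicE mem_set.
have QE : taylor_poly r.-1 f x u * Qt x u = 1 - w x u ^+ r.
  have := subrX1 (w x u) r; rewrite /Qt /a indicE mem_set// mul1r.
  have -> : w x u - 1 = - (taylor_poly r.-1 f x u / f x) by rewrite wE qE; ring.
  by move=> E; rewrite -[1 - _]opprB E; ring.
have key : phi y / f y - p x u =
    phi y / f y * (w x u ^+ r - taylor_rem r.-1 f x u * Qt x u) + Rm * Qt x u.
  have -> : w x u ^+ r - taylor_rem r.-1 f x u * Qt x u = 1 - f y * Qt x u.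
    by rewrite /taylor_rem mulrBl QE -/y; ring.
  rewrite /p (_ : taylor_poly k phi x u = phi y - Rm); last by rewrite phiE addrK.
  have [->|y0] := eqVneq (phi y) 0; first by rewrite !mul0r; ring.
  have Ay : A y by apply: contrapT => /phi0 /eqP; exact/negP.
  have fy : 0 < f y := lt_le_trans b_gt0 (f_ge Ay).
  by field; rewrite gt_eqF.
rewrite key; apply: le_trans (ler_normD _ _) _.
have w_le : `|w x u ^+ r| <= Bw ^+ r * (enorm u ^+ r * G ^+ N).
  have := HBw x u; rewrite w_at0 subr0 => Hw; rewrite normrX.
  apply: (@le_trans _ _ ((Bw * (enorm u * G ^+ r.-1)) ^+ r)).
    by rewrite lerXn2r ?nnegrE// !mulr_ge0.
  rewrite !exprMn ler_wpM2l ?exprn_ge0// ler_wpM2l ?exprn_ge0//.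
  by rewrite -exprM GN// mulnC leq_addl.
have t1 : `|phi y / f y * (w x u ^+ r - taylor_rem r.-1 f x u * Qt x u)| <=
    B / b * (Bw ^+ r + `|L| * BQ) * G ^+ N * enorm u ^+ r.
  rewrite normrM -!mulrA mulrA.
  apply: ler_pM => //; first by apply: le_trans quot _; rewrite ler_wpM2r.
  apply: le_trans (ler_normB _ _) _; rewrite [leRHS]mulrDl; apply: lerD.
    by rewrite [G ^+ N * _]mulrC.
  rewrite normrM; apply: (@le_trans _ _ (`|L| * enorm u ^+ r * (BQ * G ^+ N))).
    apply: ler_pM => //; apply: le_trans (f_rem _ _) _.
    by rewrite ler_wpM2r ?exprn_ge0// ler_norm.
  by rewrite le_eqVlt; apply/orP; left; apply/eqP; ring.
have t2 : `|Rm * Qt x u| <= BQ * G ^+ N * `|Rm|.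
  by rewrite normrM mulrC ler_wpM2r.
apply: le_trans (lerD t1 t2) _.
have g0 := G0 N; have u0 : 0 <= enorm u ^+ r by rewrite exprn_ge0.
have R0 := normr_ge0 Rm.
set c := B / b * _ in c1 *; set gN := G ^+ N in g0 *; set ur := enorm u ^+ r in u0 *.
set RR := `|Rm| in R0 *.
have a1 := mulr_ge0 (mulr_ge0 c1 g0) R0.
have a2 := mulr_ge0 (mulr_ge0 BQ0 g0) u0.
have a3 := mulr_ge0 (mulr_ge0 bi0 g0) u0.
have a4 := mulr_ge0 (mulr_ge0 bi0 g0) R0.
lra.
Qed.
End quotient_approximation.

(** * Mean-square error of smoothing *)

Lemma measurable_Rintegral_param d1 d2 (T1 : measurableType d1) (T2 : measurableType d2)
    (R : realType) (nu : {sigma_finite_measure set T2 -> \bar R}) (F : T1 * T2 -> R) :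
  measurable_fun setT F -> measurable_fun [set: T1] (fun x => \int[nu]_y F (x, y)).
Proof.
move=> mF; have mE : measurable_fun setT (EFin \o F) by apply/measurable_EFinP.
apply: (measurableT_comp (@fine_measurable _ setT measurableT)) => //.
under eq_fun do rewrite integralE.
apply: emeasurable_funB.
  rewrite (_ : (fun x => _) = fubini_F nu (funepos (EFin \o F))).
    by apply: measurable_fun_fubini_tonelli_F; [exact: measurable_funepos|exact: funepos_ge0].
  by apply/funext => x; apply: eq_integral => y _; rewrite !funeposE.
rewrite (_ : (fun x => _) = fubini_F nu (funeneg (EFin \o F))).
  by apply: measurable_fun_fubini_tonelli_F; [exact: measurable_funeneg|exact: funeneg_ge0].
by apply/funext => x; apply: eq_integral => y _; rewrite !funenegE.
Qed.

Section smoothing_error.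
Context {R : realType} {d : nat}.
Local Notation V := 'rV[R]_d.
Local Notation leb := (lebesgue_rV d).
Variables (K : V -> R) (r : nat) (m1 m2 : R).
Hypotheses (r_ge1 : (1 <= r)%N) (mK : measurable_fun [set: V] K).
Hypothesis K_int1 : \int[leb]_x K x = 1.
Hypothesis K_mom : forall l, (0 < msize l <= r.-1)%N -> \int[leb]_x (monomial l x * K x) = 0.
Hypotheses (m2_gt0 : 0 < m2) (K_exp : forall x, `|K x| <= m1 * expR (- (m2 * enorm x))).

Definition square_integrable (c : V -> R) : Prop :=
  measurable_fun [set: V] c /\ (\int[leb]_x (c x ^+ 2)%:E < +oo)%E.

Let mhom (h : R) : measurable_fun [set: V * V] (fun z : V * V => - (h *: z.2)).
Proof.
apply/measurable_fun_rVP => i; under eq_fun do rewrite !mxE.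
apply: measurableT_comp => //; apply: measurable_funM => //.
exact: (measurableT_comp (measurable_coord i) measurable_snd).
Qed.

Lemma measurable_polyfield_joint (C : (V -> R) -> Prop) N p (h : R) :
  (forall c, C c -> measurable_fun [set: V] c) -> polyfield C N p ->
  measurable_fun setT (fun z : V * V => p z.1 (- (h *: z.2))).
Proof.
move=> Cm [J [c [l [Cc lN E]]]].
rewrite (_ : (fun z => _) = fun z : V * V => \sum_j c j z.1 * monomial (l j) (- (h *: z.2))).
  apply: measurable_sum => j; apply: measurable_funM.
    exact: (measurableT_comp (Cm _ (Cc j)) measurable_fst).
  exact: (measurableT_comp (measurable_monomial (l j)) (mhom h)).
by apply/funext => z; rewrite E.
Qed.

Let mshift (g : V -> R) (h : R) : measurable_fun [set: V] g ->
  measurable_fun setT (fun z : V * V => g (z.1 - h *: z.2)).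
Proof.
move=> mg; apply: (measurableT_comp mg); by apply: measurable_funDrV => //; exact: mhom.
Qed.

(** Cauchy-Schwarz for the measure with density [`|K|]. *)
Lemma sqr_integral_kernel_le (F : V -> R) : measurable_fun [set: V] F ->
  (((\int[leb]_v (`|K v| * `|F v|)%:E) ^+ 2 <=
   (kernel_moment K 0)%:E * \int[leb]_v (`|K v| * F v ^+ 2)%:E))%E.
Proof.
move=> mF; pose S v := Num.sqrt `|K v|.
have mS : measurable_fun [set: V] S.
  rewrite (_ : S = fun v => `|K v| `^ 2^-1); last first.
    by apply/funext => v; rewrite powR12_sqrt.
  by apply: (measurableT_comp (measurable_powR _)); exact: measurableT_comp.
have := cauchy_schwarz_integral leb mS (measurable_funM mS mF).
have S2 v : S v ^+ 2 = `|K v| by rewrite sqr_sqrtr.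
under eq_integral do rewrite mulrA -expr2 S2 normrM normr_id.
under [X in (_ <= X * _)%E -> _]eq_integral do rewrite S2.
under [X in (_ <= _ * X)%E -> _]eq_integral do rewrite exprMn S2.
suff -> : (\int[leb]_x (`|K x|)%:E)%E = (kernel_moment K 0)%:E by [].
have i0 := integrable_kernel_moment mK m2_gt0 K_exp 0.
rewrite /kernel_moment /Rintegral fineK ?integrable_fin_num//.
by apply: eq_integral => v _; rewrite expr0 mul1r.
Qed.

Variables (C : (V -> R) -> Prop) (k N : nat) (phi psi : V -> R) (p : V -> V -> R).
Variables (A : set V) (a D M B : R).
Hypotheses (a_ge0 : 0 <= a) (a_le2 : a <= 2) (M_ge0 : 0 <= M) (D_ge0 : 0 <= D).
Hypotheses (mpsi : measurable_fun [set: V] psi) (psi_bounded : forall x, `|psi x| <= B).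
Hypotheses (mphi : measurable_fun [set: V] phi) (dphi : times_differentiable k phi).
Hypotheses (mA : measurable A) (A_fin : (leb A < +oo)%E).
Hypothesis p_poly : polyfield square_integrable N p.
Hypothesis p_at0 : forall x, p x 0 = psi x.
Hypothesis p_approx : forall x u, `|psi (x + u) - p x u| <=
     D * (1 + enorm u) ^+ N * (\1_A x * enorm u ^+ r + `|taylor_rem k phi x u|).
Hypothesis phi_rem : forall u, (\int[leb]_x (taylor_rem k phi x u ^+ 2)%:E
     <= (M * enorm u ^+ (2 * k) * enorm u `^ a)%:E)%E.

Let G (v : V) := 1 + enorm v.
Let G1 v : 1 <= G v. Proof. by rewrite /G lerDl enorm_ge0. Qed.
Let G0 v : 0 <= G v. Proof. exact: le_trans ler01 (G1 v). Qed.
Let eG v : enorm v <= G v. Proof. by rewrite /G lerDr. Qed.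
Let Gn0 v n : 0 <= G v ^+ n. Proof. by rewrite exprn_ge0// (le_trans ler01). Qed.

(** Integrand of the bound for the squared approximation error: [p_approx] squared, weighted by the
kernel. *)
Let Phi (h : R) (z : V * V) : R := `|K z.2| * (2 * D ^+ 2 * G z.2 ^+ (2 * N)) *
   (\1_A z.1 * (h ^+ (2 * r) * enorm z.2 ^+ (2 * r)) + taylor_rem k phi z.1 (- (h *: z.2)) ^+ 2).

Let mPhi h : measurable_fun setT (Phi h).
Proof.
have mG n : measurable_fun setT (fun z : V * V => G z.2 ^+ n).
  apply: measurable_funX; apply: measurable_funD => //.
  exact: (measurableT_comp measurable_enorm measurable_snd).
apply: measurable_funM.
  apply: measurable_funM; last exact: measurable_funM.
  by apply: measurableT_comp => //; exact: (measurableT_comp mK measurable_snd).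
apply: measurable_funD.
  apply: measurable_funM; first by apply: (measurableT_comp (f := \1_A : V -> R)); [exact: measurable_indic|exact: measurable_fst].
  apply: measurable_funM => //; apply: measurable_funX.
  exact: (measurableT_comp measurable_enorm measurable_snd).
apply: measurable_funX; apply: measurable_funB; first exact: mshift.
pose Cm (c : V -> R) := measurable_fun [set: V] c.
apply: (@measurable_polyfield_joint Cm k) => //.
apply: polyfield_taylor_poly => // [e c|l lk]; first exact: measurable_funM.
exact: measurable_mpartial lk _ _.
Qed.

Let Phi_ge0 h z : 0 < h -> 0 <= Phi h z.
Proof.
move=> h0; rewrite /Phi mulr_ge0//.
  by rewrite !mulr_ge0 ?sqr_ge0.
by rewrite addr_ge0 ?sqr_ge0// !mulr_ge0 ?exprn_ge0 ?enorm_ge0// ltW.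
Qed.

Let int_Phi h : 0 < h <= 1 -> (\int[leb]_x \int[leb]_v (Phi h (x, v))%:E <=
  (2 * D ^+ 2 * (fine (leb A) * kernel_moment K (2 * N + 2 * r) * h ^+ (2 * r)
     + M * kernel_moment K (2 * N + 2 * k + 2) * (h ^+ (2 * k) * h `^ a)))%:E)%E.
Proof.
move=> /andP[h0 h1].
rewrite (@fubini_tonelli _ _ _ _ _ leb leb (fun z => (Phi h z)%:E)); last 2 first.
- by apply/measurable_EFinP; exact: mPhi.
- by move=> z; rewrite lee_fin Phi_ge0.
pose c1 := 2 * D ^+ 2 * (fine (leb A) * h ^+ (2 * r)).
pose c2 := 2 * D ^+ 2 * (M * (h ^+ (2 * k) * h `^ a)).
have A0 : 0 <= fine (leb A) by exact: fine_ge0.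
have c10 : 0 <= c1 by rewrite /c1 !mulr_ge0 ?sqr_ge0 ?exprn_ge0 ?(ltW h0).
have c20 : 0 <= c2 by rewrite /c2 !mulr_ge0 ?sqr_ge0 ?exprn_ge0 ?powR_ge0 ?(ltW h0).
have mKG n : measurable_fun [set: V] (fun v => G v ^+ n * `|K v|).
  apply: measurable_funM; last exact: measurableT_comp.
  by apply: measurable_funX; apply: measurable_funD => //; exact: measurable_enorm.
have KGE n : (\int[leb]_v (G v ^+ n * `|K v|)%:E = (kernel_moment K n)%:E)%E.
  have i0 := integrable_kernel_moment mK m2_gt0 K_exp n.
  by rewrite /kernel_moment /Rintegral fineK ?integrable_fin_num.
have mrem v : measurable_fun [set: V] (fun x => taylor_rem k phi x v).
  apply: measurable_funB; first by apply: (measurableT_comp mphi); exact: measurable_funDrV.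
  apply: measurable_sum => j; apply: measurable_funM => //.
  by apply: (measurable_taylor_term (k := k)) => //; rewrite -ltnS.
apply: (@le_trans _ _ (\int[leb]_v (c1%:E * (G v ^+ (2 * N + 2 * r) * `|K v|)%:E + c2%:E * (G v ^+ (2 * N + 2 * k + 2) * `|K v|)%:E)))%E; last first.
  rewrite ge0_integralD//; last 4 first.
  - by move=> v _; rewrite mule_ge0// lee_fin mulr_ge0.
  - by apply/measurable_EFinP; exact: measurable_funM.
  - by move=> v _; rewrite mule_ge0// lee_fin mulr_ge0.
  - by apply/measurable_EFinP; exact: measurable_funM.
  rewrite !ge0_integralZl_EFin//; last 4 first.
  - by move=> v _; rewrite lee_fin !mulr_ge0.
  - by apply/measurable_EFinP; exact: mKG.
  - by move=> v _; rewrite lee_fin !mulr_ge0.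
  - by apply/measurable_EFinP; exact: mKG.
  by rewrite !KGE -!EFinM -EFinD lee_fin /c1 /c2 le_eqVlt; apply/orP; left; apply/eqP; ring.
apply: ge0_le_integral => //.
- by move=> v _; apply: integral_ge0 => x _; rewrite lee_fin Phi_ge0.
- apply: (@measurable_fun_fubini_tonelli_G _ _ _ _ _ leb (fun z => (Phi h z)%:E)).
    by apply/measurable_EFinP; exact: mPhi.
  by move=> z; rewrite lee_fin Phi_ge0.
- by apply: emeasurable_funD; apply/measurable_EFinP; exact: measurable_funM.
move=> v _.
pose c0 := `|K v| * (2 * D ^+ 2 * G v ^+ (2 * N)).
have c00 : 0 <= c0 by rewrite !mulr_ge0 ?sqr_ge0.
have e0 := enorm_ge0 v.
have -> : (\int[leb]_x (Phi h (x, v))%:E = c0%:E *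
   ((h ^+ (2 * r) * enorm v ^+ (2 * r))%:E * leb A
     + \int[leb]_x (taylor_rem k phi x (- (h *: v)) ^+ 2)%:E))%E.
  rewrite -[in RHS](setIT A) -integral_indic// -ge0_integralZl_EFin//; last 2 first.
  - by apply/measurable_EFinP; exact: measurable_indic.
  - by rewrite mulr_ge0 ?exprn_ge0 ?(ltW h0).
  rewrite -ge0_integralD//; last 4 first.
  - by move=> x _; rewrite lee_fin !mulr_ge0 ?exprn_ge0 ?(ltW h0).
  - by apply/measurable_EFinP; apply: measurable_funM => //; exact: measurable_indic.
  - by move=> x _; rewrite lee_fin sqr_ge0.
  - by apply/measurable_EFinP; apply: measurable_funX; exact: mrem.
  rewrite -ge0_integralZl_EFin//; last 2 first.
  - by move=> x _; rewrite adde_ge0// lee_fin ?sqr_ge0// !mulr_ge0 ?exprn_ge0 ?(ltW h0).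
  - apply: emeasurable_funD; apply/measurable_EFinP.
      by apply: measurable_funM => //; exact: measurable_indic.
    by apply: measurable_funX; exact: mrem.
  apply: eq_integral => x _.
  transitivity ((c0 * (h ^+ (2 * r) * enorm v ^+ (2 * r) * \1_A x
    + taylor_rem k phi x (- (h *: v)) ^+ 2))%:E) => //.
  by congr EFin; rewrite /Phi /c0/=; ring.
apply: (@le_trans _ _ (c0%:E * ((h ^+ (2 * r) * enorm v ^+ (2 * r))%:E * leb A
   + (M * enorm (- (h *: v)) ^+ (2 * k) * enorm (- (h *: v)) `^ a)%:E))%E).
  by rewrite lee_wpmul2l ?lee_fin// leeD2l.
rewrite -[leb A]fineK ?ge0_fin_numE//.
suff : c0 * (h ^+ (2 * r) * enorm v ^+ (2 * r) * fine (leb A)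
     + M * enorm (- (h *: v)) ^+ (2 * k) * enorm (- (h *: v)) `^ a) <=
   c1 * (G v ^+ (2 * N + 2 * r) * `|K v|) + c2 * (G v ^+ (2 * N + 2 * k + 2) * `|K v|).
  by rewrite -lee_fin.
rewrite enormN enormZ (gtr0_norm h0) mulrDr; apply: lerD.
  rewrite /c0 /c1 [leLHS](_ : _ = 2 * D ^+ 2 * (fine (leb A) * h ^+ (2 * r)) *
    (G v ^+ (2 * N) * enorm v ^+ (2 * r) * `|K v|)); last by ring.
  rewrite ler_wpM2l// ler_wpM2r// exprD ler_wpM2l//.
  by rewrite lerXn2r ?nnegrE ?G0// eG.
rewrite powRM ?(ltW h0)// exprMn.
rewrite /c0 /c2 [leLHS](_ : _ = 2 * D ^+ 2 * (M * (h ^+ (2 * k) * h `^ a)) *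
    (G v ^+ (2 * N) * (enorm v ^+ (2 * k) * enorm v `^ a) * `|K v|)); last by ring.
rewrite ler_wpM2l// ler_wpM2r// -addnA exprD ler_wpM2l// exprD.
apply: ler_pM; rewrite ?exprn_ge0 ?powR_ge0//.
  by rewrite lerXn2r ?nnegrE ?G0// eG.
rewrite -powR_mulrn ?G0//.
apply: (@le_trans _ _ (G v `^ a)).
  by rewrite ge0_ler_powR// ?nnegrE ?G0// eG.
by rewrite ler_powR.
Qed.

Let main_term h x : 0 < h <= 1 ->
  (((\int[leb]_v (K v * (psi (x - h *: v) - p x (- (h *: v))))) ^+ 2)%:E <=
   (kernel_moment K 0)%:E * \int[leb]_v (Phi h (x, v))%:E)%E.
Proof.
move=> /andP[h0 h1].
pose e v := psi (x - h *: v) - p x (- (h *: v)).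
have me : measurable_fun [set: V] e.
  apply: measurable_funB; first exact: measurable_smoothing.
  exact: (measurable_polyfield_inc (C := square_integrable) (N := N)).
have iK : leb.-integrable [set: V] (fun v => (K v * e v)%:E).
  rewrite (_ : (fun v => _) = ((fun v => (K v * psi (x - h *: v))%:E) \- (fun v => (K v * p x (- (h *: v)))%:E))%E).
    apply: integrableB => //.
      apply: (integrable_kernelM mK m2_gt0 K_exp (N := 0) (B := B)).
        exact: measurable_smoothing.
      by move=> v; rewrite expr0 mulr1.
    exact: (integrable_kernel_polyfield mK m2_gt0 K_exp x h p_poly).
  by apply/funext => v; rewrite /= -EFinB mulrBr.
have E0 : (0 <= \int[leb]_v (`|K v| * `|e v|)%:E)%E.
  by apply: integral_ge0 => v _; rewrite lee_fin mulr_ge0.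
apply: (@le_trans _ _ ((\int[leb]_v (`|K v| * `|e v|)%:E) ^+ 2)%E).
  rewrite -(real_normK (num_real (\int[leb]_v _))) EFin_expe !expe2.
  suff H : (`|\int[leb]_v (K v * e v)|%:E <= \int[leb]_v (`|K v| * `|e v|)%:E)%E.
    by apply: lee_pmul; rewrite ?lee_fin.
  have := le_normr_Rintegral measurableT iK; rewrite -lee_fin => /le_trans; apply.
  rewrite /Rintegral fineK; last by apply: integrable_fin_num => //; exact: integrable_norm.
  rewrite le_eqVlt; apply/orP; left; apply/eqP; apply: eq_integral => v _.
  by rewrite normrM.
apply: le_trans (sqr_integral_kernel_le me) _.
rewrite lee_wpmul2l ?lee_fin ?kernel_moment_ge0//.
apply: ge0_le_integral => //.
- by move=> v _; rewrite lee_fin mulr_ge0 ?sqr_ge0.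
- apply/measurable_EFinP; apply: measurable_funM; first exact: measurableT_comp.
  exact: measurable_funX.
- by apply/measurable_EFinP; exact: (measurableT_comp (mPhi h) (pair1_measurable x)).
move=> v _; rewrite lee_fin /Phi/= -mulrA ler_wpM2l//.
have := p_approx x (- (h *: v)); rewrite -/(e v) => He.
set t := taylor_rem _ _ _ _ in He *; set I := \1_A x in He *.
have hv : enorm (- (h *: v)) = h * enorm v by rewrite enormN enormZ gtr0_norm.
have hle : h * enorm v <= enorm v by rewrite ler_piMl ?enorm_ge0.
have He2 : `|e v| <= D * G v ^+ N * (I * (h * enorm v) ^+ r + `|t|).
  apply: le_trans He _; rewrite hv ler_wpM2r//.
    by rewrite addr_ge0// mulr_ge0// ?exprn_ge0// mulr_ge0 ?enorm_ge0 ?(ltW h0).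
  by rewrite ler_wpM2l// lerXn2r ?nnegrE ?G0 ?lerD2l// addr_ge0// mulr_ge0 ?enorm_ge0 ?(ltW h0).
have I2 : I ^+ 2 = I by rewrite /I indicE; case: (_ \in _); rewrite ?expr1n ?expr0n.
rewrite -(real_normK (num_real (e v))).
apply: (@le_trans _ _ ((D * G v ^+ N * (I * (h * enorm v) ^+ r + `|t|)) ^+ 2)).
  by rewrite lerXn2r ?nnegrE// (le_trans _ He2).
rewrite exprMn (_ : 2 * D ^+ 2 * _ = (D * G v ^+ N) ^+ 2 * 2); last first.
  by rewrite exprMn -exprM (mulnC N); ring.
rewrite -[leRHS]mulrA ler_wpM2l ?sqr_ge0//.
rewrite (_ : I * (h ^+ (2 * r) * _) = (I * (h * enorm v) ^+ r) ^+ 2); last first.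
  by rewrite exprMn I2 -!exprM (mulnC r) exprMn.
rewrite -(real_normK (num_real t)).
by have := sqr_ge0 (I * (h * enorm v) ^+ r - `|t|); lra.
Qed.

(** The polynomial field is almost reproduced, with square integrable coefficients; the
approximation error is integrated first in [x], for a fixed increment, where the
mean-square bound on the Taylor remainder applies, and then in the increment. *)
Lemma smoothing_error : exists2 E : R, 0 <= E & forall h : R, 0 < h <= 1 ->
  (\int[leb]_x ((psi x - \int[leb]_v (K v * psi (x - h *: v))) ^+ 2)%:E <=
   (E * (h ^+ (2 * k) * h `^ a + h ^+ (2 * r)))%:E)%E.
Proof.
have [J [c [Bc [Cc Bc0 Hc]]]] := kernel_almost_reproduces r_ge1 mK K_int1 K_mom m2_gt0 K_exp p_poly.
have mc j : measurable_fun [set: V] (c j) by case: (Cc j).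
pose S2 := \sum_j fine (\int[leb]_x (c j x ^+ 2)%:E).
have Sj0 j : (0 <= \int[leb]_x (c j x ^+ 2)%:E)%E.
  by apply: integral_ge0 => x _; rewrite lee_fin sqr_ge0.
have S20 : 0 <= S2 by apply: sumr_ge0 => j _; exact: fine_ge0.
set k0 := kernel_moment K 0; have k00 : 0 <= k0 by exact: kernel_moment_ge0.
set ka := fine (leb A) * kernel_moment K (2 * N + 2 * r).
set kb := M * kernel_moment K (2 * N + 2 * k + 2).
have ka0 : 0 <= ka by apply: mulr_ge0; [apply: fine_ge0; exact: measure_ge0|exact: kernel_moment_ge0].
have kb0 : 0 <= kb by apply: mulr_ge0 => //; exact: kernel_moment_ge0.
pose E1 := 2 * k0 * (2 * D ^+ 2); pose E2 := 2 * Bc ^+ 2 * #|J|%:R * S2.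
have E10 : 0 <= E1 by rewrite !mulr_ge0 ?sqr_ge0.
have E20 : 0 <= E2 by rewrite !mulr_ge0 ?sqr_ge0.
exists (E1 * (ka + kb) + E2) => [|h h01].
  by rewrite addr_ge0// mulr_ge0// addr_ge0.
have [h0 h1] := andP h01.
have mPF : measurable_fun [set: V] (fun x => \int[leb]_v (Phi h (x, v))%:E)%E.
  apply: (@measurable_fun_fubini_tonelli_F _ _ _ _ _ leb (fun z => (Phi h z)%:E)).
    by apply/measurable_EFinP; exact: mPhi.
  by move=> z; rewrite lee_fin Phi_ge0.
have PF0 x : (0 <= \int[leb]_v (Phi h (x, v))%:E)%E.
  by apply: integral_ge0 => v _; rewrite lee_fin Phi_ge0.
have e2r : 0 <= 2 * h ^+ (2 * r) * Bc ^+ 2 * #|J|%:R.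
  by rewrite !mulr_ge0 ?sqr_ge0 ?exprn_ge0 ?(ltW h0).
apply: (@le_trans _ _ (\int[leb]_x ((2 * k0)%:E * \int[leb]_v (Phi h (x, v))%:E
   + (2 * h ^+ (2 * r) * Bc ^+ 2 * #|J|%:R)%:E * \sum_j (c j x ^+ 2)%:E))%E).
  have mS : measurable_fun [set: V] (fun x => \sum_j (c j x ^+ 2)%:E)%E.
    by apply: emeasurable_sum => j; apply/measurable_EFinP; exact: measurable_funX.
  apply: ge0_le_integral => //.
  - by move=> x _; rewrite lee_fin sqr_ge0.
  - apply/measurable_EFinP; apply: measurable_funX; apply: measurable_funB => //.
    apply: (@measurable_Rintegral_param _ _ _ _ _ leb (fun z : V * V => K z.2 * psi (z.1 - h *: z.2))).
    apply: measurable_funM; first exact: (measurableT_comp mK measurable_snd).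
    exact: mshift.
  - by apply: emeasurable_funD; exact: emeasurable_funM.
  move=> x _.
  set T1 := \int[leb]_v (K v * (psi (x - h *: v) - p x (- (h *: v)))).
  set T2 := \int[leb]_v (K v * p x (- (h *: v))) - p x 0.
  have -> : psi x - \int[leb]_v (K v * psi (x - h *: v)) = - (T1 + T2).
    rewrite /T1 /T2 p_at0; under [\int[leb]_v (K v * (_ - _))]eq_Rintegral do rewrite mulrBr.
    rewrite RintegralB//; first by ring.
      apply: (integrable_kernelM mK m2_gt0 K_exp (N := 0) (B := B)).
        exact: measurable_smoothing.
      by move=> v; rewrite expr0 mulr1.
    exact: (integrable_kernel_polyfield mK m2_gt0 K_exp x h p_poly).
  apply: (@le_trans _ _ ((2 * T1 ^+ 2)%:E + (2 * T2 ^+ 2)%:E)%E).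
    by rewrite -EFinD lee_fin sqrrN; have := sqr_ge0 (T1 - T2); lra.
  apply: leeD.
    by rewrite !EFinM -muleA lee_wpmul2l ?lee_fin// main_term.
  rewrite sumEFin -EFinM lee_fin.
  rewrite [leRHS](_ : _ = 2 * (h ^+ (2 * r) * (Bc ^+ 2 * (#|J|%:R * \sum_j c j x ^+ 2)))); last by ring.
  rewrite ler_wpM2l//.
  apply: (@le_trans _ _ ((h ^+ r * Bc * \sum_j `|c j x|) ^+ 2)).
    rewrite -(real_normK (num_real T2)) lerXn2r ?nnegrE//.
      by rewrite !mulr_ge0 ?sumr_ge0 ?exprn_ge0 ?(ltW h0).
    exact: Hc.
  rewrite !exprMn -exprM (mulnC r) -[leLHS]mulrA.
  rewrite ler_wpM2l ?exprn_ge0 ?(ltW h0)// ler_wpM2l ?sqr_ge0//.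
  apply: le_trans (sqr_sum_le _) _; rewrite ler_wpM2l//.
  by apply: ler_sum => j _; rewrite real_normK ?num_real.
rewrite ge0_integralD//; last 4 first.
- by move=> x _; rewrite mule_ge0// lee_fin mulr_ge0.
- exact: emeasurable_funM.
- move=> x _; rewrite mule_ge0// sume_ge0// => j _; by rewrite lee_fin sqr_ge0.
- apply: emeasurable_funM => //.
  by apply: emeasurable_sum => j; apply/measurable_EFinP; exact: measurable_funX.
rewrite !ge0_integralZl_EFin//; last 3 first.
- by move=> x _; rewrite sume_ge0// => j _; rewrite lee_fin sqr_ge0.
- by apply: emeasurable_sum => j; apply/measurable_EFinP; exact: measurable_funX.
- by rewrite mulr_ge0.
rewrite ge0_integral_sum//; last 2 first.
- by move=> j; apply/measurable_EFinP; exact: measurable_funX.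
- by move=> j x _; rewrite lee_fin sqr_ge0.
have -> : (\sum_j \int[leb]_x (c j x ^+ 2)%:E = S2%:E)%E.
  rewrite /S2 -sumEFin; apply: eq_bigr => j _; rewrite fineK// ge0_fin_numE//.
  by case: (Cc j).
apply: (@le_trans _ _ ((2 * k0)%:E * (2 * D ^+ 2 * (ka * h ^+ (2 * r) + kb * (h ^+ (2 * k) * h `^ a)))%:E
   + (2 * h ^+ (2 * r) * Bc ^+ 2 * #|J|%:R)%:E * S2%:E)%E).
  by rewrite leeD2r// lee_wpmul2l ?lee_fin ?mulr_ge0// int_Phi.
rewrite -!EFinM -EFinD lee_fin.
rewrite (_ : 2 * k0 * _ = E1 * (ka * h ^+ (2 * r) + kb * (h ^+ (2 * k) * h `^ a))); last by rewrite /E1; ring.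
rewrite (_ : 2 * h ^+ (2 * r) * _ * _ * _ = E2 * h ^+ (2 * r)); last by rewrite /E2; ring.
set x1 := h ^+ (2 * k) * h `^ a; set x2 := h ^+ (2 * r).
have x10 : 0 <= x1 by rewrite mulr_ge0 ?powR_ge0 ?exprn_ge0 ?(ltW h0).
have x20 : 0 <= x2 by rewrite exprn_ge0 ?(ltW h0).
have y1 := mulr_ge0 (mulr_ge0 E10 ka0) x10.
have y2 := mulr_ge0 (mulr_ge0 E10 kb0) x20.
have y3 := mulr_ge0 E20 x10.
lra.
Qed.

End smoothing_error.

(** * Smoothing errors for phi / f and for f *)

Section vanishing.
Context {R : realType} {d : nat}.
Local Notation V := 'rV[R]_d.
Implicit Types (U : set V) (g : V -> R).

Lemma partial_vanishes U g i : open U -> (forall x, U x -> g x = 0) ->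
  forall x, U x -> partial i g x = 0.
Proof.
move=> oU gU x Ux; rewrite /partial -[RHS](derive_cst (0 : R) x (delta_mx ord0 i)).
apply: near_eq_derive; near=> y; apply: gU; near: y.
exact: open_nbhs_nbhs.
Unshelve. all: by end_near.
Qed.

Lemma mpartial_vanishes U g l : open U -> (forall x, U x -> g x = 0) ->
  forall x, U x -> mpartial l g x = 0.
Proof.
move=> oU gU; rewrite /mpartial; elim: (enum _) => [//|i s IH] /=.
by elim: (l i) => [//|n IHn] /=; exact: partial_vanishes.
Qed.

Lemma taylor_poly_vanishes U g k : open U -> (forall x, U x -> g x = 0) ->
  forall x, U x -> forall u, taylor_poly k g x u = 0.
Proof.
move=> oU gU x Ux u; rewrite /taylor_poly big1// => j _.
suff -> : taylor_term j g x u = 0 by rewrite mulr0.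
elim: (nat_of_ord j) g gU => [|n IH] g gU /=; first exact: gU.
rewrite big1// => i _; rewrite IH ?mulr0//.
exact: partial_vanishes.
Qed.

(** The translate by a vector longer than the diameter of the support has a
disjoint support, so an increment of the function controls the function. *)
Lemma sqr_le_sqr_increment (i0 : 'I_d) g (m : R) : 0 <= m ->
  (forall x, g x != 0 -> forall i, `|x ord0 i| <= m) ->
  exists u : V, forall x, g x ^+ 2 <= (g (x + u) - g x) ^+ 2.
Proof.
move=> m0 Hg; exists ((m + m + 1) *: delta_mx ord0 i0) => x.
have [->|gx] := eqVneq (g x) 0; first by rewrite expr0n sqr_ge0.
suff -> : g (x + (m + m + 1) *: delta_mx ord0 i0) = 0 by rewrite sub0r sqrrN.
apply/eqP/negPn/negP => gy; have := Hg _ gx i0; have := Hg _ gy i0.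
by rewrite !mxE !eqxx mulr1 !ler_norml; lra.
Qed.

Lemma compact_bounded_fun (Q : set V) g : compact Q -> continuous g ->
  exists2 B : R, 0 <= B & forall x, Q x -> `|g x| <= B.
Proof.
move=> cQ cg; have /compact_bounded[B [_ HB]] : compact (g @` Q).
  by apply: continuous_compact => //; exact: continuous_subspaceT.
exists (`|B| + 1) => [|x Qx]; first by rewrite addr_ge0.
by apply: (HB (`|B| + 1)); [rewrite ltr_pwDr// ler_norm|exists x].
Qed.

Lemma compact_coord_bounded (Q : set V) : compact Q ->
  exists2 m : R, 0 <= m & forall x, Q x -> forall i, `|x ord0 i| <= m.
Proof.
move=> cQ.
have /choice[B HB] i : exists B : R, 0 <= B /\ forall x, Q x -> `|x ord0 i| <= B.
  by have [B B0 HB] := compact_bounded_fun cQ (@coord_continuous R 1 d ord0 i); exists B.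
exists (\sum_i B i) => [|x Qx i]; first by apply: sumr_ge0 => i _; case: (HB i).
apply: le_trans ((HB i).2 _ Qx) _; rewrite (bigD1 i)//= lerDl.
by apply: sumr_ge0 => j _; case: (HB j).
Qed.

Definition box (m : R) : set V := [set x | forall i, `[- m, m]%classic (x ord0 i)].

Lemma boxE m x : box m x <-> forall i, `|x ord0 i| <= m.
Proof. by split=> H i; have := H i; rewrite /= in_itv/= -ler_norml. Qed.

Lemma compact_box m : compact (box m).
Proof. by apply: (rV_compact (A := fun=> `[- m, m]%classic)) => i; exact: segment_compact. Qed.

Lemma measurable_box m : measurable (box m).
Proof.
rewrite (_ : box m = \bigcap_(i in setT) ((fun x : V => x ord0 i : R) @^-1` `[- m, m]%classic)).
  apply: fin_bigcap_measurable => // i _.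
  by rewrite -[X in measurable X]setTI; exact: measurable_coord.
by apply/seteqP; split => x /= xA i => [_|]; exact: xA.
Qed.

Lemma lebesgue_box_lty m : (lebesgue_rV d (box m) < +oo)%E.
Proof.
rewrite (lebesgue_rV_box (A := fun=> `[- m, m]%classic)) => [|i]; last exact: measurable_itv.
under eq_bigr do rewrite lebesgue_measure_itv/=.
case: ifPn => _.
  rewrite (eq_bigr (fun=> (m + m)%:E)) => [|i _]; last by rewrite opprK.
  by rewrite prodEFin ltry.
by rewrite (eq_bigr (fun=> 0%:E)) // prodEFin ltry.
Qed.

End vanishing.

Lemma square_integrableM (R : realType) d (c a : 'rV[R]_d -> R) :
  square_integrable c -> bounded_measurable a -> square_integrable (fun x => c x * a x).
Proof.
move=> [mc ic] [ma [B HB]]; split; first exact: measurable_funM.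
have mc2 : measurable_fun [set: 'rV[R]_d] (fun x => (c x ^+ 2)%:E).
  by apply/measurable_EFinP; exact: measurable_funX.
apply: (@le_lt_trans _ _ (\int[lebesgue_rV d]_x ((B ^+ 2)%:E * (c x ^+ 2)%:E))%E).
  apply: ge0_le_integral => //.
  - by move=> x _; rewrite lee_fin sqr_ge0.
  - by apply/measurable_EFinP; apply: measurable_funX; exact: measurable_funM.
  - exact: emeasurable_funM.
  - move=> x _; rewrite -EFinM lee_fin exprMn mulrC ler_wpM2r ?sqr_ge0//.
    by rewrite -(real_normK (num_real (a x))) lerXn2r ?nnegrE// (le_trans _ (HB x)).
rewrite ge0_integralZl_EFin ?sqr_ge0//; last by move=> x _; rewrite lee_fin sqr_ge0.
apply: lte_mul_pinfty => //; by rewrite lee_fin sqr_ge0.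
Qed.

Section kernel_regression_analysis.
Context {R : realType} {d : nat}.
Local Notation V := 'rV[R]_d.
Local Notation leb := (lebesgue_rV d).
Variables (hd : (1 <= d)%N) (phi K f : V -> R) (s M : R) (Q : set V) (r : nat) (b m1 m2 : R).
Hypothesis M_gt0 : 0 < M.
Hypotheses (phi_supp : closure [set x | phi x != 0] = Q) (Q_compact : compact Q).
Hypotheses (phi_nikolski : nikolski s M phi) (r_ge1 : (1 <= r)%N).
Hypotheses (mf : measurable_fun [set: V] f) (f_bounded : bounded_fun f).
Hypotheses (f_diff : times_differentiable r f).
Hypothesis f_diff_bounded : forall l : 'I_d -> nat, msize l = r -> bounded_fun (mpartial l f).
Hypotheses (b_gt0 : 0 < b) (f_ge : forall x, Q x -> b <= f x).
Hypothesis K_order : kernel_of_order r K.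
Hypotheses (m2_gt0 : 0 < m2) (K_exp : forall x, `|K x| <= m1 * expR (- (m2 * enorm x))).

Lemma phi_outside x : ~ Q x -> phi x = 0.
Proof.
move=> nQ; apply/eqP/negPn/negP => px; apply: nQ; rewrite -phi_supp.
exact: subset_closure.
Qed.

Lemma bounded_fun_bound (g : V -> R) : bounded_fun g -> exists2 B : R, 0 <= B & forall x, `|g x| <= B.
Proof.
move=> [B [_ HB]]; exists (`|B| + 1) => [|x]; first by rewrite addr_ge0.
by apply: (HB (`|B| + 1)) => //; rewrite ltr_pwDr// ler_norm.
Qed.

(** The set [A] of points of a box where [f] is at least [b] contains the support of [phi],
is measurable and has finite measure; outside the support the Taylor polynomials of [phi]
vanish. Square integrability of the derivatives of [phi] comes from the Nikolski
condition itself, through an increment that moves the support off itself. *)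
Lemma smoothing_error_quotient : exists2 C : R, 0 <= C & forall h : R, 0 < h <= 1 ->
  (\int[leb]_x ((phi x / f x - \int[leb]_v (K v * (phi (x - h *: v) / f (x - h *: v)))) ^+ 2)%:E
   <= (C * (h `^ s + h ^+ r) ^+ 2)%:E)%E.
Proof.
have [/bounded_fun_bound[B B0 HB] mphi [k [al [sE /andP[al0 al1] dphi Hphi]]]] := phi_nikolski.
have [_ mK _ K1 Kmom] := K_order.
have [m m0 Hm] := compact_coord_bounded Q_compact.
have oQ : open (~` Q) by rewrite openC -phi_supp; exact: closed_closure.
pose A : set V := [set x | b <= f x] `&` box m.
have QA x : Q x -> A x by move=> Qx; split; [exact: f_ge|apply/boxE/Hm].
have mA : measurable A.
  apply: measurableI; last exact: measurable_box.
  rewrite (_ : [set x | _] = setT `&` f @^-1` `[b, +oo[%classic); first exact: mf.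
  by apply/seteqP; split => x /=; rewrite in_itv/= andbT => // -[].
have Afin : (leb A < +oo)%E.
  apply: le_lt_trans (lebesgue_box_lty m); apply: le_measure; rewrite ?inE//; last by move=> x [].
  exact: measurable_box.
have Cphi l : (msize l <= k)%N -> square_integrable (mpartial l phi).
  move=> lk; have mg := measurable_mpartial lk dphi mphi; split=> //.
  have Hg x : mpartial l phi x != 0 -> forall i, `|x ord0 i| <= m.
    move=> gx; apply: Hm; apply: contrapT => nQ; move: gx.
    by rewrite (mpartial_vanishes l oQ phi_outside)// eqxx.
  have [u Hu] := sqr_le_sqr_increment (Ordinal hd) m0 Hg.
  apply: (@le_lt_trans _ _ (\int[leb]_x ((mpartial l phi (x + u) - mpartial l phi x) ^+ 2)%:E)%E).
    apply: ge0_le_integral => //.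
    - by move=> x _; rewrite lee_fin sqr_ge0.
    - by apply/measurable_EFinP; exact: measurable_funX.
    - apply/measurable_EFinP; apply: measurable_funX; apply: measurable_funB => //.
      by apply: (measurableT_comp mg); exact: measurable_funDrV.
    - by move=> x _; rewrite lee_fin.
  exact: le_lt_trans (Hphi u l lk) (ltry _).
have := taylor_rem_le (k := r.-1) mf; rewrite prednK// => /(_ f_diff f_diff_bounded)[L L0 HL].
have fbound l : (msize l <= r.-1)%N -> exists B', forall x, A x -> `|mpartial l f x| <= B'.
  move=> lr; have cg : continuous (mpartial l f).
    move=> x; apply: differentiable_continuous.
    have d1 : times_differentiable 1 (mpartial l f).
      apply: times_differentiable_mpartial; apply: times_differentiableW f_diff.
      by rewrite addn1 -(prednK r_ge1) ltnS.
    by case: d1.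
  have [B' _ HB'] := compact_bounded_fun (@compact_box R d m) cg.
  by exists B' => x [_]; exact: HB'.
have Cb := @square_integrableM R d.
have CZ e c : square_integrable c -> square_integrable (fun x : V => e * c x).
  move=> Cc; rewrite (_ : (fun x => _) = (fun x => c x * e)).
    exact: Cb Cc (bounded_measurable_cst _ e).
  by apply/funext => x; rewrite mulrC.
have phi_out x : ~ A x -> forall u, taylor_poly k phi x u = 0.
  move=> nA; apply: (taylor_poly_vanishes k oQ phi_outside).
  by move=> Qx; exact: nA (QA _ Qx).
have f_geA x : A x -> b <= f x by case.
have [N [p [D [pp p0 D0 papp]]]] := quotient_local_approximation r_ge1 b_gt0 CZ Cb mA mf f_diff
  dphi Cphi HB f_geA fbound HL phi_out.
have mpsi : measurable_fun [set: V] (fun x => phi x / f x).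
  by apply: measurable_funM => //; exact: measurable_funV.
have psib x : `|phi x / f x| <= B / b.
  have [Qx|nQ] := pselect (Q x); last by rewrite phi_outside// mul0r normr0 divr_ge0// ltW.
  have fx := f_ge Qx; have f0 := lt_le_trans b_gt0 fx.
  by rewrite normrM ler_pM// ger0_norm ?invr_ge0 ?(ltW f0)// lef_pV2 ?posrE.
have phi_rem u : (\int[leb]_x (taylor_rem k phi x u ^+ 2)%:E
     <= (d%:R ^+ (2 * k) * M * enorm u ^+ (2 * k) * enorm u `^ (2 * al))%:E)%E.
  apply: integral_sqr_taylor_rem_le => //; rewrite ?(ltW M_gt0)//.
    by rewrite mulr_ge0// ltW.
  by move=> l lk v; apply: Hphi; rewrite lk.
have M0 : 0 <= d%:R ^+ (2 * k) * M by rewrite mulr_ge0 ?exprn_ge0// ltW.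
have a0 : 0 <= 2 * al by rewrite mulr_ge0// ltW.
have a2 : 2 * al <= 2 by rewrite -[leRHS]mulr1 ler_wpM2l.
have [E E0 HE] := smoothing_error r_ge1 mK K1 Kmom m2_gt0 K_exp a0 a2 M0 D0 mpsi psib mphi
  dphi mA Afin pp p0 papp phi_rem.
exists E => // h h01; apply: le_trans (HE h h01) _; rewrite lee_fin ler_wpM2l//.
have [h0 h1] := andP h01.
have -> : h ^+ (2 * k) * h `^ (2 * al) = (h `^ s) ^+ 2.
  rewrite -(powR_mulrn _ (ltW h0)) -powRD; last by rewrite (gt_eqF h0) implybT.
  rewrite -powR_mulrn ?powR_ge0// -powRrM sE natrM; congr (_ `^ _); ring.
rewrite mulnC exprM.
have x0 : 0 <= h `^ s by exact: powR_ge0.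
have y0 : 0 <= h ^+ r by rewrite exprn_ge0 ?ltW.
by have := mulr_ge0 x0 y0; lra.
Qed.

Lemma kernel_bias_density : exists2 C : R, 0 <= C & forall x (h : R), 0 < h <= 1 ->
    `|\int[leb]_v (K v * f (x - h *: v)) - f x| <= C * h ^+ r.
Proof.
have [_ mK _ K1 Kmom] := K_order.
exact: (kernel_bias r_ge1 mK K1 Kmom m2_gt0 K_exp).
Qed.

End kernel_regression_analysis.

(** * Expectations of bounded measurable functions *)

Section bounded_calculus.
Context d (T : measurableType d) (R : realType).
Implicit Types F G : T -> R.

Lemma bounded_measurableD F G : bounded_measurable F -> bounded_measurable G ->
  bounded_measurable (fun x => F x + G x).
Proof.
move=> [mF [A HA]] [mG [B HB]]; split; first exact: measurable_funD.
by exists (A + B) => x; rewrite (le_trans (ler_normD _ _))// lerD.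
Qed.

Lemma bounded_measurableN F : bounded_measurable F -> bounded_measurable (fun x => - F x).
Proof.
move=> [mF [A HA]]; split; first exact: measurableT_comp.
by exists A => x; rewrite normrN.
Qed.

Lemma bounded_measurableB F G : bounded_measurable F -> bounded_measurable G ->
  bounded_measurable (fun x => F x - G x).
Proof. by move=> bF bG; apply: bounded_measurableD => //; exact: bounded_measurableN. Qed.

Lemma bounded_measurable_sum (I : Type) (s : seq I) (P : pred I) (F : I -> T -> R) :
  (forall i, bounded_measurable (F i)) -> bounded_measurable (fun x => \sum_(i <- s | P i) F i x).
Proof.
move=> bF; elim: s => [|i s IH].
  by under [X in bounded_measurable X]eq_fun do rewrite big_nil; exact: bounded_measurable_cst.
under [X in bounded_measurable X]eq_fun do rewrite big_cons.
by case: (P i) => //; exact: bounded_measurableD.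
Qed.

Lemma bounded_measurable_prod (I : Type) (s : seq I) (P : pred I) (F : I -> T -> R) :
  (forall i, bounded_measurable (F i)) -> bounded_measurable (fun x => \prod_(i <- s | P i) F i x).
Proof.
move=> bF; elim: s => [|i s IH].
  by under [X in bounded_measurable X]eq_fun do rewrite big_nil; exact: bounded_measurable_cst.
under [X in bounded_measurable X]eq_fun do rewrite big_cons.
by case: (P i) => //; exact: bounded_measurableM.
Qed.

Lemma bounded_measurableX F n : bounded_measurable F -> bounded_measurable (fun x => F x ^+ n).
Proof.
move=> bF; elim: n => [|n IH]; first exact: bounded_measurable_cst.
by under [X in bounded_measurable X]eq_fun do rewrite exprS; exact: bounded_measurableM.
Qed.

Lemma bounded_measurable_norm F : bounded_measurable F -> bounded_measurable (fun x => `|F x|).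
Proof.
move=> [mF [A HA]]; split; first exact: measurableT_comp.
by exists A => x; rewrite normr_id.
Qed.

Lemma bounded_measurable_expR F : bounded_measurable F -> bounded_measurable (fun x => expR (F x)).
Proof.
move=> [mF [A HA]]; split; first exact: measurableT_comp.
exists (expR A) => x; rewrite ger0_norm ?expR_ge0// ler_expR.
exact: le_trans (ler_norm _) (HA x).
Qed.

Lemma bounded_measurable_comp d' (T' : measurableType d') (g : T' -> T) F :
  bounded_measurable F -> measurable_fun [set: T'] g -> bounded_measurable (fun x => F (g x)).
Proof.
move=> [mF [A HA]] mg; split; first exact: measurableT_comp.
by exists A => x.
Qed.

Variable mu : probability T R.

Lemma integrable_bounded F : bounded_measurable F -> mu.-integrable [set: T] (EFin \o F).
Proof.
move=> [mF [A HA]]; apply: measurable_bounded_integrable => //.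
  by apply: (@le_lt_trans _ _ 1%E); rewrite ?ltry//; exact: probability_le1.
by exists A; split; [exact: num_real|move=> y Ay x _; exact: le_trans (HA x) (ltW Ay)].
Qed.

Lemma expect_cst (c : R) : \int[mu]_x c = c.
Proof.
transitivity (c * fine (mu setT)); first exact: Rintegral_cst.
by rewrite probability_setT mulr1.
Qed.

Lemma expectD F G : bounded_measurable F -> bounded_measurable G ->
  \int[mu]_x (F x + G x) = \int[mu]_x F x + \int[mu]_x G x.
Proof. by move=> bF bG; rewrite RintegralD//; exact: integrable_bounded. Qed.

Lemma expectB F G : bounded_measurable F -> bounded_measurable G ->
  \int[mu]_x (F x - G x) = \int[mu]_x F x - \int[mu]_x G x.
Proof. by move=> bF bG; rewrite RintegralB//; exact: integrable_bounded. Qed.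

Lemma expectZl (c : R) F : bounded_measurable F -> \int[mu]_x (c * F x) = c * \int[mu]_x F x.
Proof. by move=> bF; rewrite RintegralZl//; exact: integrable_bounded. Qed.

Lemma expectZr (c : R) F : bounded_measurable F -> \int[mu]_x (F x * c) = (\int[mu]_x F x) * c.
Proof. by move=> bF; rewrite RintegralZr//; exact: integrable_bounded. Qed.

Lemma expect_sum (I : Type) (s : seq I) (P : pred I) (F : I -> T -> R) :
  (forall i, bounded_measurable (F i)) ->
  \int[mu]_x (\sum_(i <- s | P i) F i x) = \sum_(i <- s | P i) \int[mu]_x F i x.
Proof.
move=> bF; rewrite -big_filter; under eq_Rintegral do rewrite -big_filter.
by apply: Rintegral_sum => i; exact: integrable_bounded.
Qed.

Lemma le_expect F G : bounded_measurable F -> bounded_measurable G ->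
  (forall x, F x <= G x) -> \int[mu]_x F x <= \int[mu]_x G x.
Proof.
by move=> bF bG FG; apply: le_Rintegral => //; exact: integrable_bounded.
Qed.

Lemma le_expect_cst F c : bounded_measurable F -> (forall x, F x <= c) -> \int[mu]_x F x <= c.
Proof.
move=> bF Fc; rewrite -[leRHS]expect_cst; apply: le_expect => //.
exact: bounded_measurable_cst.
Qed.

Lemma norm_expect_le F : bounded_measurable F -> `|\int[mu]_x F x| <= \int[mu]_x `|F x|.
Proof. by move=> bF; apply: le_normr_Rintegral => //; exact: integrable_bounded. Qed.

Lemma expect_ge0 F : (forall x, 0 <= F x) -> 0 <= \int[mu]_x F x.
Proof. by move=> F0; apply: Rintegral_ge0. Qed.

Lemma EFin_expect F : bounded_measurable F -> (\int[mu]_x (F x)%:E = (\int[mu]_x F x)%:E)%E.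
Proof.
move=> bF; rewrite /Rintegral fineK//.
exact: integrable_fin_num (integrable_bounded bF).
Qed.

Lemma sqr_expect_le F : bounded_measurable F ->
  (\int[mu]_x F x) ^+ 2 <= \int[mu]_x (F x ^+ 2).
Proof.
move=> bF; set c := \int[mu]_x F x.
have bF2 : bounded_measurable (fun x => F x ^+ 2) by exact: bounded_measurableX.
have b2 : bounded_measurable (fun x => 2 * c * F x).
  by apply: bounded_measurableM => //; exact: bounded_measurable_cst.
have : 0 <= \int[mu]_x (F x ^+ 2 - 2 * c * F x + c ^+ 2).
  apply: expect_ge0 => x; rewrite (_ : _ + _ = (F x - c) ^+ 2) ?sqr_ge0//.
  by ring.
rewrite expectD; [|exact: bounded_measurableB|exact: bounded_measurable_cst].
rewrite expectB// expectZl// expect_cst -/c; lra.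
Qed.

Lemma expect_norm_le_sqrt F : bounded_measurable F ->
  \int[mu]_x `|F x| <= Num.sqrt (\int[mu]_x (F x ^+ 2)).
Proof.
move=> bF; rewrite -[leLHS]ger0_norm ?expect_ge0// -sqrtr_sqr ler_wsqrtr//.
apply: le_trans (sqr_expect_le (bounded_measurable_norm bF)) _.
apply: le_expect; [exact/bounded_measurableX/bounded_measurable_norm|exact: bounded_measurableX|].
by move=> x; rewrite real_normK ?num_real.
Qed.

End bounded_calculus.

Lemma prod_setT_lty d1 d2 (T1 : measurableType d1) (T2 : measurableType d2) (R : realType)
  (m1 : probability T1 R) (m2 : probability T2 R) : ((m1 \x m2)%E setT < +oo)%E.
Proof.
rewrite -setXTT; apply: (@le_lt_trans _ _ (m1 setT * m2 setT)%E).
  by rewrite le_eqVlt; apply/orP; left; apply/eqP; exact: product_measure1E.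
by rewrite !probability_setT mule1 ltry.
Qed.

Section bounded_fubini.
Context d1 d2 (T1 : measurableType d1) (T2 : measurableType d2) (R : realType).
Variables (m1 : probability T1 R) (m2 : probability T2 R) (F : T1 * T2 -> R).
Hypothesis bF : bounded_measurable F.

Lemma bounded_measurable_sectl x : bounded_measurable (fun y => F (x, y)).
Proof. exact: bounded_measurable_comp bF (pair1_measurable x). Qed.

Lemma bounded_measurable_sectr y : bounded_measurable (fun x => F (x, y)).
Proof. exact: bounded_measurable_comp bF (pair2_measurable y). Qed.

Lemma bounded_measurable_expect : bounded_measurable (fun x => \int[m2]_y F (x, y)).
Proof.
split; first by apply: measurable_Rintegral_param; case: bF.
have [_ [B HB]] := bF; exists B => x.
apply: le_trans (norm_expect_le _ (bounded_measurable_sectl x)) _.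
apply: le_expect_cst => [|y]; first exact: bounded_measurable_norm (bounded_measurable_sectl x).
exact: HB.
Qed.

Lemma expect_prod : \int[(m1 \x m2)%E]_z F z = \int[m1]_x \int[m2]_y F (x, y).
Proof.
have iF : (m1 \x m2)%E.-integrable setT (EFin \o F).
  have [mF [A HA]] := bF; apply: measurable_bounded_integrable => //.
    exact: prod_setT_lty.
  by exists A; split; [exact: num_real|move=> y Ay x _; exact: le_trans (HA x) (ltW Ay)].
rewrite {1}/Rintegral -integral12_prod_meas1//; congr fine.
by apply: eq_integral => x _; rewrite -EFin_expect//; exact: bounded_measurable_sectl.
Qed.

End bounded_fubini.

Lemma expect_fubini d1 d2 (T1 : measurableType d1) (T2 : measurableType d2) (R : realType)
    (m1 : probability T1 R) (m2 : probability T2 R) (F : T1 -> T2 -> R) :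
  bounded_measurable (fun z : T1 * T2 => F z.1 z.2) ->
  \int[m1]_x \int[m2]_y F x y = \int[m2]_y \int[m1]_x F x y.
Proof.
move=> bF.
have iF : (m1 \x m2)%E.-integrable setT (EFin \o (fun z => F z.1 z.2)).
  have [mF [A HA]] := bF; apply: measurable_bounded_integrable => //.
    exact: prod_setT_lty.
  by exists A; split; [exact: num_real|move=> y Ay x _; exact: le_trans (HA x) (ltW Ay)].
have := Fubini iF; rewrite /Rintegral => E; congr fine.
transitivity (\int[m1]_x \int[m2]_y (F x y)%:E)%E.
  apply: eq_integral => x _; rewrite EFin_expect//.
  exact: bounded_measurable_sectl bF x.
rewrite E; apply: eq_integral => y _; rewrite EFin_expect//.
exact: bounded_measurable_sectr bF y.
Qed.

(** * Redrawing one coordinate of a sample *)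

Section tuple_update.
Context d (T : measurableType d) (n : nat).
Implicit Types (t : n.-tuple T) (j : 'I_n) (y : T).

Definition upd t j y : n.-tuple T := [tuple if i == j then y else tnth t i | i < n].

Lemma tnth_upd t j y i : tnth (upd t j y) i = if i == j then y else tnth t i.
Proof. exact: tnth_mktuple. Qed.

Lemma measurable_upd j : measurable_fun setT (fun z : n.-tuple T * T => upd z.1 j z.2).
Proof.
apply/measurable_fun_tnthP => i.
rewrite (_ : _ \o _ = fun z : n.-tuple T * T => if i == j then z.2 else tnth z.1 i).
  case: (i == j); first exact: measurable_snd.
  exact: (measurableT_comp (measurable_tnth i) measurable_fst).
by apply/funext => z /=; rewrite tnth_upd.
Qed.

Definition tuple_box (A : 'I_n -> set T) : set (n.-tuple T) := [set t | forall i, A i (tnth t i)].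

Lemma measurable_tuple_box A : (forall i, measurable (A i)) -> measurable (tuple_box A).
Proof.
move=> mA; rewrite (_ : tuple_box A = \bigcap_(i in setT) ((fun t => tnth t i) @^-1` A i)).
  apply: fin_bigcap_measurable => // i _.
  by rewrite -[X in measurable X]setTI; exact: measurable_tnth.
by apply/seteqP; split => x /= xA i => [_|]; exact: xA.
Qed.

(** Boxes form a pi-system that generates the product sigma-algebra. *)
Lemma eq_measure_tuple (R : realType) (m1 : probability (n.-tuple T) R)
    (m2 : {measure set (n.-tuple T) -> \bar R}) :
  (forall A, (forall i, measurable (A i)) -> m1 (tuple_box A) = m2 (tuple_box A)) ->
  forall A, measurable A -> m1 A = m2 A.
Proof.
move=> H.
pose GG := [set B : set (n.-tuple T) | exists2 A : 'I_n -> set T, (forall i, measurable (A i)) & B = tuple_box A].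
apply: (@measure_unique _ _ _ GG (fun=> setT)) => //.
- apply/seteqP; split.
    apply: smallest_sub; first exact: smallest_sigma_algebra.
    rewrite -bigcup_seq; apply: bigcup_sub => i _ B [C mC <-].
    apply: sub_sigma_algebra; exists (fun j => if j == i then C else setT).
      by move=> j; case: (j == i).
    rewrite setTI; apply/seteqP; split => t /= => [Ct j|/(_ i)]; last by rewrite eqxx.
    by case: eqP => [->|].
  apply: smallest_sub; first exact: sigma_algebra_measurable.
  by move=> B [A mA ->]; exact: measurable_tuple_box.
- move=> B1 B2 [A1 mA1 ->] [A2 mA2 ->]; exists (fun i => A1 i `&` A2 i).
    by move=> i; exact: measurableI.
  apply/seteqP; split => t /=; first by move=> [h1 h2] i; split; [exact: h1|exact: h2].
  by move=> h; split=> i; have [] := h i.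
- by move=> _; exists (fun=> setT) => //; apply/seteqP; split.
- by apply/seteqP; split => // t _; exists 0%N.
- by move=> B [A mA ->]; exact: H.
- by move=> _; apply: (@le_lt_trans _ _ 1%E); rewrite ?ltry//; exact: probability_le1.
Qed.

End tuple_update.

(** The only consequence of independence and identical distribution that the moment
computations use: the law of the sample is invariant when one coordinate is redrawn. *)
Definition resampling d (T : measurableType d) (R : realType) n
    (mu : probability T R) (nu : probability (n.-tuple T) R) : Prop :=
  forall (j : 'I_n) (F : n.-tuple T -> R), bounded_measurable F ->
  \int[nu]_t F t = \int[nu]_t \int[mu]_y F (upd t j y).

Section iid_sample.
Context disp disp' (Omega : measurableType disp) (T : measurableType disp') (R : realType).
Variables (P : probability Omega R) (X : nat -> {RV P >-> T}).
Hypotheses (X_indep : mutually_independent X) (X_ident : identically_distributed X).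
Variable n : nat.

Definition sample_tuple (w : Omega) : n.-tuple T := [tuple X i w | i < n].

Lemma measurable_sample_tuple : measurable_fun [set: Omega] sample_tuple.
Proof.
apply/measurable_fun_tnthP => i.
rewrite (_ : _ \o _ = (X i : Omega -> T)); first exact: measurable_funP.
by apply/funext => w /=; rewrite tnth_mktuple.
Qed.

HB.instance Definition _ := isMeasurableFun.Build _ _ _ _ sample_tuple measurable_sample_tuple.

Let nu := distribution P sample_tuple.
Let mu := distribution P (X 0%N).

Lemma sample_box (A : 'I_n -> set T) : (forall i, measurable (A i)) ->
  (nu (tuple_box A) = \prod_(i < n) mu (A i))%E.
Proof.
move=> mA; pose B (j : nat) : set T := if insub j is Some i then A i else setT.
have BE (i : 'I_n) : B i = A i by rewrite /B valK.
have mB j : measurable (B j) by rewrite /B; case: insubP.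
have := X_indep (iota_uniq 0 n) mB.
rewrite (_ : \bigcap_(j in _) _ = sample_tuple @^-1` tuple_box A); last first.
  apply/seteqP; split => w /=.
    move=> h i; rewrite tnth_mktuple -BE; apply: (h i).
    by rewrite /= mem_iota add0n ltn_ord.
  move=> h j; rewrite /= mem_iota add0n => jn.
  by have := h (Ordinal jn); rewrite tnth_mktuple -BE.
rewrite /nu /distribution /pushforward => ->.
rewrite -{1}(subn0 n) -/(index_iota 0 n) big_mkord; apply: eq_bigr => i _.
by rewrite BE; exact: X_ident.
Qed.

(** Both sides are integrals for probability measures on tuples that agree on boxes. *)
Lemma sample_resampling : resampling (mu : probability T R) (nu : probability (n.-tuple T) R).
Proof.
move=> j F bF.
pose U (z : n.-tuple T * T) := upd z.1 j z.2.
have mU : measurable_fun setT U by exact: measurable_upd.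
pose nu' := measure_function_pushforward__canonical__measure_function_Measure (nu \x mu)%E mU.
have nuE A : measurable A -> nu A = nu' A.
  apply: eq_measure_tuple => {}A mA.
  rewrite [RHS](_ : _ = (nu \x mu)%E (tuple_box (fun i => if i == j then setT else A i) `*` A j)); last first.
    congr ((nu \x mu)%E _); apply/seteqP; split => -[t y] /=.
      move=> h; split=> [i|]; last by have := h j; rewrite tnth_upd eqxx.
      by have := h i; rewrite tnth_upd; case: eqP.
    move=> [h Ay] i; rewrite tnth_upd; case: eqP => [->//|/eqP ij].
    by have := h i; rewrite (negbTE ij).
  have mA' i : measurable (if i == j then setT else A i) by case: (i == j).
  rewrite product_measure1E//; last exact: measurable_tuple_box.
  transitivity (\prod_(i < n) mu (A i))%E; first exact: sample_box.
  transitivity ((\prod_(i < n) mu (if i == j then setT else A i)) * mu (A j))%E; last first.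
    by congr (_ * _)%E; apply/esym; exact: sample_box.
  rewrite (bigD1 j)//= [X in (_ = X * _)%E](bigD1 j)//= eqxx.
  have -> : mu setT = 1%E by exact: probability_setT.
  rewrite mul1e muleC; congr (_ * _)%E.
  by apply: eq_bigr => i /negbTE ->.
have iF : (nu \x mu)%E.-integrable setT (EFin \o (fun z => F (U z))).
  have [mF [B HB]] := bF; apply: measurable_bounded_integrable => //.
  - exact: prod_setT_lty.
  - exact: measurableT_comp.
  - by exists B; split; [exact: num_real|move=> y By x _; exact: le_trans (HB _) (ltW By)].
transitivity (\int[nu']_t F t).
  by congr fine; apply: eq_measure_integral => A mA _; exact: nuE.
transitivity (\int[(nu \x mu)%E]_z F (U z)).
  congr fine; rewrite -[LHS]/(\int[pushforward (nu \x mu)%E U]_t (F t)%:E)%E.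
  by rewrite integral_pushforward//; apply/measurable_EFinP; case: bF.
by apply: expect_prod; exact: bounded_measurable_comp bF mU.
Qed.

End iid_sample.

(** * Moments of degenerate sums *)

Section resampling_moments.
Context d (T : measurableType d) (R : realType) (n : nat).
Variables (mu : probability T R) (nu : probability (n.-tuple T) R).
Hypothesis nu_res : resampling mu nu.

Lemma bounded_measurable_tnth (F : T -> R) (i : 'I_n) : bounded_measurable F ->
  bounded_measurable (fun t : n.-tuple T => F (tnth t i)).
Proof. by move=> bF; exact: bounded_measurable_comp bF (measurable_tnth i). Qed.

Lemma measurable_tnth2 (i j : 'I_n) :
  measurable_fun setT (fun t : n.-tuple T => (tnth t i, tnth t j)).
Proof. by apply/measurable_fun_pairP; split; exact: measurable_tnth. Qed.

Lemma bounded_measurable_tnth2 (F : T -> T -> R) (i j : 'I_n) :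
  bounded_measurable (fun z : T * T => F z.1 z.2) ->
  bounded_measurable (fun t : n.-tuple T => F (tnth t i) (tnth t j)).
Proof. by move=> bF; exact: bounded_measurable_comp bF (measurable_tnth2 i j). Qed.

Lemma bounded_measurable_tnth3 (F : T -> T -> T -> R) (i j k : 'I_n) :
  bounded_measurable (fun z : T * T * T => F z.1.1 z.1.2 z.2) ->
  bounded_measurable (fun t : n.-tuple T => F (tnth t i) (tnth t j) (tnth t k)).
Proof.
move=> bF; have mt : measurable_fun setT (fun t : n.-tuple T => ((tnth t i, tnth t j), tnth t k)).
  by apply/measurable_fun_pairP; split; [exact: measurable_tnth2|exact: measurable_tnth].
exact: bounded_measurable_comp bF mt.
Qed.

Lemma bounded_measurable_upd (F : n.-tuple T -> R) (j : 'I_n) : bounded_measurable F ->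
  bounded_measurable (fun t => \int[mu]_y F (upd t j y)).
Proof.
move=> bF; apply: (@bounded_measurable_expect _ _ _ _ _ mu (fun z : n.-tuple T * T => F (upd z.1 j z.2))).
exact: bounded_measurable_comp bF (measurable_upd j).
Qed.

Lemma expect_coord (F : T -> R) (i : 'I_n) : bounded_measurable F ->
  \int[nu]_t F (tnth t i) = \int[mu]_x F x.
Proof.
move=> bF; rewrite (nu_res i (bounded_measurable_tnth i bF)).
under eq_Rintegral do under eq_Rintegral do rewrite tnth_upd eqxx.
by rewrite expect_cst.
Qed.

Lemma expect_coord2 (F : T -> T -> R) (i j : 'I_n) : i != j ->
  bounded_measurable (fun z : T * T => F z.1 z.2) ->
  \int[nu]_t F (tnth t i) (tnth t j) = \int[mu]_x \int[mu]_y F x y.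
Proof.
move=> ij bF; rewrite (nu_res j (bounded_measurable_tnth2 i j bF)).
under eq_Rintegral do under eq_Rintegral do rewrite !tnth_upd eqxx (negbTE ij).
by rewrite (expect_coord (F := fun x => \int[mu]_y F x y))//; exact: bounded_measurable_expect bF.
Qed.

Lemma expect_coord3 (F : T -> T -> T -> R) (i j k : 'I_n) : i != j -> i != k -> j != k ->
  bounded_measurable (fun z : T * T * T => F z.1.1 z.1.2 z.2) ->
  \int[nu]_t F (tnth t i) (tnth t j) (tnth t k) = \int[mu]_x \int[mu]_y \int[mu]_z F x y z.
Proof.
move=> ij ik jk bF; rewrite (nu_res k (bounded_measurable_tnth3 i j k bF)).
under eq_Rintegral do under eq_Rintegral do rewrite !tnth_upd eqxx (negbTE ik) (negbTE jk).
rewrite (expect_coord2 (F := fun x y => \int[mu]_z F x y z))//.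
exact: (@bounded_measurable_expect _ _ _ _ _ mu (fun z : (T * T) * T => F z.1.1 z.1.2 z.2)).
Qed.

Section degenerate_families.
Variables (I : finType) (S : I -> {set 'I_n}) (F : I -> n.-tuple T -> R).
Hypothesis bF : forall a, bounded_measurable (F a).
Hypothesis F_indep : forall a j, j \notin S a -> forall t y, F a (upd t j y) = F a t.
Hypothesis F_degen : forall a j, j \in S a -> forall t, \int[mu]_y F a (upd t j y) = 0.

(** Averaging over a coordinate that only one of the two factors depends on kills
the product. *)
Lemma degenerate_orthogonal a b : S a != S b -> \int[nu]_t (F a t * F b t) = 0.
Proof.
wlog [j ja jb] : a b / exists2 j, j \in S a & j \notin S b.
  move=> H Sab; have [sab|/fintype.subsetPn[j ja jb]] := boolP (S a \subset S b); last first.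
    by apply: H => //; exists j.
  have /fintype.subsetPn[j jb ja] : ~~ (S b \subset S a).
    by apply: contra Sab => sba; rewrite finset.eqEsubset sab.
  under eq_Rintegral do rewrite mulrC.
  by apply: H; [exists j|rewrite eq_sym].
move=> _; rewrite (nu_res j); last exact: bounded_measurableM.
under eq_Rintegral => t _.
  under eq_Rintegral => y _ do rewrite (F_indep jb).
  rewrite expectZr; last first.
    exact: (bounded_measurable_comp (bF a) (measurableT_comp (measurable_upd j) (pair1_measurable t))).
  rewrite F_degen// mul0r; over.
exact: expect_cst.
Qed.

(** By orthogonality only pairs of terms that depend on the same coordinates remain; [m]
bounds the number of partners of a term. *)
Lemma expect_sqr_sum_degenerate (m v : R) : 0 <= v ->
  (forall a, \int[nu]_t (F a t ^+ 2) <= v) ->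
  (forall a, #|[set b | S b == S a]%SET|%:R <= m) ->
  \int[nu]_t ((\sum_a F a t) ^+ 2) <= #|I|%:R * m * v.
Proof.
move=> v0 Hv Hm.
have bFF a b : bounded_measurable (fun t => F a t * F b t) by exact: bounded_measurableM.
under eq_Rintegral do rewrite expr2 big_distrlr/=.
rewrite expect_sum; last by move=> a; apply: bounded_measurable_sum => b.
apply: (@le_trans _ _ (\sum_(a : I) m * v)); last first.
  by rewrite sumr_const -mulrA mulr_natl.
apply: ler_sum => a _; rewrite expect_sum//.
rewrite (bigID (fun b => S b == S a))/= [X in _ + X]big1 ?addr0; last first.
  by move=> b Sba; apply: degenerate_orthogonal; rewrite eq_sym.
apply: (@le_trans _ _ (\sum_(b | S b == S a) v)).
  apply: ler_sum => b _.
  apply: (@le_trans _ _ (\int[nu]_t (F a t ^+ 2 * 2^-1 + F b t ^+ 2 * 2^-1))).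
    apply: le_expect => // [|t].
      by apply: bounded_measurableD; apply: bounded_measurableM; [exact: bounded_measurableX|exact: bounded_measurable_cst|exact: bounded_measurableX|exact: bounded_measurable_cst].
    by have := sqr_ge0 (F a t - F b t); lra.
  rewrite expectD ?expectZr; [|exact: bounded_measurableX..| |].
  - by have := Hv a; have := Hv b; lra.
  - by apply: bounded_measurableM; [exact: bounded_measurableX|exact: bounded_measurable_cst].
  - by apply: bounded_measurableM; [exact: bounded_measurableX|exact: bounded_measurable_cst].
rewrite (eq_bigl (fun b => b \in [set b | S b == S a]%SET)); last by move=> b; rewrite inE.
by rewrite sumr_const -[leLHS]mulr_natl ler_wpM2r.
Qed.

End degenerate_families.

Lemma expect_sqr_sum1 (g : T -> R) : bounded_measurable g -> \int[mu]_x g x = 0 ->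
  \int[nu]_t ((\sum_i g (tnth t i)) ^+ 2) <= n%:R * \int[mu]_x (g x ^+ 2).
Proof.
move=> bg g0.
have := @expect_sqr_sum_degenerate _ (fun i : 'I_n => [set i]%SET) (fun i t => g (tnth t i)).
move=> /(_ (fun i => bounded_measurable_tnth i bg)).
move=> /(_ _ _ 1 (\int[mu]_x (g x ^+ 2))); rewrite card_ord mulr1; apply.
- by move=> i j; rewrite inE => ij t y; rewrite tnth_upd eq_sym (negbTE ij).
- move=> i j; rewrite inE => /eqP -> t; under eq_Rintegral do rewrite tnth_upd eqxx.
  exact: g0.
- by apply: expect_ge0 => x; exact: sqr_ge0.
- by move=> i; rewrite (expect_coord (F := fun x => g x ^+ 2))//; exact: bounded_measurableX.
- move=> i; rewrite (_ : [set b | _]%SET = [set i]%SET) ?cards1//.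
  apply/setP => j; rewrite !inE; apply/eqP/eqP => [/setP/(_ j)|->//].
  by rewrite !inE eqxx => /esym/eqP.
Qed.

(** [4 = 2 * 2] bounds the number of pairs of indices with a given underlying set. *)
Lemma expect_sqr_sum2 (g : T -> T -> R) :
  bounded_measurable (fun z : T * T => g z.1 z.2) ->
  (forall x, \int[mu]_y g x y = 0) -> (forall y, \int[mu]_x g x y = 0) ->
  \int[nu]_t ((\sum_i \sum_(j | j != i) g (tnth t i) (tnth t j)) ^+ 2)
    <= 4 * n%:R ^+ 2 * \int[mu]_x \int[mu]_y (g x y ^+ 2).
Proof.
move=> bg gx gy; set v := \int[mu]_x _.
have v0 : 0 <= v by apply: expect_ge0 => x; apply: expect_ge0 => y; exact: sqr_ge0.
have bg2 : bounded_measurable (fun z : T * T => g z.1 z.2 ^+ 2) by exact: bounded_measurableX.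
pose F (a : 'I_n * 'I_n) t : R := if a.2 != a.1 then g (tnth t a.1) (tnth t a.2) else 0.
under eq_Rintegral do under eq_bigr do rewrite big_mkcond/=.
under eq_Rintegral do rewrite pair_bigA/= -/(F _ _).
have := @expect_sqr_sum_degenerate _ (fun a : 'I_n * 'I_n => [set a.1; a.2]%SET) F.
have -> : 4 * n%:R ^+ 2 * v = #|{: 'I_n * 'I_n}|%:R * 4 * v :> R.
  by rewrite card_prod !card_ord natrM; ring.
apply => //.
- move=> a; rewrite /F; case: (a.2 != a.1); last exact: bounded_measurable_cst.
  exact: bounded_measurable_tnth2.
- move=> [a b] j; rewrite !inE negb_or /F/= => /andP[ja jb] t y.
  by rewrite !tnth_upd [a == j]eq_sym [b == j]eq_sym (negbTE ja) (negbTE jb).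
- move=> [a b] j; rewrite !inE /F/= => jab t; case: (boolP (b != a)) => ab; last exact: expect_cst.
  case/orP: jab => /eqP ->.
    by under eq_Rintegral do rewrite !tnth_upd eqxx (negbTE ab); exact: gy.
  by under eq_Rintegral do rewrite !tnth_upd eqxx eq_sym (negbTE ab); exact: gx.
- move=> [a b]; rewrite /F/=; case: (boolP (b != a)) => ab.
    by rewrite (expect_coord2 (F := fun x y => g x y ^+ 2))// eq_sym.
  by under eq_Rintegral do rewrite expr0n; rewrite expect_cst.
- move=> [a b] /=; rewrite (_ : 4 = (2 * 2)%:R)// ler_nat.
  have c2 : (#|[set a; b]%SET| <= 2)%N by rewrite cards2; case: (_ != _).
  apply: leq_trans (leq_mul c2 c2); rewrite -cardsX subset_leq_card//.
  apply/fintype.subsetP => -[a' b']; rewrite !inE/= => /eqP E.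
  have := finset.set21 a' b'; have := finset.set22 a' b'; rewrite E !inE.
  by move=> /orP[]/eqP-> /orP[]/eqP->; rewrite ?eqxx ?orbT.
Qed.

(** [27 = 3 * 3 * 3] bounds the number of triples of indices with a given underlying set. *)
Lemma expect_sqr_sum3 (g : T -> T -> T -> R) :
  bounded_measurable (fun z : T * T * T => g z.1.1 z.1.2 z.2) ->
  (forall x y, \int[mu]_z g x y z = 0) -> (forall x z, \int[mu]_y g x y z = 0) ->
  (forall y z, \int[mu]_x g x y z = 0) ->
  \int[nu]_t ((\sum_i \sum_(j | j != i) \sum_(k | (k != i) && (k != j))
      g (tnth t i) (tnth t j) (tnth t k)) ^+ 2)
    <= 27 * n%:R ^+ 3 * \int[mu]_x \int[mu]_y \int[mu]_z (g x y z ^+ 2).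
Proof.
move=> bg gz gy gx; set v := \int[mu]_x _.
have v0 : 0 <= v.
  by do 3 apply: expect_ge0 => ?; exact: sqr_ge0.
have bg2 : bounded_measurable (fun z : T * T * T => g z.1.1 z.1.2 z.2 ^+ 2) by exact: bounded_measurableX.
pose F (a : 'I_n * 'I_n * 'I_n) t : R :=
  if [&& a.1.2 != a.1.1, a.2 != a.1.1 & a.2 != a.1.2] then g (tnth t a.1.1) (tnth t a.1.2) (tnth t a.2) else 0.
have E t : \sum_i \sum_(j | j != i) \sum_(k | (k != i) && (k != j)) g (tnth t i) (tnth t j) (tnth t k)
    = \sum_a F a t.
  rewrite -(pair_bigA _ (fun a k => F (a, k) t))/= -(pair_bigA _ (fun i j => \sum_k F (i, j, k) t))/=.
  apply: eq_bigr => i _; rewrite big_mkcond/=; apply: eq_bigr => j _.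
  rewrite /F/=; case: (j != i) => /=; last by rewrite big1.
  by rewrite big_mkcond.
under eq_Rintegral do rewrite E.
have := @expect_sqr_sum_degenerate _ (fun a : 'I_n * 'I_n * 'I_n => [set a.1.1; a.1.2; a.2]%SET) F.
have -> : 27 * n%:R ^+ 3 * v = #|{: 'I_n * 'I_n * 'I_n}|%:R * 27 * v :> R.
  by rewrite !card_prod !card_ord !natrM; ring.
apply => //.
- move=> a; rewrite /F; case: [&& a.1.2 != a.1.1, a.2 != a.1.1 & a.2 != a.1.2]; last exact: bounded_measurable_cst.
  exact: bounded_measurable_tnth3.
- move=> [[a b] c] j; rewrite !inE !negb_or /F/= => /andP[/andP[ja jb] jc] t y.
  by rewrite !tnth_upd [a == j]eq_sym [b == j]eq_sym [c == j]eq_sym (negbTE ja) (negbTE jb) (negbTE jc).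
- move=> [[a b] c] j; rewrite !inE /F/= => jab t; case: (boolP [&& b != a, c != a & c != b]) => [/and3P[ba ca cb]|_]; last exact: expect_cst.
  case/orP: jab => [/orP[]|] /eqP ->.
  + by under eq_Rintegral do rewrite !tnth_upd eqxx (negbTE ba) (negbTE ca); exact: gx.
  + by under eq_Rintegral do rewrite !tnth_upd eqxx (negbTE cb) eq_sym (negbTE ba); exact: gy.
  + by under eq_Rintegral do rewrite !tnth_upd eqxx ![_ == c]eq_sym (negbTE ca) (negbTE cb); exact: gz.
- move=> [[a b] c]; rewrite /F/=; case: (boolP [&& b != a, c != a & c != b]) => [/and3P[ba ca cb]|_].
    by rewrite (expect_coord3 (F := fun x y z => g x y z ^+ 2))// eq_sym.
  by under eq_Rintegral do rewrite expr0n; rewrite expect_cst.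
- move=> [[a b] c] /=; rewrite (_ : 27 = (3 * 3 * 3)%:R)// ler_nat.
  have c3 : (#|[set a; b; c]%SET| <= 3)%N.
    rewrite (leq_trans (leq_card_setU _ _))// cards1 addn1 ltnS cards2.
    by case: (_ != _).
  apply: leq_trans (leq_mul (leq_mul c3 c3) c3); rewrite -!cardsX subset_leq_card//.
  apply/fintype.subsetP => -[[a' b'] c']; rewrite !inE/= => /eqP E'.
  have ha : a' \in [set a; b; c]%SET by rewrite -E' !inE eqxx.
  have hb : b' \in [set a; b; c]%SET by rewrite -E' !inE eqxx orbT.
  have hc : c' \in [set a; b; c]%SET by rewrite -E' !inE eqxx !orbT.
  by move: ha hb hc; rewrite !inE => -> -> ->.
Qed.

(** The factors other than the common coordinate are integrated out one after the other. *)
Lemma expect_prod_coord_le (G : T -> T -> R) (c : R) (i : 'I_n) (s : seq 'I_n) : 0 <= c ->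
  bounded_measurable (fun z : T * T => G z.1 z.2) ->
  (forall x y, 0 <= G x y) -> (forall x, \int[mu]_y G x y <= c) ->
  uniq s -> i \notin s ->
  \int[nu]_t (\prod_(j <- s) G (tnth t i) (tnth t j)) <= c ^+ size s.
Proof.
move=> c0 bG G0 Gc; elim: s => [_ _|j s IH].
  under eq_Rintegral do rewrite big_nil.
  by rewrite expect_cst expr0.
rewrite cons_uniq inE negb_or => /andP[js us] /andP[ij si].
have bP s' : bounded_measurable (fun t : n.-tuple T => \prod_(j <- s') G (tnth t i) (tnth t j)).
  by apply: bounded_measurable_prod => k; exact: bounded_measurable_tnth2.
rewrite (nu_res j (bP _)).
apply: (@le_trans _ _ (\int[nu]_t (c * \prod_(j <- s) G (tnth t i) (tnth t j)))); last first.
  by rewrite expectZl// exprS ler_wpM2l// IH.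
apply: le_expect; [exact: bounded_measurable_upd (bP _)| |].
  by apply: bounded_measurableM => //; exact: bounded_measurable_cst.
move=> t.
have E y : \prod_(k <- j :: s) G (tnth (upd t j y) i) (tnth (upd t j y) k) =
    G (tnth t i) y * \prod_(k <- s) G (tnth t i) (tnth t k).
  rewrite big_cons !tnth_upd eqxx (negbTE ij); congr (_ * _).
  apply: eq_big_seq => k ks; rewrite tnth_upd; case: eqP => // kj.
  by rewrite -kj ks in js.
under eq_Rintegral do rewrite E.
rewrite expectZr; last exact: (bounded_measurable_sectl bG).
by rewrite ler_wpM2r// prodr_ge0.
Qed.

End resampling_moments.

(** * Elementary inequalities for squares *)

Section square_bounds.
Context {R : realFieldType}.
Implicit Types (u v w z a b c e D x y t : R).

Lemma sqr_linear_comb_le u v w a b c :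
  u ^+ 2 <= a -> v ^+ 2 <= b -> w ^+ 2 <= c ->
  (2 * u - v - w) ^+ 2 <= 12 * a + 3 * b + 3 * c.
Proof.
have s1 := sqr_ge0 (2 * u + v); have s2 := sqr_ge0 (2 * u + w); have s3 := sqr_ge0 (v - w).
move=> *; lra.
Qed.

Lemma sqr_add4_le u v w z : (u - v - w + z) ^+ 2 <= 4 * u ^+ 2 + 4 * v ^+ 2 + 4 * w ^+ 2 + 4 * z ^+ 2.
Proof.
have s1 := sqr_ge0 (u + v); have s2 := sqr_ge0 (u + w); have s3 := sqr_ge0 (u - z).
have s4 := sqr_ge0 (v - w); have s5 := sqr_ge0 (v + z); have s6 := sqr_ge0 (w + z).
lra.
Qed.

Lemma sqr_add3_le u v w : (u + v + w) ^+ 2 <= 3 * u ^+ 2 + 3 * v ^+ 2 + 3 * w ^+ 2.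
Proof.
have s1 := sqr_ge0 (u - v); have s2 := sqr_ge0 (u - w); have s3 := sqr_ge0 (v - w).
lra.
Qed.

Lemma sqr_le_of_norm u v : `|u| <= v -> u ^+ 2 <= v ^+ 2.
Proof.
move=> uv; rewrite -(real_normK (num_real u)) lerXn2r ?nnegrE//.
exact: le_trans uv.
Qed.

End square_bounds.

(** * Hoeffding decomposition of sums over pairs *)

Section hoeffding_decomposition.
Context d (T : measurableType d) (R : realType) (n : nat).
Variables (mu : probability T R) (nu : probability (n.-tuple T) R).
Hypothesis nu_res : resampling mu nu.
Variables (F : T -> T -> R) (J : R).
Hypothesis bF : bounded_measurable (fun z : T * T => F z.1 z.2).
Hypothesis F_sqr : forall x, \int[mu]_y (F x y ^+ 2) <= J.

Let a x := \int[mu]_y F x y.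
Let c y := \int[mu]_x F x y.
Let theta := \int[mu]_x a x.


Let ba : bounded_measurable a.
Proof. exact: bounded_measurable_expect bF. Qed.

Let bF' : bounded_measurable (fun z : T * T => F z.2 z.1).
Proof.
apply: (bounded_measurable_comp bF (g := fun z : T * T => (z.2, z.1))).
by apply/measurable_fun_pairP; split; [exact: measurable_snd|exact: measurable_fst].
Qed.

Let bc : bounded_measurable c.
Proof. exact: bounded_measurable_expect bF'. Qed.

Let bl x : bounded_measurable (F x). Proof. exact: (bounded_measurable_sectl bF x). Qed.

Let br y : bounded_measurable (F^~ y). Proof. exact: (bounded_measurable_sectr bF y). Qed.

Let int_c : \int[mu]_y c y = theta.
Proof. by rewrite -(expect_fubini mu mu bF). Qed.

(** The completely degenerate part of [F]. *)
Let g x y := F x y - a x - c y + theta.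

Let bFa x : bounded_measurable (fun y => F x y - a x).
Proof. by apply: bounded_measurableB; [exact: bl|exact: bounded_measurable_cst]. Qed.

Let bFc y : bounded_measurable (fun x => F x y - a x).
Proof. by apply: bounded_measurableB; [exact: br|exact: ba]. Qed.

Let bg : bounded_measurable (fun z : T * T => g z.1 z.2).
Proof.
apply: bounded_measurableD; last exact: bounded_measurable_cst.
apply: bounded_measurableB; last exact: bounded_measurable_comp bc measurable_snd.
apply: bounded_measurableB; first exact: bF.
exact: bounded_measurable_comp ba measurable_fst.
Qed.

Let gl x : \int[mu]_y g x y = 0.
Proof.
rewrite /g expectD; [|exact: bounded_measurableB (bFa x) bc|exact: bounded_measurable_cst].
rewrite (expectB _ (bFa x) bc) (expectB _ (bl x)); last exact: bounded_measurable_cst.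
by rewrite !expect_cst int_c -/(a x); ring.
Qed.

Let gr y : \int[mu]_x g x y = 0.
Proof.
rewrite /g expectD; [|apply: bounded_measurableB; [exact: bFc|exact: bounded_measurable_cst]|exact: bounded_measurable_cst].
rewrite expectB; [|exact: bFc|exact: bounded_measurable_cst].
by rewrite (expectB _ (br y) ba) !expect_cst -/(c y) -/theta; ring.
Qed.

Let bF2 : bounded_measurable (fun z : T * T => F z.1 z.2 ^+ 2).
Proof. exact: bounded_measurableX. Qed.

Let a2 x : a x ^+ 2 <= J.
Proof. exact: le_trans (sqr_expect_le _ (bl x)) (F_sqr x). Qed.

Let c2 : \int[mu]_y (c y ^+ 2) <= J.
Proof.
apply: (@le_trans _ _ (\int[mu]_y \int[mu]_x (F x y ^+ 2))).
  apply: le_expect; [exact: bounded_measurableX bc| |move=> y; exact: sqr_expect_le (br y)].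
  apply: (@bounded_measurable_expect _ _ _ _ _ mu (fun z : T * T => F z.2 z.1 ^+ 2)).
  exact: bounded_measurableX bF'.
rewrite -(expect_fubini mu mu bF2); apply: le_expect_cst F_sqr.
exact: bounded_measurable_expect bF2.
Qed.

Let theta2 : theta ^+ 2 <= J.
Proof.
apply: le_trans (sqr_expect_le _ ba) _.
apply: le_expect_cst a2; exact: bounded_measurableX ba.
Qed.

Let g_sqr : \int[mu]_x \int[mu]_y (g x y ^+ 2) <= 16 * J.
Proof.
have bgx := @bounded_measurable_expect _ _ _ _ _ mu (fun z : T * T => g z.1 z.2 ^+ 2) (bounded_measurableX 2 bg).
apply: le_expect_cst bgx _ => x.
have b4 (G : T -> R) : bounded_measurable G -> bounded_measurable (fun x => 4 * G x).
  by move=> bG; apply: bounded_measurableM bG; exact: bounded_measurable_cst.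
have b1 := b4 _ (bounded_measurableX 2 (bl x)).
have b3 := b4 _ (bounded_measurableX 2 bc).
have b12 := bounded_measurableD b1 (bounded_measurable_cst T (4 * J)).
have b123 := bounded_measurableD b12 b3.
have bJ := bounded_measurable_cst T (4 * J).
apply: (@le_trans _ _ (\int[mu]_y (4 * F x y ^+ 2 + 4 * J + 4 * c y ^+ 2 + 4 * J))).
  apply: le_expect; [exact: (bounded_measurableX 2 (bounded_measurable_sectl bg x))|exact: bounded_measurableD b123 bJ|].
  move=> y; apply: le_trans (sqr_add4_le _ _ _ _) _.
  by rewrite !lerD// ler_wpM2l.
rewrite (expectD _ b123 bJ) (expectD _ b12 b3) (expectD _ b1 bJ) !expect_cst.
rewrite (expectZl _ _ (bounded_measurableX 2 (bl x))) (expectZl _ _ (bounded_measurableX 2 bc)).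
have := F_sqr x; move: (Rintegral _ _ _) => u uJ.
have := c2; move: (Rintegral _ _ _) => v vJ; lra.
Qed.

(** The projection of [F] on one variable, summed over the two positions of this variable in a pair. *)
Let e x := a x + c x - 2 * theta.

Let be : bounded_measurable e.
Proof.
apply: bounded_measurableB; last exact: bounded_measurable_cst.
exact: bounded_measurableD ba bc.
Qed.

Let e_mean : \int[mu]_x e x = 0.
Proof.
rewrite /e expectB; [|exact: bounded_measurableD ba bc|exact: bounded_measurable_cst].
by rewrite (expectD _ ba bc) expect_cst int_c -/theta; ring.
Qed.

Lemma sum_off_diag_cst (i : 'I_n) (u : R) : \sum_(j < n | j != i) u = n.-1%:R * u.
Proof.
rewrite (eq_bigl (fun j => j \in predC1 i))// sumr_const cardC1 card_ord.
by rewrite mulr_natl.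
Qed.

Lemma sum_off_diag_l (G : 'I_n -> R) : \sum_i \sum_(j | j != i) G i = n.-1%:R * \sum_i G i.
Proof. by rewrite big_distrr/=; apply: eq_bigr => i _; exact: sum_off_diag_cst. Qed.

Lemma sum_off_diag_r (G : 'I_n -> R) : \sum_i \sum_(j | j != i) G j = n.-1%:R * \sum_i G i.
Proof.
rewrite -sum_off_diag_l (exchange_big_dep predT)//=; apply: eq_bigr => j _.
by apply: eq_bigl => i; rewrite eq_sym.
Qed.

Lemma expect_sqr_pair_sum (E : R) :
  \int[mu]_x ((\int[mu]_y F x y + \int[mu]_y F y x - 2 * \int[mu]_x \int[mu]_y F x y) ^+ 2) <= E ->
  \int[nu]_t ((\sum_i \sum_(j | j != i) F (tnth t i) (tnth t j)) ^+ 2) <=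
  3 * (n%:R * n.-1%:R * \int[mu]_x \int[mu]_y F x y) ^+ 2 +
  3 * n.-1%:R ^+ 2 * (n%:R * E) + 3 * (4 * n%:R ^+ 2 * (16 * J)).
Proof.
rewrite -/theta => e_sqr.
pose U1 (t : n.-tuple T) := \sum_i e (tnth t i).
pose U2 (t : n.-tuple T) := \sum_i \sum_(j | j != i) g (tnth t i) (tnth t j).
have dec (t : n.-tuple T) : \sum_i \sum_(j | j != i) F (tnth t i) (tnth t j) =
    n%:R * n.-1%:R * theta + n.-1%:R * U1 t + U2 t.
  have -> : U2 t = \sum_i \sum_(j | j != i) F (tnth t i) (tnth t j)
      - n.-1%:R * \sum_i a (tnth t i) - n.-1%:R * \sum_i c (tnth t i) + n%:R * n.-1%:R * theta.
    rewrite -(sum_off_diag_l (fun i => a (tnth t i))) -(sum_off_diag_r (fun i => c (tnth t i))).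
    have -> : n%:R * n.-1%:R * theta = \sum_(i < n) \sum_(j < n | j != i) theta.
      rewrite (eq_bigr (fun=> n.-1%:R * theta)) => [|i _]; last exact: sum_off_diag_cst.
      by rewrite sumr_const card_ord -[RHS]mulr_natl mulrA.
    rewrite -!sumrB -big_split/=; apply: eq_bigr => i _.
    by rewrite -!sumrB -big_split/=.
  have -> : U1 t = \sum_i a (tnth t i) + \sum_i c (tnth t i) - n%:R * (2 * theta).
    by rewrite /U1 /e sumrB big_split/= sumr_const card_ord -[X in _ - X]mulr_natl.
  ring.
have bU1 : bounded_measurable U1.
  by apply: bounded_measurable_sum => i; exact: bounded_measurable_tnth.
have bU2 : bounded_measurable U2.
  apply: bounded_measurable_sum => i; apply: bounded_measurable_sum => j.
  exact: (bounded_measurable_tnth2 _ _ bg).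
have bS : bounded_measurable (fun t : n.-tuple T => \sum_i \sum_(j | j != i) F (tnth t i) (tnth t j)).
  apply: bounded_measurable_sum => i; apply: bounded_measurable_sum => j.
  exact: (bounded_measurable_tnth2 _ _ bF).
have h1 := le_trans (expect_sqr_sum1 nu_res be e_mean) (ler_wpM2l (ler0n _ _) e_sqr).
have n2 : 0 <= 4 * n%:R ^+ 2 :> R by rewrite mulr_ge0 ?sqr_ge0.
have h2 := le_trans (expect_sqr_sum2 nu_res bg gl gr) (ler_wpM2l n2 g_sqr).
pose th : R := 3 * (n%:R * n.-1%:R * theta) ^+ 2; pose x1 : R := 3 * n.-1%:R ^+ 2.
have x10 : 0 <= x1 by rewrite mulr_ge0 ?sqr_ge0.
have bth := bounded_measurable_cst (n.-tuple T) th.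
have bq1 := bounded_measurableM (bounded_measurable_cst (n.-tuple T) x1) (bounded_measurableX 2 bU1).
have bq2 := bounded_measurableM (bounded_measurable_cst (n.-tuple T) (3 : R)) (bounded_measurableX 2 bU2).
have bth1 := bounded_measurableD bth bq1.
apply: (@le_trans _ _ (\int[nu]_t (th + x1 * U1 t ^+ 2 + 3 * U2 t ^+ 2))).
  apply: le_expect; [exact: bounded_measurableX bS|exact: bounded_measurableD bth1 bq2|].
  move=> t; rewrite dec; apply: le_trans (sqr_add3_le _ _ _) _.
  by rewrite (exprMn 2 _ (U1 t)) (mulrA 3 (_ ^+ 2)) /th /x1.
rewrite (expectD _ bth1 bq2) (expectD _ bth bq1) expect_cst.
rewrite (expectZl _ _ (bounded_measurableX 2 bU1)) (expectZl _ _ (bounded_measurableX 2 bU2)).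
apply: lerD; first apply: lerD; first by [].
  exact: (ler_wpM2l x10 h1).
exact: (ler_wpM2l (ler0n _ 3) h2).
Qed.

End hoeffding_decomposition.

(** * Expansions of the reciprocal *)

Section reciprocal_expansions.
Context {R : realFieldType}.
Variables (phi B b f g : R).
Hypotheses (b_gt0 : 0 < b) (phi_le : `|phi| <= B) (f_ge : b <= f) (g_ge : b / 2 <= g).

Let f_gt0 : 0 < f. Proof. exact: lt_le_trans f_ge. Qed.
Let g_gt0 : 0 < g. Proof. by apply: lt_le_trans g_ge; rewrite divr_gt0. Qed.
Let f_le : f^-1 <= b^-1. Proof. by rewrite lef_pV2 ?posrE. Qed.
Let g_le : g^-1 <= 2 / b.
Proof. by rewrite -[2 / b]invrK lef_pV2 ?posrE ?invr_gt0 ?divr_gt0// invf_div. Qed.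
Let fV_ge0 : 0 <= f^-1. Proof. by rewrite invr_ge0 ltW. Qed.
Let gV_ge0 : 0 <= g^-1. Proof. by rewrite invr_ge0 ltW. Qed.
Let bV_ge0 : 0 <= b^-1. Proof. by rewrite invr_ge0 ltW. Qed.
Let B_ge0 : 0 <= B. Proof. exact: le_trans phi_le. Qed.

(** The exact remainder is [(g - f) ^+ 2 / (f ^+ 2 * g)]. *)
Lemma reciprocal_expansion1 :
  `|phi / g - (2 * (phi / f ^+ 1) - phi / f ^+ 2 * g)| <= 2 * B / b ^+ 3 * (g - f) ^+ 2.
Proof.
have -> : phi / g - (2 * (phi / f ^+ 1) - phi / f ^+ 2 * g) =
    phi * (f^-1 ^+ 2 * g^-1) * (g - f) ^+ 2.
  by field; rewrite !gt_eqF.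
rewrite normrM [`|(g - f) ^+ 2|]ger0_norm ?sqr_ge0// ler_wpM2r ?sqr_ge0// normrM.
rewrite (_ : 2 * B / b ^+ 3 = B * (b^-1 ^+ 2 * (2 / b))); last by field; rewrite gt_eqF.
apply: ler_pM => //; rewrite ger0_norm ?mulr_ge0 ?exprn_ge0//.
by apply: ler_pM; rewrite ?exprn_ge0// lerXn2r.
Qed.

(** Expansion to the third order, at [g = f + s + e] with fluctuation [s] and bias [e]. The
second order term contributes [s ^+ 2], from which the correction subtracts [v]; the three
error terms are the bias in the square, the cube of [g - f], and the replacement of
[g ^- 3] by [f ^- 3] in the correction. *)
Lemma reciprocal_expansion2 (s e q v beta : R) : g = f + s + e -> `|e| <= beta -> 0 <= v ->
  q = s ^+ 2 - v ->
  `|phi / g * (1 - v / g ^+ 2) - (2 * (phi / f ^+ 1) - phi / f ^+ 2 * g) - phi / f ^+ 3 * q|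
  <= (2 * B / b ^+ 3 + 14 * B / b ^+ 4) *
     (beta * `|s| + beta ^+ 2 + `|s| ^+ 3 + beta ^+ 3 + v * `|s| + v * beta).
Proof.
move=> gE e_le v0 ->; have beta0 : 0 <= beta by exact: le_trans e_le.
pose D := s + e; have DE : g = f + D by rewrite gE /D addrA.
have D_le : `|D| <= `|s| + beta by apply: le_trans (ler_normD _ _) _; rewrite lerD2l.
have D3 : `|D| ^+ 3 <= 4 * (`|s| ^+ 3 + beta ^+ 3).
  apply: (@le_trans _ _ ((`|s| + beta) ^+ 3)); first by rewrite lerXn2r// nnegrE addr_ge0.
  have := normr_ge0 s; move: `|s| => u u0; rewrite -subr_ge0.
  rewrite (_ : _ - _ = 3 * ((u + beta) * (u - beta) ^+ 2)); last by ring.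
  by rewrite mulr_ge0// mulr_ge0 ?sqr_ge0// addr_ge0.
have -> : phi / g * (1 - v / g ^+ 2) - (2 * (phi / f ^+ 1) - phi / f ^+ 2 * g) -
    phi / f ^+ 3 * (s ^+ 2 - v) =
    phi * ((2 * s * e + e ^+ 2) * f^-1 ^+ 3) - phi * (D ^+ 3 * (f^-1 ^+ 3 * g^-1)) +
    phi * (v * D * (f^-1 * g^-1 ^+ 3 + f^-1 ^+ 2 * g^-1 ^+ 2 + f^-1 ^+ 3 * g^-1)).
  by rewrite /D gE; field; rewrite -gE !gt_eqF.
have fp p : f^-1 ^+ p <= b^-1 ^+ p by rewrite lerXn2r.
have gp p : g^-1 ^+ p <= (2 / b) ^+ p by rewrite lerXn2r// nnegrE mulr_ge0.
have fp0 p : 0 <= f^-1 ^+ p by exact: exprn_ge0.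
have gp0 p : 0 <= g^-1 ^+ p by exact: exprn_ge0.
set t1 := phi * (_ * f^-1 ^+ 3); set t2 := phi * (D ^+ 3 * _); set t3 := phi * _.
have h1 : `|t1| <= B / b ^+ 3 * (2 * (beta * `|s|) + beta ^+ 2).
  rewrite /t1 (normrM phi) (normrM _ (f^-1 ^+ 3)) [`|f^-1 ^+ 3|]ger0_norm// (_ : B / b ^+ 3 * _ = B * ((2 * (beta * `|s|) + beta ^+ 2) * b^-1 ^+ 3)); last by field; rewrite gt_eqF.
  apply: ler_pM; rewrite ?mulr_ge0// ler_pM//.
  apply: le_trans (ler_normD _ _) _; rewrite lerD//.
    rewrite (normrM (2 * s)) (normrM 2) ger0_norm// -mulrA ler_wpM2l//.
    by rewrite mulrC ler_wpM2r.
  by rewrite normrX lerXn2r ?nnegrE.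
have h2 : `|t2| <= 2 * B / b ^+ 4 * (4 * (`|s| ^+ 3 + beta ^+ 3)).
  rewrite /t2 (normrM phi) (normrM (D ^+ 3)) (normrM (f^-1 ^+ 3)) [`|f^-1 ^+ 3|]ger0_norm// [`|g^-1|]ger0_norm//.
  rewrite (_ : 2 * B / b ^+ 4 * _ = B * (4 * (`|s| ^+ 3 + beta ^+ 3) * (b^-1 ^+ 3 * (2 / b)))); last by field; rewrite gt_eqF.
  apply: ler_pM; rewrite ?mulr_ge0// ler_pM ?mulr_ge0//; first by rewrite normrX.
  exact: ler_pM.
have h3 : `|t3| <= 14 * B / b ^+ 4 * (v * `|s| + v * beta).
  rewrite /t3 (normrM phi) (normrM (v * D)) (_ : _ * (v * _ + _) = B * (v * (`|s| + beta) * (14 * b^-1 ^+ 4))); last by field; rewrite gt_eqF.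
  have p0 : 0 <= f^-1 * g^-1 ^+ 3 + f^-1 ^+ 2 * g^-1 ^+ 2 + f^-1 ^+ 3 * g^-1 by rewrite !addr_ge0// mulr_ge0.
  apply: ler_pM; rewrite ?mulr_ge0// (ger0_norm p0) ler_pM//.
    by rewrite normrM ger0_norm// ler_wpM2l.
  rewrite (_ : 14 * b^-1 ^+ 4 = b^-1 * (2 / b) ^+ 3 + b^-1 ^+ 2 * (2 / b) ^+ 2 + b^-1 ^+ 3 * (2 / b)); last by field; rewrite gt_eqF.
  by rewrite !lerD// ler_pM.
have hs : `|t1 - t2 + t3| <= `|t1| + `|t2| + `|t3|.
  by apply: le_trans (ler_normD _ _) _; rewrite lerD2r ler_normB.
have c1 : 0 <= B / b ^+ 3 by rewrite divr_ge0// exprn_ge0// ltW.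
have c2 : 0 <= B / b ^+ 4 by rewrite divr_ge0// exprn_ge0// ltW.
have s0 := normr_ge0 s.
apply: le_trans hs _; apply: le_trans (lerD (lerD h1 h2) h3) _.
rewrite -(mulrA 2) -(mulrA 2 B) -(mulrA 14) -subr_ge0.
move: (B / b ^+ 3) c1 (B / b ^+ 4) c2 `|s| s0 => c c0 c' c'0 u u0.
rewrite (_ : _ - _ = c * (beta ^+ 2 + 2 * (u ^+ 3 + beta ^+ 3 + v * u + v * beta))
  + c' * (14 * (beta * u + beta ^+ 2) + 6 * (u ^+ 3 + beta ^+ 3))); last by ring.
by rewrite !(addr_ge0, mulr_ge0)// ?exprn_ge0.
Qed.

End reciprocal_expansions.

(** * Fluctuations of the density estimate *)

Section exponential_inequalities.
Variable R : realType.

Lemma expR_le_quadratic (x : R) : expR x <= 1 + x + x ^+ 2 * expR `|x|.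
Proof.
have h1 : expR x * (1 - x) <= 1.
  have := expR_ge1Dx (- x); rewrite expRN -(ler_pM2l (expR_gt0 x)) mulfV ?gt_eqF ?expR_gt0//.
have h2 := expR_ge1Dx x; have e0 := expR_gt0 x.
have [x0|x0] := leP 0 x.
  have h3 : expR x - 1 <= x * expR x by lra.
  have h4 : x * (expR x - 1) <= x * (x * expR x) by rewrite ler_wpM2l.
  rewrite ger0_norm// expr2 -[x * x * _]mulrA; lra.
have h3 : 1 <= expR `|x| by rewrite -[X in X <= _]expR0 ler_expR.
have h4 : x * (expR x - 1) <= x ^+ 2 by rewrite expr2; nra.
have h5 : x ^+ 2 <= x ^+ 2 * expR `|x| by rewrite ler_peMr ?sqr_ge0.
lra.
Qed.

Lemma expR_le_linear (x c : R) : 0 <= x <= c -> expR x <= 1 + x * expR c.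
Proof.
move=> /andP[x0 xc].
have h1 : expR x * (1 - x) <= 1.
  have := expR_ge1Dx (- x); rewrite expRN -(ler_pM2l (expR_gt0 x)) mulfV ?gt_eqF ?expR_gt0//.
have h2 : x * expR x <= x * expR c by rewrite ler_wpM2l// ler_expR.
lra.
Qed.

(** Turns exponential moments of both signs into moments of order [p]. *)
Lemma power_le_expR (u : R) (p : nat) : (0 < p)%N ->
  `|u| ^+ p <= p%:R ^+ p * (expR u + expR (- u)).
Proof.
move=> p0; have p0' : (0 : R) < p%:R by rewrite ltr0n.
have h (v : R) : 0 <= v -> v ^+ p <= p%:R ^+ p * expR v.
  move=> v0; have {1 2}-> : v = p%:R * (v / p%:R) by rewrite mulrC divfK// gt_eqF.
  rewrite exprMn expRM_natl ler_wpM2l ?exprn_ge0// lerXn2r ?nnegrE ?expR_ge0//.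
    by rewrite divr_ge0// ltW.
  by apply: le_trans (expR_ge1Dx _); rewrite lerDr.
apply: le_trans (h _ (normr_ge0 u)) _; rewrite ler_wpM2l ?exprn_ge0//.
by have [u0|u0] := leP 0 u; [rewrite ger0_norm// lerDl expR_ge0|rewrite ltr0_norm// lerDr expR_ge0].
Qed.

End exponential_inequalities.

(** A symmetric kernel [k] that is large, of order [1 / eps], but has integrals of order one;
for a density estimate [eps] is the volume [h ^+ d] of a window. *)
Section centered_kernel.
Context d (T : measurableType d) (R : realType) (n : nat).
Variables (mu : probability T R) (nu : probability (n.-tuple T) R).
Hypothesis nu_res : resampling mu nu.
Variables (k : T -> T -> R) (eps A : R).
Hypotheses (n_ge3 : (3 <= n)%N) (eps_gt0 : 0 < eps) (eps_le1 : eps <= 1) (A_ge0 : 0 <= A).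
Hypothesis bk : bounded_measurable (fun z : T * T => k z.1 z.2).
Hypothesis k_sup : forall x y, `|k x y| <= A / eps.
Hypothesis k_int : forall x, \int[mu]_y `|k x y| <= A.
Hypothesis k_sym : forall x y, k x y = k y x.

Definition kernel_mean x : R := \int[mu]_y k x y.
Definition centered x y : R := k x y - kernel_mean x.
Local Notation C := (2 * A).
Let m : R := n%:R - 1.

Lemma bounded_kernel_mean : bounded_measurable kernel_mean.
Proof. exact: bounded_measurable_expect bk. Qed.

Lemma kernel_mean_le x : `|kernel_mean x| <= A.
Proof. by apply: le_trans (norm_expect_le _ _) (k_int x); exact: bounded_measurable_sectl bk x. Qed.

Lemma bounded_centered : bounded_measurable (fun z : T * T => centered z.1 z.2).
Proof.
apply: bounded_measurableB bk _.
exact: bounded_measurable_comp bounded_kernel_mean measurable_fst.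
Qed.

Lemma bounded_centered_l x : bounded_measurable (centered x).
Proof. exact: bounded_measurable_sectl bounded_centered x. Qed.

Lemma bounded_centered_r y : bounded_measurable (fun x => centered x y).
Proof. exact: bounded_measurable_sectr bounded_centered y. Qed.

Lemma centered_sup x y : `|centered x y| <= C / eps.
Proof.
apply: le_trans (ler_normB _ _) _.
have : A <= A / eps by rewrite ler_peMr// invf_ge1.
have := k_sup x y; have := kernel_mean_le x; lra.
Qed.

Lemma centered_mean0 x : \int[mu]_y centered x y = 0.
Proof.
rewrite /centered expectB; [|exact: bounded_measurable_sectl bk x|exact: bounded_measurable_cst].
by rewrite expect_cst subrr.
Qed.

Lemma centered_intl x : \int[mu]_y `|centered x y| <= C.
Proof.
have b1 : bounded_measurable (fun y => `|k x y|) by apply/bounded_measurable_norm/(bounded_measurable_sectl bk x).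
apply: (@le_trans _ _ (\int[mu]_y (`|k x y| + A))).
  apply: le_expect => [||y].
  - exact/bounded_measurable_norm/bounded_centered_l.
  - by apply: bounded_measurableD => //; exact: bounded_measurable_cst.
  - by apply: le_trans (ler_normB _ _) _; rewrite lerD2l kernel_mean_le.
rewrite expectD// ?expect_cst; last exact: bounded_measurable_cst.
by have := k_int x; lra.
Qed.

Lemma centered_intr y : \int[mu]_x `|centered x y| <= C.
Proof.
have b1 : bounded_measurable (fun x => `|k x y|) by apply/bounded_measurable_norm/(bounded_measurable_sectr bk y).
apply: (@le_trans _ _ (\int[mu]_x (`|k x y| + A))).
  apply: le_expect => [||x].
  - exact/bounded_measurable_norm/bounded_centered_r.
  - by apply: bounded_measurableD => //; exact: bounded_measurable_cst.
  - by apply: le_trans (ler_normB _ _) _; rewrite lerD2l kernel_mean_le.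
rewrite expectD// ?expect_cst; last exact: bounded_measurable_cst.
have := k_int y; under eq_Rintegral do rewrite k_sym.
by lra.
Qed.

Lemma centered_sqr x : \int[mu]_y (centered x y ^+ 2) <= C ^+ 2 / eps.
Proof.
apply: (@le_trans _ _ (\int[mu]_y (C / eps * `|centered x y|))).
  apply: le_expect => [||y].
  - exact/bounded_measurableX/bounded_centered_l.
  - apply: bounded_measurableM; first exact: bounded_measurable_cst.
    exact/bounded_measurable_norm/bounded_centered_l.
  - by rewrite -(real_normK (num_real _)) expr2 ler_wpM2r// centered_sup.
rewrite expectZl; last exact/bounded_measurable_norm/bounded_centered_l.
rewrite [leRHS](_ : _ = C / eps * C); last by ring.
rewrite ler_wpM2l ?centered_intl//.
by rewrite divr_ge0 ?mulr_ge0// ltW.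
Qed.

Hypothesis m_eps : 1 <= m * eps.

Let m_gt0 : 0 < m.
Proof. by rewrite /m subr_gt0 ltr1n (leq_trans _ n_ge3). Qed.

Let mE : m = n.-1%:R.
Proof. by rewrite /m -subn1 natrB// (leq_trans _ n_ge3). Qed.

(** The inverse of the size of the fluctuations: [n * eps] is the number of sample points in
a window. *)
Let tau := Num.sqrt (m * eps).

Let tau_ge1 : 1 <= tau.
Proof. by rewrite -[leLHS]sqrtr1 ler_wsqrtr. Qed.

Let tau2 : tau ^+ 2 = m * eps.
Proof. by rewrite sqr_sqrtr// mulr_ge0// ltW. Qed.

Definition fluctuation (i : 'I_n) (t : n.-tuple T) : R :=
  m^-1 * \sum_(j < n | j != i) centered (tnth t i) (tnth t j).

Definition sum_sqr (i : 'I_n) (t : n.-tuple T) : R :=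
  \sum_(j < n | j != i) centered (tnth t i) (tnth t j) ^+ 2.

Lemma bounded_fluctuation i : bounded_measurable (fluctuation i).
Proof.
apply: bounded_measurableM; first exact: bounded_measurable_cst.
by apply: bounded_measurable_sum => j; exact: (bounded_measurable_tnth2 _ _ bounded_centered).
Qed.

Lemma bounded_sum_sqr i : bounded_measurable (sum_sqr i).
Proof.
apply: bounded_measurable_sum => j; apply: bounded_measurableX.
exact: (bounded_measurable_tnth2 _ _ bounded_centered).
Qed.

(** Independence makes the exponential moment of a sum a product of [n - 1]
factors, each of them [1 + O(1/(n-1))]. *)
Lemma expect_expR_sum_le (g : T -> T -> R) (c : R) (i : 'I_n) : 0 <= c ->
  bounded_measurable (fun z : T * T => g z.1 z.2) ->
  (forall x, \int[mu]_y expR (g x y) <= 1 + c / m) ->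
  \int[nu]_t expR (\sum_(j < n | j != i) g (tnth t i) (tnth t j)) <= expR c.
Proof.
move=> c0 bg Hg.
under eq_Rintegral do rewrite expR_sum -big_filter.
have cm0 : 0 <= 1 + c / m by rewrite addr_ge0// divr_ge0// ltW.
apply: le_trans (expect_prod_coord_le nu_res cm0 _ _ Hg _ _) _.
- exact: bounded_measurable_expR bg.
- by move=> x y; exact: expR_ge0.
- exact: filter_uniq (index_enum_uniq _).
- by rewrite mem_filter eqxx.
have -> : size [seq j <- index_enum _ | j != i] = n.-1.
  rewrite -sum1_size big_filter (eq_bigl (fun j => j \in predC1 i))//.
  by rewrite sum1_card cardC1 card_ord.
apply: (@le_trans _ _ (expR (c / m) ^+ n.-1)).
  by rewrite lerXn2r ?nnegrE ?expR_ge0// expR_ge1Dx.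
by rewrite -expRM_natl -mE mulrC divfK// gt_eqF.
Qed.

Definition fluctuation_const : R := expR (expR C * C ^+ 2).
Definition sum_sqr_const : R := expR (expR (C ^+ 2) * C ^+ 2).

(** At the scale [tau] a single summand is at most [C], and its square has mean [C ^+ 2 / m],
so the quadratic bound on the exponential costs a factor [expR C]. *)
Let exp_fluctuation (sg : R) i : `|sg| = 1 ->
  \int[nu]_t expR (sg * (tau * fluctuation i t)) <= fluctuation_const.
Proof.
move=> sg1; pose th := sg * (tau / m).
have C0 : 0 <= C by rewrite mulr_ge0.
have th2 : th ^+ 2 = eps / m.
  rewrite /th exprMn -(real_normK (num_real sg)) sg1 expr1n mul1r expr_div_n tau2.
  by field; rewrite gt_eqF.
have bth : bounded_measurable (fun z : T * T => th * centered z.1 z.2).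
  by apply: bounded_measurableM; [exact: bounded_measurable_cst|exact: bounded_centered].
have sgs : sg ^+ 2 = 1 by rewrite -(real_normK (num_real sg)) sg1 expr1n.
under eq_Rintegral => t _.
  rewrite (_ : sg * _ = \sum_(j < n | j != i) th * centered (tnth t i) (tnth t j)).
  over.
  by rewrite -big_distrr/= /th /fluctuation; ring.
apply: (@expect_expR_sum_le (fun x y => th * centered x y) (expR C * C ^+ 2) i) => //; first by rewrite mulr_ge0 ?sqr_ge0 ?expR_ge0.
move=> x.
have b1 := bounded_centered_l x.
have bz2 := bounded_measurableX 2 b1.
have thZ y : `|th * centered x y| <= C.
  rewrite normrM /th normrM sg1 mul1r ger0_norm ?divr_ge0 ?sqrtr_ge0 ?(ltW m_gt0)//.
  apply: (@le_trans _ _ (tau / m * (C / eps))).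
    by rewrite ler_wpM2l ?centered_sup// divr_ge0 ?sqrtr_ge0 ?(ltW m_gt0).
  have -> : tau / m * (C / eps) = C / tau.
    have t0 : tau != 0 by rewrite gt_eqF// (lt_le_trans ltr01).
    rewrite (_ : tau / m * _ = C * tau / (m * eps)); last first.
      by field; rewrite !gt_eqF.
    by rewrite -tau2; field.
  by rewrite ler_pdivrMr ?ler_peMr// (lt_le_trans ltr01).
apply: (@le_trans _ _ (\int[mu]_y (1 + th * centered x y + th ^+ 2 * expR C * centered x y ^+ 2))).
  have b2 : bounded_measurable (fun y => th * centered x y).
    by apply: bounded_measurableM => //; exact: bounded_measurable_cst.
  apply: le_expect.
  - exact: bounded_measurable_expR.
  - apply: bounded_measurableD; first by apply: bounded_measurableD => //; exact: bounded_measurable_cst.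
    by apply: bounded_measurableM => //; exact: bounded_measurable_cst.
  - move=> y; apply: le_trans (expR_le_quadratic _) _; rewrite lerD2l.
    rewrite exprMn [leRHS]mulrAC; apply: (ler_wpM2l (mulr_ge0 (sqr_ge0 _) (sqr_ge0 _))).
    by rewrite ler_expR.
rewrite expectD; [|by apply: bounded_measurableD; [exact: bounded_measurable_cst|apply: bounded_measurableM => //; exact: bounded_measurable_cst]
   |by apply: bounded_measurableM => //; exact: bounded_measurable_cst].
rewrite expectD; [|exact: bounded_measurable_cst|by apply: bounded_measurableM => //; exact: bounded_measurable_cst].
rewrite expect_cst !expectZl// centered_mean0 mulr0 addr0 lerD2l th2.
apply: (@le_trans _ _ (eps / m * expR C * (C ^+ 2 / eps))).
  by rewrite ler_wpM2l ?centered_sqr// mulr_ge0 ?expR_ge0// divr_ge0 ?(ltW m_gt0) ?(ltW eps_gt0).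
by rewrite le_eqVlt; apply/orP; left; apply/eqP; field; rewrite !gt_eqF.
Qed.

Lemma fluctuation_moment (p : nat) i : (0 < p)%N ->
  \int[nu]_t (`|fluctuation i t| ^+ p) <= 2 * p%:R ^+ p * fluctuation_const / tau ^+ p.
Proof.
move=> p0; have t0 : 0 < tau by exact: lt_le_trans tau_ge1.
have bS := bounded_fluctuation i.
have bt : bounded_measurable (fun t => tau * fluctuation i t).
  by apply: bounded_measurableM => //; exact: bounded_measurable_cst.
rewrite ler_pdivlMr ?exprn_gt0// -expectZr; last exact/bounded_measurableX/bounded_measurable_norm.
have be sg : bounded_measurable (fun t => expR (sg * (tau * fluctuation i t))).
  by apply: bounded_measurable_expR; apply: bounded_measurableM => //; exact: bounded_measurable_cst.
apply: (@le_trans _ _ (\int[nu]_t (p%:R ^+ p * (expR (1 * (tau * fluctuation i t)) + expR (- 1 * (tau * fluctuation i t)))))).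
  apply: le_expect.
  - apply: bounded_measurableM; last exact: bounded_measurable_cst.
    exact/bounded_measurableX/bounded_measurable_norm.
  - by apply: bounded_measurableM; [exact: bounded_measurable_cst|exact: bounded_measurableD].
  - move=> t; rewrite mul1r mulN1r; apply: le_trans (power_le_expR _ p0).
    by rewrite (normrM tau) (gtr0_norm t0) exprMn mulrC.
rewrite expectZl ?expectD//; last exact: bounded_measurableD.
rewrite [2 * _]mulrC -!mulrA ler_wpM2l ?exprn_ge0//.
have e1 : \int[nu]_t expR (1 * (tau * fluctuation i t)) <= fluctuation_const.
  by apply: exp_fluctuation; rewrite normr1.
have e2 : \int[nu]_t expR (- 1 * (tau * fluctuation i t)) <= fluctuation_const.
  by apply: exp_fluctuation; rewrite normrN1.
lra.
Qed.

Lemma sum_sqr_moment i :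
  \int[nu]_t ((eps / m * sum_sqr i t) ^+ 2) <= 8 * sum_sqr_const.
Proof.
have em0 : 0 <= eps / m by rewrite divr_ge0 ?(ltW m_gt0) ?(ltW eps_gt0).
have C0 : 0 <= C by rewrite mulr_ge0.
have bW := bounded_sum_sqr i.
have beW : bounded_measurable (fun t => eps / m * sum_sqr i t).
  by apply: bounded_measurableM => //; exact: bounded_measurable_cst.
have W0 t : 0 <= eps / m * sum_sqr i t.
  by rewrite mulr_ge0// sumr_ge0// => j _; exact: sqr_ge0.
apply: (@le_trans _ _ (\int[nu]_t (8 * expR (eps / m * sum_sqr i t)))).
  apply: le_expect.
  - exact: bounded_measurableX.
  - by apply: bounded_measurableM; [exact: bounded_measurable_cst|exact: bounded_measurable_expR].
  - move=> t; have := power_le_expR (eps / m * sum_sqr i t) (isT : 0 < 2)%N.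
    rewrite ger0_norm// => /le_trans; apply.
    have : expR (- (eps / m * sum_sqr i t)) <= expR (eps / m * sum_sqr i t).
      by rewrite ler_expR; have := W0 t; lra.
    by rewrite expr2; lra.
rewrite expectZl; last exact: bounded_measurable_expR.
rewrite ler_wpM2l//.
under eq_Rintegral do rewrite /sum_sqr big_distrr/=.
apply: (@expect_expR_sum_le (fun x y => eps / m * centered x y ^+ 2)).
- by rewrite mulr_ge0 ?sqr_ge0 ?expR_ge0.
- apply: bounded_measurableM; first exact: bounded_measurable_cst.
  exact: bounded_measurableX bounded_centered.
move=> x; have bz2 := bounded_measurableX 2 (bounded_centered_l x).
apply: (@le_trans _ _ (\int[mu]_y (1 + (eps / m * expR (C ^+ 2)) * centered x y ^+ 2))).
  apply: le_expect.
  - by apply: bounded_measurable_expR; apply: bounded_measurableM => //; exact: bounded_measurable_cst.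
  - apply: bounded_measurableD; first exact: bounded_measurable_cst.
    by apply: bounded_measurableM => //; exact: bounded_measurable_cst.
  - move=> y; rewrite [eps / m * expR _ * _]mulrAC; apply: expR_le_linear.
    rewrite mulr_ge0 ?sqr_ge0//=.
    apply: (@le_trans _ _ (eps / m * (C / eps) ^+ 2)).
      rewrite ler_wpM2l// -(real_normK (num_real (centered x y))) lerXn2r ?nnegrE ?centered_sup//.
      by rewrite divr_ge0 ?(ltW eps_gt0).
    have -> : eps / m * (C / eps) ^+ 2 = C ^+ 2 / (m * eps) by field; rewrite !gt_eqF.
    rewrite ler_pdivrMr ?(lt_le_trans ltr01)// ler_peMr ?sqr_ge0//.
rewrite expectD ?expect_cst ?expectZl//; [|exact: bounded_measurable_cst|]; last first.
  by apply: bounded_measurableM => //; exact: bounded_measurable_cst.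
rewrite lerD2l; apply: (@le_trans _ _ (eps / m * expR (C ^+ 2) * (C ^+ 2 / eps))).
  by rewrite ler_wpM2l ?centered_sqr// mulr_ge0 ?expR_ge0.
by rewrite le_eqVlt; apply/orP; left; apply/eqP; field; rewrite !gt_eqF.
Qed.



End centered_kernel.

(** * The linear term *)

Section weights.
Context d (T : measurableType d) (R : realType).
Variables (phi f : T -> R) (B b : R).
Hypotheses (b_gt0 : 0 < b) (bphi : bounded_measurable phi) (phi_le : forall x, `|phi x| <= B).
Hypotheses (bf : bounded_measurable f) (f_ge : forall x, phi x != 0 -> b <= f x).

Definition weight (p : nat) x : R := phi x / f x ^+ p.

Lemma weight_le p x : `|weight p x| <= B / b ^+ p.
Proof.
have B0 : 0 <= B by exact: le_trans (phi_le x).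
have [p0|p0] := eqVneq (phi x) 0.
  by rewrite /weight p0 mul0r normr0 divr_ge0// exprn_ge0// ltW.
have fx := f_ge p0; have f0 := lt_le_trans b_gt0 fx.
rewrite normrM ler_pM// ger0_norm ?invr_ge0 ?exprn_ge0 ?(ltW f0)//.
by rewrite lef_pV2 ?posrE ?exprn_gt0// lerXn2r ?nnegrE ?(ltW b_gt0) ?(ltW f0).
Qed.

Lemma bounded_weight p : bounded_measurable (weight p).
Proof.
split; last by exists (B / b ^+ p); exact: weight_le.
apply: measurable_funM; first by case: bphi.
by apply: measurable_funV; apply: measurable_funX; case: bf.
Qed.

End weights.

Section linear_term.
Context d (T : measurableType d) (R : realType) (n : nat).
Variables (mu : probability T R) (nu : probability (n.-tuple T) R).
Hypothesis nu_res : resampling mu nu.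
Variables (k : T -> T -> R) (eps A : R).
Hypotheses (n_ge3 : (3 <= n)%N) (eps_gt0 : 0 < eps) (eps_le1 : eps <= 1) (A_ge0 : 0 <= A).
Hypothesis bk : bounded_measurable (fun z : T * T => k z.1 z.2).
Hypothesis k_sup : forall x y, `|k x y| <= A / eps.
Hypothesis k_int : forall x, \int[mu]_y `|k x y| <= A.
Variables (phi f : T -> R) (B b beta delta2 : R).
Hypotheses (b_gt0 : 0 < b) (bphi : bounded_measurable phi) (phi_le : forall x, `|phi x| <= B).
Hypotheses (bf : bounded_measurable f) (f_ge : forall x, phi x != 0 -> b <= f x).
Hypothesis bias_le : forall x, `|kernel_mean mu k x - f x| <= beta.
Local Notation weight := (weight phi f).
Local Notation kernel_mean := (kernel_mean mu k).
Let m : R := n%:R - 1.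
Let m_gt0 : 0 < m.
Proof. by rewrite /m subr_gt0 ltr1n (leq_trans _ n_ge3). Qed.

Let bw p : bounded_measurable (weight p). Proof. exact: (bounded_weight b_gt0 bphi phi_le bf f_ge). Qed.

Let wle p x : `|weight p x| <= B / b ^+ p. Proof. exact: (weight_le b_gt0 phi_le f_ge). Qed.

(** For a kernel with density [f], this is the smoothing of [phi / f]. *)
Definition smoothed_weight y : R := \int[mu]_x (weight 2 x * k x y).
Definition target : R := \int[mu]_x weight 1 x.
Hypothesis delta2_le : \int[mu]_y ((weight 1 y - smoothed_weight y) ^+ 2) <= delta2.

(** [linear_term] is the average of [2 phi/f - phi g/f^2] minus the target, where the density
estimate [g] is itself an average of [k]. *)
Definition linear_kernel x y : R := 2 * weight 1 x - weight 2 x * k x y - target.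

Definition linear_term (t : n.-tuple T) : R :=
  (n%:R * m)^-1 * \sum_i \sum_(j | j != i) linear_kernel (tnth t i) (tnth t j).

Let bwk : bounded_measurable (fun z : T * T => weight 2 z.1 * k z.1 z.2).
Proof.
apply: bounded_measurableM bk; exact: bounded_measurable_comp (bw 2) measurable_fst.
Qed.

Let bsw : bounded_measurable smoothed_weight.
Proof.
have bsw' : bounded_measurable (fun z : T * T => weight 2 z.2 * k z.2 z.1).
  apply: bounded_measurableM; first exact: bounded_measurable_comp (bw 2) measurable_snd.
  apply: (bounded_measurable_comp (F := fun z : T * T => k z.1 z.2) bk (g := fun z : T * T => (z.2, z.1))).
  by apply/measurable_fun_pairP; split; [exact: measurable_snd|exact: measurable_fst].
exact: bounded_measurable_expect bsw'.
Qed.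

Let blk : bounded_measurable (fun z : T * T => linear_kernel z.1 z.2).
Proof.
apply: bounded_measurableB; last exact: bounded_measurable_cst.
apply: bounded_measurableB bwk; apply: bounded_measurableM; first exact: bounded_measurable_cst.
exact: bounded_measurable_comp (bw 1) measurable_fst.
Qed.

Lemma bounded_linear_term : bounded_measurable linear_term.
Proof.
apply: bounded_measurableM; first exact: bounded_measurable_cst.
apply: bounded_measurable_sum => i; apply: bounded_measurable_sum => j.
exact: (bounded_measurable_tnth2 _ _ blk).
Qed.

Let a x := 2 * weight 1 x - weight 2 x * kernel_mean x - target.
Let c' y := target - smoothed_weight y.
Let theta := \int[mu]_x a x.

Let intl x : \int[mu]_y linear_kernel x y = a x.
Proof.
have bkx := bounded_measurable_sectl bk x; have bwkx := bounded_measurable_sectl bwk x.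
rewrite /linear_kernel expectB; [|apply: bounded_measurableB => //; exact: bounded_measurable_cst|exact: bounded_measurable_cst].
rewrite expectB//; last exact: bounded_measurable_cst.
by rewrite !expect_cst expectZl.
Qed.

Let intr y : \int[mu]_x linear_kernel x y = c' y.
Proof.
have bwky := bounded_measurable_sectr bwk y; have b1 := bw 1.
have b2 : bounded_measurable (fun x => 2 * weight 1 x).
  by apply: bounded_measurableM => //; exact: bounded_measurable_cst.
rewrite /linear_kernel expectB; [|exact: bounded_measurableB|exact: bounded_measurable_cst].
rewrite expectB// expect_cst expectZl// /c' /smoothed_weight /target /=; ring.
Qed.

Let ba : bounded_measurable a.
Proof.
apply: bounded_measurableB; last exact: bounded_measurable_cst.
apply: bounded_measurableB.
  by apply: bounded_measurableM; [exact: bounded_measurable_cst|exact: bw].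
by apply: bounded_measurableM; [exact: bw|exact: bounded_kernel_mean bk].
Qed.

Let bc' : bounded_measurable c'.
Proof. by apply: bounded_measurableB => //; exact: bounded_measurable_cst. Qed.

Let thetaE : \int[mu]_y c' y = theta.
Proof.
rewrite /theta; under eq_Rintegral do rewrite -intr.
rewrite -(expect_fubini mu mu blk).
by apply: eq_Rintegral => x _; exact: intl.
Qed.

Local Notation q1 := (B / b).
Local Notation q2 := (B / b ^+ 2).

Let B_ge0 (x : T) : 0 <= B. Proof. exact: le_trans (phi_le x). Qed.

Let a_close x : `|a x - (weight 1 x - target)| <= q2 * beta.
Proof.
have -> : a x - (weight 1 x - target) = weight 2 x * (f x - kernel_mean x).
  rewrite /a /weight expr1; have [->|p0] := eqVneq (phi x) 0; first by rewrite !mul0r; ring.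
  by have f0 := lt_le_trans b_gt0 (f_ge p0); field; rewrite gt_eqF.
rewrite normrM ler_pM ?wle//; rewrite distrC; exact: bias_le.
Qed.

Let theta_le : `|theta| <= q2 * beta.
Proof.
have b1 : bounded_measurable (fun x => weight 1 x - target).
  by apply: bounded_measurableB; [exact: bw|exact: bounded_measurable_cst].
have -> : theta = \int[mu]_x (a x - (weight 1 x - target)).
  rewrite expectB// expectB; [|exact: bw|exact: bounded_measurable_cst].
  by rewrite expect_cst subrr subr0.
have bd := bounded_measurableB ba b1.
apply: le_trans (norm_expect_le _ bd) _; apply: le_expect_cst; first exact: bounded_measurable_norm.
exact: a_close.
Qed.

Definition linear_const : R := 15 * q1 ^+ 2 + 3 * q2 ^+ 2 * A ^+ 2.

Let target_le : `|target| <= q1.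
Proof.
apply: le_trans (norm_expect_le _ (bw 1)) _.
apply: le_expect_cst; first exact: bounded_measurable_norm (bw 1).
by move=> x; have := wle 1 x; rewrite expr1.
Qed.

Let k_sqr x : \int[mu]_y (k x y ^+ 2) <= A ^+ 2 / eps.
Proof.
have bkx := bounded_measurable_sectl bk x; rewrite /= in bkx.
apply: (@le_trans _ _ (\int[mu]_y (A / eps * `|k x y|))).
  apply: le_expect => [||y].
  - exact: bounded_measurableX.
  - apply: bounded_measurableM; first exact: bounded_measurable_cst.
    exact: bounded_measurable_norm.
  - by rewrite -(real_normK (num_real _)) expr2 ler_wpM2r.
rewrite expectZl; last exact: bounded_measurable_norm.
rewrite [leRHS](_ : _ = A / eps * A); last by ring.
exact: (ler_wpM2l (divr_ge0 A_ge0 (ltW eps_gt0)) (k_int x)).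
Qed.

Let lk_sqr x : \int[mu]_y (linear_kernel x y ^+ 2) <= linear_const / eps.
Proof.
have b1 := bounded_measurable_sectl blk x; rewrite /= in b1.
have bkx := bounded_measurable_sectl bk x; rewrite /= in bkx.
have bk2 := bounded_measurableX 2 bkx.
have b3 := bounded_measurableM (bounded_measurable_cst T (3 * q2 ^+ 2)) bk2.
apply: (@le_trans _ _ (\int[mu]_y (15 * q1 ^+ 2 + 3 * q2 ^+ 2 * k x y ^+ 2))).
  apply: le_expect => [||y]; first exact: bounded_measurableX.
    apply: bounded_measurableD; first exact: bounded_measurable_cst.
    exact: b3.
  rewrite /linear_kernel.
  have h1 := sqr_le_of_norm (wle 1 x); have h2 := sqr_le_of_norm (wle 2 x).
  have h3 := sqr_le_of_norm target_le; rewrite expr1 in h1.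
  have h4 : (weight 2 x * k x y) ^+ 2 <= q2 ^+ 2 * k x y ^+ 2 by rewrite exprMn ler_wpM2r ?sqr_ge0.
  apply: le_trans (sqr_linear_comb_le h1 h4 h3) _.
  by rewrite le_eqVlt; apply/orP; left; apply/eqP; ring.
rewrite (expectD _ (bounded_measurable_cst T _) b3) expect_cst (expectZl _ _ bk2).
rewrite /linear_const [leRHS]mulrDl; apply: lerD.
  by rewrite (ler_pdivlMr _ _ eps_gt0); exact: (ler_piMr (mulr_ge0 (ler0n _ 15) (sqr_ge0 _)) eps_le1).
rewrite -(mulrA (3 * q2 ^+ 2)); exact: (ler_wpM2l (mulr_ge0 (ler0n _ 3) (sqr_ge0 _)) (k_sqr x)).
Qed.

Let bce : bounded_measurable (fun x => a x + c' x - 2 * theta).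
Proof. by apply: bounded_measurableB; [exact: bounded_measurableD|exact: bounded_measurable_cst]. Qed.

Let ce_sqr : \int[mu]_x ((a x + c' x - 2 * theta) ^+ 2) <= 3 * (delta2 + 5 * (q2 * beta) ^+ 2).
Proof.
set D := q2 * beta.
have bws := bounded_measurableX 2 (bounded_measurableB (bw 1) bsw).
have b3 := bounded_measurableM (bounded_measurable_cst T (3 : R)) bws.
apply: (@le_trans _ _ (\int[mu]_x (3 * (weight 1 x - smoothed_weight x) ^+ 2 + 15 * D ^+ 2))).
  apply: le_expect; first exact/bounded_measurableX/bce.
    apply: bounded_measurableD; last exact: bounded_measurable_cst.
    exact: b3.
  move=> x; have h1 := sqr_le_of_norm (a_close x); have h2 := sqr_le_of_norm theta_le.
  rewrite -/D in h1 h2; set u := a x - _ in h1.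
  have -> : a x + c' x - 2 * theta = (weight 1 x - smoothed_weight x) + u - 2 * theta by rewrite /c' /u; ring.
  apply: le_trans (sqr_add3_le _ _ _) _.
  rewrite -addrA lerD// [leRHS](_ : _ = 3 * D ^+ 2 + 3 * (4 * D ^+ 2)); last by ring.
  apply: lerD; first exact: (ler_wpM2l (ler0n _ 3) h1).
  rewrite sqrrN exprMn -natrX; exact: (ler_wpM2l (ler0n _ 3) (ler_wpM2l (ler0n _ 4) h2)).
rewrite (expectD _ b3 (bounded_measurable_cst T _)) (expectZl _ _ bws) expect_cst [leRHS]mulrDr.
apply: lerD; first exact: (ler_wpM2l (ler0n _ 3) delta2_le).
by rewrite le_eqVlt; apply/orP; left; apply/eqP; ring.
Qed.

(** The projection of the linear kernel on one variable is [weight 1 - smoothed_weight] up to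
the bias: it is small because smoothing nearly reproduces the quotient [phi / f]. The
degenerate part only has the order of the second moment of the kernel divided by
[n ^+ 2]. *)
Lemma expect_sqr_linear_term : \int[nu]_t (linear_term t ^+ 2) <=
  3 * ((q2 * beta) ^+ 2 + 3 * (delta2 + 5 * (q2 * beta) ^+ 2) / n%:R + 64 * linear_const / (m ^+ 2 * eps)).
Proof.
have n0 : (0 : R) < n%:R by rewrite ltr0n (leq_trans _ n_ge3).
set E := 3 * (delta2 + 5 * (q2 * beta) ^+ 2); set J := linear_const / eps.
have mE : n.-1%:R = m by rewrite /m -subn1 natrB// (leq_trans _ n_ge3).
have lE : \int[mu]_x \int[mu]_y linear_kernel x y = theta.
  by apply: eq_Rintegral => x _; exact: intl.
have := @expect_sqr_pair_sum _ _ _ _ _ _ nu_res _ _ blk lk_sqr E.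
rewrite -/J lE mE => /(_ _)/wrap[].
  apply: le_trans ce_sqr; rewrite le_eqVlt; apply/orP; left; apply/eqP.
  by apply: eq_Rintegral => x _; rewrite intl intr.
set V := \int[nu]_t _ => VE.
have nm0 : 0 < n%:R * m by rewrite mulr_gt0.
have bV : bounded_measurable (fun t : n.-tuple T => \sum_i \sum_(j | j != i) linear_kernel (tnth t i) (tnth t j)).
  apply: bounded_measurable_sum => i; apply: bounded_measurable_sum => j.
  exact: (bounded_measurable_tnth2 _ _ blk).
have -> : \int[nu]_t (linear_term t ^+ 2) = (n%:R * m)^-1 ^+ 2 * V.
  rewrite -(expectZl _ _ (bounded_measurableX 2 bV)).
  by apply: eq_Rintegral => t _; rewrite exprMn.
apply: le_trans (ler_wpM2l (sqr_ge0 _) VE) _.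
apply: (@le_trans _ _ (3 * theta ^+ 2 + 3 * (E / n%:R) + 192 * (J / m ^+ 2))).
  rewrite le_eqVlt; apply/orP; left; apply/eqP; field; rewrite !gt_eqF//.
rewrite !(mulrDr 3); apply: lerD; first apply: lerD.
- by apply: ler_wpM2l => //; exact: sqr_le_of_norm theta_le.
- by rewrite /E (mulrDr 3).
rewrite /J le_eqVlt; apply/orP; left; apply/eqP; field; rewrite !gt_eqF//.
Qed.

End linear_term.

(** * Sums over triples and the quadratic term *)

Section triple_sums.
Context d (T : measurableType d) (R : realType) (n : nat).
Variables (mu : probability T R) (nu : probability (n.-tuple T) R).
Hypothesis nu_res : resampling mu nu.

Lemma sum_off_diag2_cst (i j : 'I_n) (u : R) : j != i ->
  \sum_(l < n | (l != i) && (l != j)) u = n.-2%:R * u.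
Proof.
move=> ji; rewrite (eq_bigl (fun l => l \in ~: [set i; j]%SET)) => [|l].
  by rewrite sumr_const cardsCs finset.setCK cards2 eq_sym ji card_ord subn2 mulr_natl.
by rewrite !inE negb_or.
Qed.

Lemma sum_triples_drop (G : 'I_n -> 'I_n -> R) :
  \sum_i \sum_(j | j != i) \sum_(l | (l != i) && (l != j)) G j l =
  n.-2%:R * \sum_j \sum_(l | l != j) G j l.
Proof.
rewrite (exchange_big_dep predT)//= big_distrr/=; apply: eq_bigr => j _.
rewrite (exchange_big_dep (fun l => l != j))/= => [|i l _ /andP[]//].
rewrite big_distrr/=; apply: eq_bigr => l lj.
rewrite -(sum_off_diag2_cst _ lj); apply: eq_bigl => i.
by rewrite lj andbT [j == i]eq_sym [l == i]eq_sym.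
Qed.

Variables (g : T -> T -> T -> R) (V q : R).
Hypothesis bg : bounded_measurable (fun z : T * T * T => g z.1.1 z.1.2 z.2).
Hypotheses (gz : forall x y, \int[mu]_z g x y z = 0) (gy : forall x z, \int[mu]_y g x y z = 0).
Let G y z := \int[mu]_x g x y z.
Hypothesis g_sqr : forall x, \int[mu]_y \int[mu]_z (g x y z ^+ 2) <= V.
Hypothesis G_sqr : forall y, \int[mu]_z (G y z ^+ 2) <= q.

Let bgx : bounded_measurable (fun p : T * T * T => g p.2 p.1.1 p.1.2).
Proof.
apply: (bounded_measurable_comp bg (g := fun p : T * T * T => ((p.2, p.1.1), p.1.2))).
apply/measurable_fun_pairP; split; last exact: measurableT_comp measurable_snd measurable_fst.
apply/measurable_fun_pairP; split; first exact: measurable_snd.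
exact: measurableT_comp measurable_fst measurable_fst.
Qed.

Let bG : bounded_measurable (fun p : T * T => G p.1 p.2).
Proof. exact: bounded_measurable_expect bgx. Qed.

Let bgxy x y : bounded_measurable (g x y).
Proof. exact: (bounded_measurable_sectl bg (x, y)). Qed.

Let bgxz x z : bounded_measurable (fun y => g x y z).
Proof. exact: (bounded_measurable_comp (bounded_measurable_sectr bg z) (pair1_measurable x)). Qed.

Let bgyz y z : bounded_measurable (fun x => g x y z).
Proof. exact: (bounded_measurable_comp (bounded_measurable_sectr bg z) (pair2_measurable y)). Qed.

Let bg_yz x : bounded_measurable (fun p : T * T => g x p.1 p.2).
Proof.
apply: (bounded_measurable_comp bg (g := fun p : T * T => ((x, p.1), p.2))).
apply/measurable_fun_pairP; split; last exact: measurable_snd.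
by apply/measurable_fun_pairP; split; [exact: measurable_cst|exact: measurable_fst].
Qed.

Let G_intz y : \int[mu]_z G y z = 0.
Proof.
have bxz : bounded_measurable (fun p : T * T => g p.1 y p.2).
  apply: (bounded_measurable_comp bg (g := fun p : T * T => ((p.1, y), p.2))).
  apply/measurable_fun_pairP; split; last exact: measurable_snd.
  by apply/measurable_fun_pairP; split; [exact: measurable_fst|exact: measurable_cst].
rewrite -(expect_fubini mu mu bxz).
by under eq_Rintegral do rewrite gz; rewrite expect_cst.
Qed.

Let G_inty z : \int[mu]_y G y z = 0.
Proof.
rewrite -(expect_fubini mu mu (bounded_measurable_sectr bg z)) /=.
by under eq_Rintegral do rewrite gy; rewrite expect_cst.
Qed.

Let e x y z := g x y z - G y z.

Let be : bounded_measurable (fun z : T * T * T => e z.1.1 z.1.2 z.2).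
Proof.
apply: bounded_measurableB; first exact: bg.
apply: (bounded_measurable_comp bG (g := fun p : T * T * T => (p.1.2, p.2))).
apply/measurable_fun_pairP; split; last exact: measurable_snd.
exact: measurableT_comp measurable_snd measurable_fst.
Qed.

Let e_sqr : \int[mu]_x \int[mu]_y \int[mu]_z (e x y z ^+ 2) <= 2 * (V + q).
Proof.
have be2 := bounded_measurableX 2 be.
have b3 := @bounded_measurable_expect _ _ _ _ _ mu (fun z : (T * T) * T => e z.1.1 z.1.2 z.2 ^+ 2) be2.
apply: le_expect_cst; first exact: (bounded_measurable_expect mu b3).
move=> x.
have bg2 : bounded_measurable (fun y => \int[mu]_z (g x y z ^+ 2)).
  exact: (@bounded_measurable_expect _ _ _ _ _ mu (fun p : T * T => g x p.1 p.2 ^+ 2) (bounded_measurableX 2 (bg_yz x))).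
have bG2 : bounded_measurable (fun y => \int[mu]_z (G y z ^+ 2)).
  exact: (@bounded_measurable_expect _ _ _ _ _ mu (fun p : T * T => G p.1 p.2 ^+ 2) (bounded_measurableX 2 bG)).
have bsum := bounded_measurableD bg2 bG2.
apply: (@le_trans _ _ (\int[mu]_y (2 * (\int[mu]_z (g x y z ^+ 2) + \int[mu]_z (G y z ^+ 2))))).
  apply: le_expect.
  - exact: (bounded_measurable_sectl b3 x).
  - by apply: bounded_measurableM bsum; exact: bounded_measurable_cst.
  - move=> y; have b1 := bounded_measurableX 2 (bgxy x y).
    have b2 := bounded_measurableX 2 (bounded_measurable_sectl bG y).
    rewrite -(expectD _ b1 b2) -(expectZl _ _ (bounded_measurableD b1 b2)).
    apply: le_expect.
    + exact: bounded_measurableX (bounded_measurable_sectl be (x, y)).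
    + by apply: bounded_measurableM (bounded_measurableD b1 b2); exact: bounded_measurable_cst.
    + move=> z; rewrite /e /=; have := sqr_ge0 (g x y z + G y z); lra.
rewrite (expectZl _ _ bsum) (expectD _ bg2 bG2) ler_wpM2l//.
by apply: lerD; [exact: g_sqr|exact: le_expect_cst bG2 G_sqr].
Qed.

(** Subtracting the conditional mean [G] given the last two variables makes the
kernel completely degenerate; [G] is itself a degenerate kernel of two
variables, which each pair of indices carries [n - 2] times. *)
Lemma expect_sqr_triple_sum :
  \int[nu]_t ((\sum_i \sum_(j | j != i) \sum_(l | (l != i) && (l != j))
      g (tnth t i) (tnth t j) (tnth t l)) ^+ 2)
    <= 2 * (27 * n%:R ^+ 3 * (2 * (V + q))) + 2 * (n.-2%:R ^+ 2 * (4 * n%:R ^+ 2 * q)).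
Proof.
pose U3 (t : n.-tuple T) := \sum_i \sum_(j | j != i) \sum_(l | (l != i) && (l != j))
  e (tnth t i) (tnth t j) (tnth t l).
pose U2 (t : n.-tuple T) := \sum_j \sum_(l | l != j) G (tnth t j) (tnth t l).
have dec (t : n.-tuple T) : \sum_i \sum_(j | j != i) \sum_(l | (l != i) && (l != j))
    g (tnth t i) (tnth t j) (tnth t l) = U3 t + n.-2%:R * U2 t.
  rewrite -sum_triples_drop -big_split/=; apply: eq_bigr => i _.
  rewrite -big_split/=; apply: eq_bigr => j _; rewrite -big_split/=.
  by apply: eq_bigr => l _; rewrite /e subrK.
have bU2 : bounded_measurable U2.
  apply: bounded_measurable_sum => i; apply: bounded_measurable_sum => j.
  exact: (bounded_measurable_tnth2 _ _ bG).
have bU3 : bounded_measurable U3.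
  do 3 apply: bounded_measurable_sum => ?.
  exact: (bounded_measurable_tnth3 _ _ _ be).
have n3 : 0 <= 27 * n%:R ^+ 3 :> R by rewrite mulr_ge0 ?exprn_ge0.
have n2 : 0 <= 4 * n%:R ^+ 2 :> R by rewrite mulr_ge0 ?sqr_ge0.
have h3 := expect_sqr_sum3 nu_res be.
have {}h3 : \int[nu]_t (U3 t ^+ 2) <= 27 * n%:R ^+ 3 * (2 * (V + q)).
  apply: le_trans (h3 _ _ _) (ler_wpM2l n3 e_sqr) => [x y|x z|y z].
  - by rewrite /e (expectB _ (bgxy x y) (bounded_measurable_sectl bG y)) gz G_intz subrr.
  - by rewrite /e (expectB _ (bgxz x z) (bounded_measurable_sectr bG z)) gy G_inty subrr.
  - by rewrite /e (expectB _ (bgyz y z) (bounded_measurable_cst T _)) expect_cst subrr.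
have h2 : \int[nu]_t (U2 t ^+ 2) <= 4 * n%:R ^+ 2 * q.
  apply: le_trans (expect_sqr_sum2 nu_res bG G_intz G_inty) (ler_wpM2l n2 _).
  apply: le_expect_cst G_sqr.
  exact: (@bounded_measurable_expect _ _ _ _ _ mu (fun p : T * T => G p.1 p.2 ^+ 2) (bounded_measurableX 2 bG)).
have b1 := bounded_measurableM (bounded_measurable_cst (n.-tuple T) (2 : R)) (bounded_measurableX 2 bU3).
have b2 := bounded_measurableM (bounded_measurable_cst (n.-tuple T) (2 * n.-2%:R ^+ 2 : R)) (bounded_measurableX 2 bU2).
apply: (@le_trans _ _ (\int[nu]_t (2 * U3 t ^+ 2 + 2 * n.-2%:R ^+ 2 * U2 t ^+ 2))).
  apply: le_expect; [|exact: bounded_measurableD b1 b2|].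
    apply: bounded_measurableX; do 3 apply: bounded_measurable_sum => ?.
    exact: (bounded_measurable_tnth3 _ _ _ bg).
  move=> t; rewrite dec; have := sqr_ge0 (U3 t - n.-2%:R * U2 t).
  by move: (U3 t) (U2 t) (n.-2%:R : R) => u v w; lra.
rewrite (expectD _ b1 b2) (expectZl _ _ (bounded_measurableX 2 bU3)).
rewrite (expectZl _ _ (bounded_measurableX 2 bU2)) -(mulrA 2 (_ ^+ 2)).
apply: lerD; first exact: (ler_wpM2l (ler0n _ 2) h3).
exact: (ler_wpM2l (ler0n _ 2) (ler_wpM2l (sqr_ge0 _) h2)).
Qed.

End triple_sums.

Section quadratic_term.
Context d (T : measurableType d) (R : realType) (n : nat).
Variables (mu : probability T R) (nu : probability (n.-tuple T) R).
Hypothesis nu_res : resampling mu nu.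
Variables (Z : T -> T -> R) (w : T -> R) (C W eps : R).
Hypotheses (eps_gt0 : 0 < eps) (eps_le1 : eps <= 1) (C_ge0 : 0 <= C) (W_ge0 : 0 <= W).
Hypothesis bZ : bounded_measurable (fun z : T * T => Z z.1 z.2).
Hypothesis Z_mean : forall x, \int[mu]_y Z x y = 0.
Hypothesis Z_sup : forall x y, `|Z x y| <= C / eps.
Hypothesis Z_intl : forall x, \int[mu]_y `|Z x y| <= C.
Hypothesis Z_intr : forall y, \int[mu]_x `|Z x y| <= C.
Hypothesis Z_sqr : forall x, \int[mu]_y (Z x y ^+ 2) <= C ^+ 2 / eps.
Hypotheses (bw : bounded_measurable w) (w_le : forall x, `|w x| <= W).

Let g x y z := w x * Z x y * Z x z.

Let bg : bounded_measurable (fun z : T * T * T => g z.1.1 z.1.2 z.2).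
Proof.
apply: bounded_measurableM; last first.
  apply: (bounded_measurable_comp bZ (g := fun p : T * T * T => (p.1.1, p.2))).
  apply/measurable_fun_pairP; split; last exact: measurable_snd.
  exact: measurableT_comp measurable_fst measurable_fst.
apply: bounded_measurableM; last exact: (bounded_measurable_comp bZ measurable_fst).
by apply: (bounded_measurable_comp bw); exact: measurableT_comp measurable_fst measurable_fst.
Qed.

Let bZx x : bounded_measurable (Z x). Proof. exact: (bounded_measurable_sectl bZ x). Qed.
Let bZy y : bounded_measurable (Z^~ y). Proof. exact: (bounded_measurable_sectr bZ y). Qed.
Let bwZ y : bounded_measurable (fun x => w x * Z x y). Proof. exact: bounded_measurableM bw (bZy y). Qed.

Let Ce_ge0 : 0 <= C / eps. Proof. by rewrite divr_ge0// ltW. Qed.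

Let g_sqr x : \int[mu]_y \int[mu]_z (g x y z ^+ 2) <= W ^+ 2 * (C ^+ 2 / eps) ^+ 2.
Proof.
have bx := bounded_measurableX 2 (bZx x).
have E y : \int[mu]_z (g x y z ^+ 2) = (w x ^+ 2 * \int[mu]_z (Z x z ^+ 2)) * Z x y ^+ 2.
  rewrite -[RHS]mulrA (mulrC _ (Z x y ^+ 2)) mulrA -exprMn -(expectZl _ _ bx).
  by apply: eq_Rintegral => z _; rewrite -exprMn.
under eq_Rintegral do rewrite E.
rewrite (expectZl _ _ bx) -mulrA -expr2; apply: ler_pM; rewrite ?sqr_ge0//.
  exact: sqr_le_of_norm.
apply: sqr_le_of_norm; rewrite ger0_norm ?Z_sqr//.
by apply: expect_ge0 => y; exact: sqr_ge0.
Qed.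

Let G y z := \int[mu]_x g x y z.

Let bgyz y z : bounded_measurable (fun x => g x y z).
Proof. exact: bounded_measurableM (bwZ y) (bZy z). Qed.

Let G_sup y z : `|G y z| <= W * C ^+ 2 / eps.
Proof.
apply: le_trans (norm_expect_le _ (bgyz y z)) _.
have bn := bounded_measurable_norm (bZy z).
apply: (@le_trans _ _ (\int[mu]_x (W * (C / eps) * `|Z x z|))).
  apply: le_expect; first exact: bounded_measurable_norm (bgyz y z).
    by apply: bounded_measurableM bn; exact: bounded_measurable_cst.
  by move=> x; rewrite /g normrM ler_wpM2r// normrM ler_pM.
rewrite (expectZl _ _ bn) [leRHS](_ : _ = W * (C / eps) * C); last by ring.
by rewrite ler_wpM2l ?Z_intr// mulr_ge0.
Qed.

Let G_int y : \int[mu]_z `|G y z| <= W * C ^+ 2.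
Proof.
have byz : bounded_measurable (fun p : T * T => g p.1 y p.2).
  apply: (bounded_measurable_comp bg (g := fun p : T * T => ((p.1, y), p.2))).
  apply/measurable_fun_pairP; split; last exact: measurable_snd.
  by apply/measurable_fun_pairP; split; [exact: measurable_fst|exact: measurable_cst].
have bn := bounded_measurable_norm byz.
have bnz : bounded_measurable (fun p : T * T => `|g p.2 y p.1|).
  apply: (bounded_measurable_comp bn (g := fun p : T * T => (p.2, p.1))).
  by apply/measurable_fun_pairP; split; [exact: measurable_snd|exact: measurable_fst].
apply: (@le_trans _ _ (\int[mu]_z \int[mu]_x `|g x y z|)).
  apply: le_expect => [||z]; last exact: norm_expect_le (bgyz y z).
    have bz : bounded_measurable (fun p : T * T => g p.2 y p.1).
      apply: (bounded_measurable_comp byz (g := fun p : T * T => (p.2, p.1))).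
      by apply/measurable_fun_pairP; split; [exact: measurable_snd|exact: measurable_fst].
    exact: bounded_measurable_norm (bounded_measurable_expect mu bz).
  exact: bounded_measurable_expect bnz.
rewrite -(expect_fubini mu mu bn).
have bny := bounded_measurable_norm (bZy y).
apply: (@le_trans _ _ (\int[mu]_x (W * C * `|Z x y|))).
  apply: le_expect.
  - exact: (@bounded_measurable_expect _ _ _ _ _ mu (fun p : T * T => `|g p.1 y p.2|)).
  - by apply: bounded_measurableM bny; exact: bounded_measurable_cst.
  - move=> x; have bx := bounded_measurable_norm (bZx x).
    rewrite (_ : \int[mu]_z `|g x y z| = `|w x * Z x y| * \int[mu]_z `|Z x z|); last first.
      by rewrite -(expectZl _ _ bx); apply: eq_Rintegral => z _; rewrite -normrM.
    rewrite (mulrAC W) normrM; apply: ler_pM; [by rewrite mulr_ge0|exact: expect_ge0| |exact: Z_intl].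
    by rewrite ler_wpM2r.
rewrite (expectZl _ _ bny) expr2 mulrA ler_wpM2l// mulr_ge0//.
Qed.

Let bG y : bounded_measurable (G y).
Proof.
have bz : bounded_measurable (fun p : T * T => g p.2 y p.1).
  apply: (bounded_measurable_comp bg (g := fun p : T * T => ((p.2, y), p.1))).
  apply/measurable_fun_pairP; split; last exact: measurable_fst.
  by apply/measurable_fun_pairP; split; [exact: measurable_snd|exact: measurable_cst].
exact: bounded_measurable_expect bz.
Qed.

Let G_sqr y : \int[mu]_z (G y z ^+ 2) <= W ^+ 2 * C ^+ 4 / eps.
Proof.
have bn := bounded_measurable_norm (bG y).
apply: (@le_trans _ _ (\int[mu]_z (W * C ^+ 2 / eps * `|G y z|))).
  apply: le_expect; first exact: bounded_measurableX (bG y).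
    by apply: bounded_measurableM bn; exact: bounded_measurable_cst.
  by move=> z; rewrite -(real_normK (num_real (G y z))) expr2 ler_wpM2r.
rewrite (expectZl _ _ bn) [leRHS](_ : _ = W * C ^+ 2 / eps * (W * C ^+ 2)); last by field; rewrite gt_eqF.
by rewrite ler_wpM2l// divr_ge0 ?(ltW eps_gt0)// mulr_ge0// sqr_ge0.
Qed.

Definition quadratic_term (t : n.-tuple T) : R :=
  (n%:R * n.-1%:R * n.-2%:R)^-1 * \sum_i \sum_(j | j != i) \sum_(l | (l != i) && (l != j))
    w (tnth t i) * Z (tnth t i) (tnth t j) * Z (tnth t i) (tnth t l).

Lemma bounded_quadratic_term : bounded_measurable quadratic_term.
Proof.
apply: bounded_measurableM; first exact: bounded_measurable_cst.
do 3 apply: bounded_measurable_sum => ?.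
exact: (bounded_measurable_tnth3 _ _ _ bg).
Qed.

(** The two-variable projection of the kernel has square integral of order [1 / eps],
against [1 / eps ^ 2] for the kernel itself: averaging over the common variable
spreads the product of two bumps. *)
Lemma expect_sqr_quadratic_term : (3 <= n)%N ->
  \int[nu]_t (quadratic_term t ^+ 2) <= W ^+ 2 * C ^+ 4 *
    (216 * n%:R / (n.-1%:R * n.-2%:R * eps) ^+ 2 + 8 / (n.-1%:R ^+ 2 * eps)).
Proof.
move=> n3; set N := n%:R; set N1 := n.-1%:R; set N2 := n.-2%:R.
have N0 : 0 < N by rewrite ltr0n (leq_trans _ n3).
have N10 : 0 < N1 by rewrite ltr0n -subn1 subn_gt0 (leq_trans _ n3).
have N20 : 0 < N2 by rewrite ltr0n -subn2 subn_gt0.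
have gz x y : \int[mu]_z g x y z = 0 by rewrite (expectZl _ _ (bZx x)) Z_mean mulr0.
have gy x z : \int[mu]_y g x y z = 0.
  rewrite (expectZr _ _ (bounded_measurableM (bounded_measurable_cst T (w x)) (bZx x))).
  by rewrite (expectZl _ _ (bZx x)) Z_mean mulr0 mul0r.
have h := expect_sqr_triple_sum nu_res bg gz gy g_sqr G_sqr.
have bS : bounded_measurable (fun t : n.-tuple T => \sum_i \sum_(j | j != i) \sum_(l | (l != i) && (l != j))
    g (tnth t i) (tnth t j) (tnth t l)).
  do 3 apply: bounded_measurable_sum => ?.
  exact: (bounded_measurable_tnth3 _ _ _ bg).
have -> : \int[nu]_t (quadratic_term t ^+ 2) = (N * N1 * N2)^-1 ^+ 2 *
    \int[nu]_t ((\sum_i \sum_(j | j != i) \sum_(l | (l != i) && (l != j))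
      g (tnth t i) (tnth t j) (tnth t l)) ^+ 2).
  by rewrite -(expectZl _ _ (bounded_measurableX 2 bS)); apply: eq_Rintegral => t _; rewrite -exprMn.
apply: le_trans (ler_wpM2l (sqr_ge0 _) h) _.
have q_le : W ^+ 2 * C ^+ 4 / eps <= W ^+ 2 * (C ^+ 2 / eps) ^+ 2.
  rewrite [leRHS](_ : _ = W ^+ 2 * C ^+ 4 / eps / eps); last by field; rewrite gt_eqF.
  rewrite ler_peMr ?invf_ge1// divr_ge0 ?(ltW eps_gt0)// mulr_ge0 ?sqr_ge0//.
  exact: exprn_ge0.
set V := W ^+ 2 * (C ^+ 2 / eps) ^+ 2 in q_le *; set q := W ^+ 2 * C ^+ 4 / eps in q_le *.
apply: (@le_trans _ _ ((N * N1 * N2)^-1 ^+ 2 *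
    (2 * (27 * N ^+ 3 * (2 * (V + V))) + 2 * (N2 ^+ 2 * (4 * N ^+ 2 * q))))).
  have n30 : 0 <= 27 * N ^+ 3 by rewrite mulr_ge0 ?exprn_ge0// ltW.
  by rewrite ler_wpM2l ?sqr_ge0// lerD2r ler_wpM2l// ler_wpM2l// ler_wpM2l// lerD2l.
rewrite le_eqVlt; apply/orP; left; apply/eqP; rewrite /V /q; field.
by rewrite !gt_eqF.
Qed.

End quadratic_term.

(** * Expansion of the plug-in estimators *)

Lemma probability_le_expect d (T : measurableType d) (R : realType) (nu : probability T R)
    (S : set T) (F : T -> R) : measurable S -> bounded_measurable F ->
  (forall t, 0 <= F t) -> (forall t, S t -> 1 <= F t) -> (nu S <= (\int[nu]_t F t)%:E)%E.
Proof.
move=> mS bF F0 F1; rewrite -(EFin_expect _ bF) -[S in leLHS]setIT -integral_indic//.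
apply: ge0_le_integral => //.
- exact/measurable_EFinP/measurable_indic.
- by apply/measurable_EFinP; case: bF.
- move=> t _; rewrite lee_fin indicE; case: (boolP (t \in S)) => [/set_mem/F1//|_].
  exact: F0.
Qed.

Section plug_in_estimators.
Context d (T : measurableType d) (R : realType) (n : nat).
Variables (k : T -> T -> R) (phi : T -> R).
Local Notation m := (n%:R - 1 : R).

Definition density_estimate (t : n.-tuple T) (i : 'I_n) : R :=
  m^-1 * \sum_(j | j != i) k (tnth t i) (tnth t j).

Definition variance_estimate (t : n.-tuple T) (i : 'I_n) : R :=
  (m * (n%:R - 2))^-1 * \sum_(j | j != i) (k (tnth t i) (tnth t j) - density_estimate t i) ^+ 2.

Definition plain_estimate (t : n.-tuple T) : R :=
  n%:R^-1 * \sum_i (phi (tnth t i) / density_estimate t i).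

Definition corrected_estimate (t : n.-tuple T) : R :=
  n%:R^-1 * \sum_i (phi (tnth t i) / density_estimate t i *
    (1 - variance_estimate t i / density_estimate t i ^+ 2)).

Hypotheses (bk : bounded_measurable (fun z : T * T => k z.1 z.2)) (bphi : bounded_measurable phi).

Lemma bounded_density_estimate i : bounded_measurable (density_estimate^~ i).
Proof.
apply: bounded_measurableM; first exact: bounded_measurable_cst.
by apply: bounded_measurable_sum => j; exact: bounded_measurable_tnth2.
Qed.

Lemma bounded_variance_estimate i : bounded_measurable (variance_estimate^~ i).
Proof.
apply: bounded_measurableM; first exact: bounded_measurable_cst.
apply: bounded_measurable_sum => j; apply: bounded_measurableX.
apply: bounded_measurableB (bounded_density_estimate i).
exact: (bounded_measurable_tnth2 (n := n) i j bk).
Qed.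

Lemma measurable_plain_estimate : measurable_fun setT plain_estimate.
Proof.
apply: measurable_funM => //; apply: measurable_sum => i.
apply: measurable_funM; first by case: (bounded_measurable_tnth (n := n) i bphi).
by apply: measurable_funV; case: (bounded_density_estimate i).
Qed.

Lemma measurable_corrected_estimate : measurable_fun setT corrected_estimate.
Proof.
apply: measurable_funM => //; apply: measurable_sum => i.
have [mf _] := bounded_density_estimate i; have [mv _] := bounded_variance_estimate i.
apply: measurable_funM.
  by apply: measurable_funM; [case: (bounded_measurable_tnth (n := n) i bphi)|exact: measurable_funV].
apply: measurable_funB => //; apply: measurable_funM => //.
exact/measurable_funV/measurable_funX.
Qed.

Section decomposition.
Variables (mu : probability T R) (f : T -> R) (B b beta : R) (t : n.-tuple T).
Hypothesis n_ge3 : (3 <= n)%N.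
Hypotheses (b_gt0 : 0 < b) (phi_le : forall x, `|phi x| <= B) (f_ge : forall x, phi x != 0 -> b <= f x).
Hypothesis bias_le : forall x, `|kernel_mean mu k x - f x| <= beta.
Hypothesis t_good : forall i, phi (tnth t i) != 0 -> b / 2 <= density_estimate t i.

Let m_gt0 : 0 < m. Proof. by rewrite subr_gt0 ltr1n (leq_trans _ n_ge3). Qed.
Let m1_gt0 : 0 < n%:R - 2 :> R. Proof. by rewrite subr_gt0 ltr_nat. Qed.
Let n_gt0 : (0 : R) < n%:R. Proof. by rewrite ltr0n (leq_trans _ n_ge3). Qed.
Let mE : n.-1%:R = m. Proof. by rewrite -subn1 natrB// (leq_trans _ n_ge3). Qed.
Let m1E : n.-2%:R = n%:R - 2 :> R. Proof. by rewrite -subn2 natrB// (leq_trans _ n_ge3). Qed.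
Let sum_cst (i : 'I_n) (u : R) : \sum_(j < n | j != i) u = m * u.
Proof. by rewrite sum_off_diag_cst mE. Qed.

Local Notation S i := (fluctuation mu k i t).
Local Notation Z i j := (centered mu k (tnth t i) (tnth t j)).

Lemma density_estimateE i : density_estimate t i = kernel_mean mu k (tnth t i) + S i.
Proof.
rewrite /density_estimate /fluctuation /centered sumrB sum_cst; field.
by rewrite gt_eqF.
Qed.

Lemma sum_sqr_deviations i : \sum_(j | j != i) (k (tnth t i) (tnth t j) - density_estimate t i) ^+ 2 =
  sum_sqr mu k i t - m * S i ^+ 2.
Proof.
transitivity (\sum_(j | j != i) (Z i j ^+ 2 - 2 * S i * Z i j + S i ^+ 2)).
  by apply: eq_bigr => j _; rewrite density_estimateE /centered; ring.
rewrite big_split/= sumrB sum_cst -big_distrr/=.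
have -> : \sum_(j | j != i) Z i j = m * S i by rewrite /fluctuation mulVKf// gt_eqF.
by rewrite /sum_sqr; ring.
Qed.

Lemma variance_estimate_ge0 i : 0 <= variance_estimate t i.
Proof.
rewrite mulr_ge0 ?invr_ge0 ?mulr_ge0 ?(ltW m_gt0) ?(ltW m1_gt0)//.
by apply: sumr_ge0 => j _; exact: sqr_ge0.
Qed.

Lemma variance_estimate_le i : variance_estimate t i <= 2 / m ^+ 2 * sum_sqr mu k i t.
Proof.
rewrite /variance_estimate sum_sqr_deviations.
have W0 : 0 <= sum_sqr mu k i t by apply: sumr_ge0 => j _; exact: sqr_ge0.
apply: (@le_trans _ _ ((m * (n%:R - 2))^-1 * sum_sqr mu k i t)).
  rewrite ler_wpM2l ?invr_ge0 ?mulr_ge0 ?(ltW m_gt0) ?(ltW m1_gt0)//.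
  by rewrite lerBlDr lerDl mulr_ge0 ?sqr_ge0// ltW.
rewrite ler_wpM2r// -[leRHS]invrK lef_pV2 ?posrE ?mulr_gt0 ?invr_gt0 ?divr_gt0 ?exprn_gt0//.
rewrite invf_div expr2 -mulrA ler_wpM2l ?(ltW m_gt0)//.
have : 3 <= n%:R :> R by rewrite ler_nat.
lra.
Qed.

(** The estimated variance removes from the squared fluctuation its diagonal part, so that
what remains has mean zero given the sample point. *)
Lemma sqr_fluctuation_sub_variance i : S i ^+ 2 - variance_estimate t i =
  (m * (n%:R - 2))^-1 * \sum_(j | j != i) \sum_(l | (l != i) && (l != j)) (Z i j * Z i l).
Proof.
have sumZ : \sum_(j | j != i) Z i j = m * S i by rewrite /fluctuation mulVKf// gt_eqF.
have -> : \sum_(j | j != i) \sum_(l | (l != i) && (l != j)) (Z i j * Z i l) =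
    (m * S i) ^+ 2 - sum_sqr mu k i t.
  rewrite -{1}sumZ expr2 big_distrl/= /sum_sqr -sumrB; apply: eq_bigr => j ji.
  by rewrite [in RHS](bigD1 j)//= mulrDr expr2 addrAC subrr add0r big_distrr.
rewrite /variance_estimate sum_sqr_deviations; field.
by rewrite !gt_eqF.
Qed.

Let mean_le (F G : 'I_n -> R) : (forall i, `|F i| <= G i) ->
  `|n%:R^-1 * \sum_i F i| <= n%:R^-1 * \sum_i G i.
Proof.
move=> FG; rewrite normrM ger0_norm ?invr_ge0// ler_wpM2l ?invr_ge0//.
by apply: le_trans (ler_norm_sum _ _ _) _; exact: ler_sum.
Qed.

Let linE : linear_term mu k phi f t = n%:R^-1 *
  \sum_i (2 * weight phi f 1 (tnth t i) - weight phi f 2 (tnth t i) * density_estimate t i)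
  - target mu phi f.
Proof.
rewrite /linear_term /linear_kernel.
transitivity ((n%:R * m)^-1 * \sum_i (m * (2 * weight phi f 1 (tnth t i)
  - weight phi f 2 (tnth t i) * density_estimate t i) - m * target mu phi f)).
  congr (_ * _); apply: eq_bigr => i _.
  rewrite sumrB sumrB !sum_cst -big_distrr/= /density_estimate; field.
  by rewrite gt_eqF.
rewrite sumrB -big_distrr/= sumr_const card_ord -[_ *+ n]mulr_natl; field.
by rewrite !gt_eqF.
Qed.

(** The mean over the sample of the first order part of the expansion of the reciprocal is
[linear_term]; points where [phi] vanishes contribute nothing on either side. *)
Lemma plain_estimate_decomposition :
  `|plain_estimate t - target mu phi f| <= `|linear_term mu k phi f t| +
     n%:R^-1 * \sum_i (4 * B / b ^+ 3 * (S i ^+ 2 + beta ^+ 2)).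
Proof.
have -> : plain_estimate t - target mu phi f = linear_term mu k phi f t +
    n%:R^-1 * \sum_i (phi (tnth t i) / density_estimate t i
      - (2 * weight phi f 1 (tnth t i) - weight phi f 2 (tnth t i) * density_estimate t i)).
  by rewrite linE /plain_estimate !sumrB; ring.
apply: le_trans (ler_normD _ _) _; rewrite lerD2l; apply: mean_le => i.
have B0 : 0 <= B by exact: le_trans (phi_le (tnth t i)).
have c0 : 0 <= 4 * B / b ^+ 3 by rewrite ?divr_ge0 ?mulr_ge0 ?exprn_ge0 ?(ltW b_gt0)//.
have [p0|p0] := eqVneq (phi (tnth t i)) 0.
  rewrite /weight p0 !mul0r mulr0 subrr subr0 normr0.
  by rewrite mulr_ge0// addr_ge0 ?sqr_ge0.
apply: le_trans (reciprocal_expansion1 b_gt0 (phi_le _) (f_ge p0) (t_good p0)) _.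
have := sqr_le_of_norm (bias_le (tnth t i)); rewrite density_estimateE.
set e := kernel_mean _ _ _ - _ => e2; set s := S i.
have -> : kernel_mean mu k (tnth t i) + s - f (tnth t i) = e + s by rewrite /e; ring.
rewrite (_ : 4 * B / b ^+ 3 * _ = 2 * B / b ^+ 3 * (2 * (s ^+ 2 + beta ^+ 2))); last by field; rewrite gt_eqF.
apply: ler_wpM2l; first by rewrite ?divr_ge0 ?mulr_ge0 ?exprn_ge0 ?(ltW b_gt0)//.
rewrite -subr_ge0 (_ : _ - _ = (e - s) ^+ 2 + 2 * (beta ^+ 2 - e ^+ 2)); last by ring.
by rewrite addr_ge0 ?sqr_ge0// mulr_ge0// subr_ge0.
Qed.

Lemma corrected_estimate_decomposition :
  `|corrected_estimate t - target mu phi f| <= `|linear_term mu k phi f t| +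
     `|quadratic_term (centered mu k) (weight phi f 3) t| +
     n%:R^-1 * \sum_i ((2 * B / b ^+ 3 + 14 * B / b ^+ 4) *
       (beta * `|S i| + beta ^+ 2 + `|S i| ^+ 3 + beta ^+ 3
        + variance_estimate t i * `|S i| + variance_estimate t i * beta)).
Proof.
have quadE : quadratic_term (centered mu k) (weight phi f 3) t =
    n%:R^-1 * \sum_i (weight phi f 3 (tnth t i) * (S i ^+ 2 - variance_estimate t i)).
  rewrite /quadratic_term.
  transitivity ((n%:R * m * (n%:R - 2))^-1 * \sum_i (m * (n%:R - 2) *
      (weight phi f 3 (tnth t i) * (S i ^+ 2 - variance_estimate t i)))).
    rewrite mE m1E; congr (_ * _); apply: eq_bigr => i _.
    rewrite sqr_fluctuation_sub_variance mulrCA mulVKf ?gt_eqF ?mulr_gt0// big_distrr/=.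
    apply: eq_bigr => j _; rewrite big_distrr/=; apply: eq_bigr => l _.
    by rewrite mulrA.
  by rewrite -big_distrr/=; field; rewrite !gt_eqF.
have -> : corrected_estimate t - target mu phi f = linear_term mu k phi f t +
    quadratic_term (centered mu k) (weight phi f 3) t +
    n%:R^-1 * \sum_i (phi (tnth t i) / density_estimate t i *
      (1 - variance_estimate t i / density_estimate t i ^+ 2)
      - (2 * weight phi f 1 (tnth t i) - weight phi f 2 (tnth t i) * density_estimate t i)
      - weight phi f 3 (tnth t i) * (S i ^+ 2 - variance_estimate t i)).
  by rewrite linE quadE /corrected_estimate !sumrB; ring.
apply: le_trans (ler_normD _ _) _; apply: lerD; first exact: ler_normD.
apply: mean_le => i.
have B0 : 0 <= B by exact: le_trans (phi_le (tnth t i)).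
have beta0 : 0 <= beta by exact: le_trans (bias_le (tnth t i)).
have := variance_estimate_ge0 i; move: (variance_estimate t i) => v v0.
have [p0|p0] := eqVneq (phi (tnth t i)) 0.
  rewrite /weight p0 !mul0r mulr0 !subrr normr0.
  rewrite mulr_ge0// ?addr_ge0 ?mulr_ge0 ?divr_ge0 ?invr_ge0 ?exprn_ge0 ?(ltW b_gt0)//.
have gE : density_estimate t i = f (tnth t i) + S i + (kernel_mean mu k (tnth t i) - f (tnth t i)).
  by rewrite density_estimateE; ring.
exact: (reciprocal_expansion2 b_gt0 (phi_le _) (f_ge p0) (t_good p0) gE (bias_le _) v0 erefl).
Qed.

End decomposition.
End plug_in_estimators.

(** * Tail bounds for the plug-in estimators *)

(** Nonnegativity of an expression built from nonnegative atoms. *)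
Ltac nonneg := repeat first [assumption|exact: sqr_ge0|by apply: exprn_ge0|apply: addr_ge0
  |apply: mulr_ge0|by rewrite invr_ge0].

Lemma corrected_error_le (R : realFieldType) (e r F G : R) :
  0 <= e -> e <= 1 -> 0 <= r -> r <= 1 -> 0 <= F -> 0 <= G ->
  e ^+ 2 + e ^+ 3 + e * r ^+ 2 / 2 + e * (2 * F * r) + 54 * F * r ^+ 3
    + r / 2 * (8 * F * r ^+ 2) + (2 * r ^+ 3 + 2 * e * r ^+ 2) * (8 * G)
  <= (3 + 58 * F + 16 * G) * (e + r ^+ 3).
Proof.
move=> e0 e1 r0 r1 F0 G0.
have r2 : r ^+ 2 <= 1 by rewrite expr_le1.
have e2 : e ^+ 2 <= 1 by rewrite expr_le1.
rewrite -subr_ge0 (_ : _ - _ = e * (1 - e) + e * (1 - e ^+ 2) + e * (1 - r ^+ 2) + e * r ^+ 2 / 2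
  + 3 * r ^+ 3 + F * (2 * (e * (1 - r)) + 56 * e) + 16 * G * (e * (1 - r ^+ 2))); last by field.
have [ha hb hc hd] : [/\ 0 <= 1 - e, 0 <= 1 - e ^+ 2, 0 <= 1 - r & 0 <= 1 - r ^+ 2].
  by rewrite !subr_ge0.
by nonneg.
Qed.

Section tail_bounds.
Context d (T : measurableType d) (R : realType) (n : nat).
Variables (mu : probability T R) (nu : probability (n.-tuple T) R).
Hypothesis nu_res : resampling mu nu.
Variables (k : T -> T -> R) (eps A : R).
Hypotheses (n_ge3 : (3 <= n)%N) (eps_gt0 : 0 < eps) (eps_le1 : eps <= 1) (A_ge0 : 0 <= A).
Hypothesis bk : bounded_measurable (fun z : T * T => k z.1 z.2).
Hypothesis k_sup : forall x y, `|k x y| <= A / eps.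
Hypothesis k_int : forall x, \int[mu]_y `|k x y| <= A.
Local Notation m := (n%:R - 1 : R).
Hypothesis m_eps : 1 <= m * eps.
Variables (phi f : T -> R) (B b beta : R).
Hypotheses (b_gt0 : 0 < b) (B_ge0 : 0 <= B) (bphi : bounded_measurable phi) (phi_le : forall x, `|phi x| <= B).
Hypotheses (bf : bounded_measurable f) (f_ge : forall x, phi x != 0 -> b <= f x).
Hypothesis bias_le : forall x, `|kernel_mean mu k x - f x| <= beta.
Hypotheses (beta_ge0 : 0 <= beta) (beta_le : beta <= b / 4).

Local Notation S := (fluctuation mu k).
Local Notation tau := (Num.sqrt (m * eps)).

Let m_gt0 : 0 < m. Proof. by rewrite subr_gt0 ltr1n (leq_trans _ n_ge3). Qed.
Let n_gt0 : (0 : R) < n%:R. Proof. by rewrite ltr0n (leq_trans _ n_ge3). Qed.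
Let tau_gt0 : 0 < tau. Proof. by rewrite sqrtr_gt0 (lt_le_trans ltr01). Qed.
Let bS (i : 'I_n) : bounded_measurable (S i). Proof. exact: bounded_fluctuation bk i. Qed.
Let bSX p (i : 'I_n) : bounded_measurable (fun t => `|S i t| ^+ p).
Proof. exact/bounded_measurableX/bounded_measurable_norm/bS. Qed.

Let S_moment p (i : 'I_n) : (0 < p)%N ->
  \int[nu]_t (`|S i t| ^+ p) <= 2 * p%:R ^+ p * fluctuation_const A / tau ^+ p.
Proof. exact: (fluctuation_moment nu_res n_ge3 eps_gt0 eps_le1 A_ge0 bk k_sup k_int m_eps). Qed.

Lemma expect_mean_le (U : 'I_n -> n.-tuple T -> R) (u : R) : (forall i, bounded_measurable (U i)) ->
  (forall i, \int[nu]_t U i t <= u) -> \int[nu]_t (n%:R^-1 * \sum_i U i t) <= u.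
Proof.
move=> bU hU; rewrite (expectZl _ _ (bounded_measurable_sum _ _ bU)) (expect_sum _ _ _ bU).
rewrite mulrC ler_pdivrMr//; apply: (@le_trans _ _ (\sum_(i < n) u)).
  by apply: ler_sum => i _; exact: hU.
by rewrite sumr_const card_ord mulr_natr.
Qed.

(** Either every relevant density estimate is at least [b / 2], and [W] bounds the error, or
some fluctuation is at least [b / 4]; the sum of the sixth powers of the fluctuations
then exceeds a constant. Sixth moments suffice because [n / tau ^+ 6] is, up to a
constant, the square of [n^(-1) h^(-3d/2)]. *)
Lemma tail_bound (est W : n.-tuple T -> R) (I c : R) : 0 < c ->
  measurable_fun setT est -> bounded_measurable W -> (forall t, 0 <= W t) ->
  (forall t : n.-tuple T, (forall i, phi (tnth t i) != 0 -> b / 2 <= density_estimate k t i) ->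
    `|est t - I| <= W t) ->
  (nu [set t | (c < `|est t - I|)%R] <=
   ((4 / b) ^+ 6 * (2 * 6 ^+ 6 * fluctuation_const A) * (n%:R / tau ^+ 6) + c^-1 * \int[nu]_t W t)%:E)%E.
Proof.
move=> c0 mest bW W0 estW.
have mS : measurable [set t | c < `|est t - I|].
  have mb : measurable_fun setT (fun t => c < `|est t - I|).
    apply: measurable_fun_ltr => //; apply: measurableT_comp => //.
    exact: measurable_funB.
  have := mb measurableT [set true] Logic.I.
  by rewrite setTI; congr measurable; apply/seteqP; split=> t /=.
pose F (t : n.-tuple T) := (4 / b) ^+ 6 * \sum_i `|S i t| ^+ 6 + c^-1 * W t.
have b1 : bounded_measurable (fun t : n.-tuple T => \sum_i `|S i t| ^+ 6).
  by apply: bounded_measurable_sum => i; exact: bSX.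
have b2 := bounded_measurableM (bounded_measurable_cst (n.-tuple T) ((4 / b) ^+ 6)) b1.
have b3 := bounded_measurableM (bounded_measurable_cst (n.-tuple T) c^-1) bW.
have b4_ge0 : 0 <= 4 / b by rewrite divr_ge0// ltW.
have s6_ge0 (t : n.-tuple T) : 0 <= \sum_i `|S i t| ^+ 6 by apply: sumr_ge0 => i _; exact: exprn_ge0.
have cV : 0 <= c^-1 by rewrite invr_ge0 ltW.
apply: (@le_trans _ _ (\int[nu]_t F t)%:E).
  apply: probability_le_expect => //; first exact: bounded_measurableD b2 b3.
    by move=> t; apply: addr_ge0; apply: mulr_ge0 => //; exact: exprn_ge0.
  move=> t /= ct.
  have [/forallP good|] := boolP [forall i, (phi (tnth t i) != 0) ==> (b / 2 <= density_estimate k t i)].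
    have {}good i : phi (tnth t i) != 0 -> b / 2 <= density_estimate k t i.
      by move=> p0; have := good i; rewrite p0.
    apply: (@le_trans _ _ (c^-1 * W t)); last by rewrite lerDr mulr_ge0 ?exprn_ge0.
    by rewrite mulrC ler_pdivlMr// mul1r; exact: le_trans (ltW ct) (estW _ good).
  rewrite negb_forall => /existsP[i]; rewrite negb_imply -ltNge => /andP[p0 bad].
  apply: (@le_trans _ _ ((4 / b) ^+ 6 * `|S i t| ^+ 6)).
    rewrite -exprMn exprn_ege1// mulrC -ler_pdivrMr ?divr_gt0// mul1r invf_div.
    have := bias_le (tnth t i); have := f_ge p0; move: bad beta_le.
    rewrite (density_estimateE k mu)//.
    move: (kernel_mean _ _ _) (S i t) (f _) => x s y h1 h2 h3.
    rewrite ler_norml => /andP[h4 h5].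
    have : s <= - (b / 4) by lra.
    by move=> sb; apply: (@le_trans _ _ (- s)); [lra|rewrite -normrN; exact: ler_norm].
  rewrite /F (bigD1 i)//= mulrDr -addrA lerDl; apply: addr_ge0; apply: mulr_ge0 => //.
    exact: exprn_ge0.
  by apply: sumr_ge0 => j _; exact: exprn_ge0.
rewrite lee_fin (expectD _ b2 b3) (expectZl _ _ b1) (expectZl _ _ bW) lerD2r.
rewrite -!(mulrA ((4 / b) ^+ 6)) ler_wpM2l ?exprn_ge0//.
rewrite (expect_sum _ _ _ (fun i => bSX 6 i)).
apply: le_trans (ler_sum _ (fun i _ => S_moment i (isT : (0 < 6)%N))) _.
by rewrite sumr_const card_ord -[leLHS]mulr_natl le_eqVlt; apply/orP; left; apply/eqP; ring.
Qed.

Local Notation fc := (fluctuation_const A).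
Local Notation sc := (sum_sqr_const A).
Variable lam : R.
Hypothesis lam_ge : \int[nu]_t `|linear_term mu k phi f t| <= lam.

Let bL : bounded_measurable (fun t : n.-tuple T => `|linear_term mu k phi f t|).
Proof.
apply: bounded_measurable_norm.
exact: (@bounded_linear_term _ _ _ _ _ _ bk _ _ _ _ b_gt0 bphi phi_le bf f_ge).
Qed.

Let mean_b (U : 'I_n -> n.-tuple T -> R) : (forall i, bounded_measurable (U i)) ->
  bounded_measurable (fun t => n%:R^-1 * \sum_i U i t).
Proof.
move=> bU; apply: bounded_measurableM; first exact: bounded_measurable_cst.
exact: bounded_measurable_sum.
Qed.

Let mean_ge0 (U : 'I_n -> n.-tuple T -> R) : (forall i t, 0 <= U i t) ->
  forall t, 0 <= n%:R^-1 * \sum_i U i t.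
Proof. by move=> U0 t; rewrite mulr_ge0 ?invr_ge0// sumr_ge0. Qed.

Let bcst (e : R) := bounded_measurable_cst (n.-tuple T) e.

(** The mean of the quadratic error is [1 / tau ^+ 2] up to the squared bias. *)
Lemma plain_estimate_tail (c : R) : 0 < c ->
  (nu [set t | (c < `|plain_estimate k phi t - target mu phi f|)%R] <=
   ((4 / b) ^+ 6 * (2 * 6 ^+ 6 * fc) * (n%:R / tau ^+ 6) +
    c^-1 * (lam + 4 * B / b ^+ 3 * (8 * fc / tau ^+ 2 + beta ^+ 2)))%:E)%E.
Proof.
move=> c0; set D := 4 * B / b ^+ 3.
pose U (i : 'I_n) (t : n.-tuple T) := D * (S i t ^+ 2 + beta ^+ 2).
have bS2 (i : 'I_n) : bounded_measurable (fun t => S i t ^+ 2) by exact: bounded_measurableX.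
have bU i : bounded_measurable (U i).
  exact: bounded_measurableM (bcst D) (bounded_measurableD (bS2 i) (bcst (beta ^+ 2))).
have U0 i t : 0 <= U i t.
  by rewrite mulr_ge0 ?addr_ge0 ?sqr_ge0 ?divr_ge0 ?mulr_ge0 ?exprn_ge0 ?(ltW b_gt0).
have D0 : 0 <= D by rewrite ?divr_ge0 ?mulr_ge0 ?exprn_ge0 ?(ltW b_gt0).
have bW := bounded_measurableD bL (mean_b bU).
apply: le_trans (tail_bound (I := target mu phi f) c0 _ bW _ _) _.
- exact: measurable_plain_estimate.
- by move=> t; rewrite addr_ge0// mean_ge0.
- by move=> t good; exact: plain_estimate_decomposition.
rewrite lee_fin lerD2l ler_wpM2l ?invr_ge0 ?(ltW c0)// (expectD _ bL (mean_b bU)).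
apply: lerD => //; apply: expect_mean_le => // i.
rewrite (expectZl _ _ (bounded_measurableD (bS2 i) (bcst _))) ler_wpM2l//.
rewrite (expectD _ (bS2 i) (bcst _)) expect_cst lerD2r.
apply: le_trans (le_trans _ (S_moment i (isT : (0 < 2)%N))) _.
  by rewrite le_eqVlt; apply/orP; left; apply/eqP; apply: eq_Rintegral => t _; rewrite real_normK ?num_real.
by rewrite le_eqVlt; apply/orP; left; apply/eqP; congr (_ * _ / _); ring.
Qed.

Variable lamQ : R.
Hypothesis lamQ_ge : \int[nu]_t `|quadratic_term (centered mu k) (weight phi f 3) t| <= lamQ.

(** The product of the estimated variance with the fluctuation is split by the
inequality between geometric and arithmetic means at the scale [tau], so that only second
moments of each factor are needed. *)
Lemma corrected_estimate_tail (c : R) : 0 < c -> beta <= 1 ->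
  (nu [set t | (c < `|corrected_estimate k phi t - target mu phi f|)%R] <=
   ((4 / b) ^+ 6 * (2 * 6 ^+ 6 * fc) * (n%:R / tau ^+ 6) +
    c^-1 * (lam + lamQ + (2 * B / b ^+ 3 + 14 * B / b ^+ 4) *
      ((3 + 58 * fc + 16 * sc) * (beta + tau^-1 ^+ 3))))%:E)%E.
Proof.
move=> c0 beta1; set D := 2 * B / b ^+ 3 + 14 * B / b ^+ 4.
have D0 : 0 <= D by rewrite addr_ge0 ?divr_ge0 ?mulr_ge0 ?exprn_ge0 ?(ltW b_gt0).
set r := tau^-1; have r0 : 0 <= r by rewrite invr_ge0 ltW.
have r1 : r <= 1.
  by rewrite invf_le1// -[leLHS]sqrtr1 ler_wsqrtr.
have r2 : r ^+ 2 = (m * eps)^-1 by rewrite exprVn sqr_sqrtr// (le_trans ler01).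
pose X (i : 'I_n) (t : n.-tuple T) := eps / m * sum_sqr mu k i t.
pose c1 : R := beta ^+ 2 + beta ^+ 3 + beta * r ^+ 2 / 2.
pose e : R := 2 * r ^+ 3 + 2 * beta * r ^+ 2.
pose V i (t : n.-tuple T) := c1 + beta * `|S i t| ^+ 1 + `|S i t| ^+ 3 + r / 2 * `|S i t| ^+ 2 + e * X i t ^+ 2.
pose U i t := D * V i t.
have e0 : 0 <= e by rewrite addr_ge0 ?mulr_ge0 ?exprn_ge0.
have bX i : bounded_measurable (fun t => X i t ^+ 2).
  by apply: bounded_measurableX; apply: bounded_measurableM; [exact: bcst|exact: bounded_sum_sqr].
have b1 i := bounded_measurableM (bcst beta) (bSX 1 i).
have b2 i := bounded_measurableM (bcst (r / 2)) (bSX 2 i).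
have b3 i := bounded_measurableM (bcst e) (bX i).
have b01 i := bounded_measurableD (bcst c1) (b1 i).
have b013 i := bounded_measurableD (b01 i) (bSX 3 i).
have b0132 i := bounded_measurableD (b013 i) (b2 i).
have bV i : bounded_measurable (V i) := bounded_measurableD (b0132 i) (b3 i).
have bU i : bounded_measurable (U i) := bounded_measurableM (bcst D) (bV i).
have V0 i t : 0 <= V i t.
  rewrite /V /c1; nonneg.
have bQ : bounded_measurable (fun t : n.-tuple T => `|quadratic_term (centered mu k) (weight phi f 3) t|).
  apply: bounded_measurable_norm; apply: bounded_quadratic_term.
    exact: bounded_centered bk.
  exact: (bounded_weight b_gt0 bphi phi_le bf f_ge).
have bLQ := bounded_measurableD bL bQ.
have bW := bounded_measurableD bLQ (mean_b bU).
apply: le_trans (tail_bound (I := target mu phi f) c0 _ bW _ _) _.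
- exact: measurable_corrected_estimate.
- by move=> t; rewrite !addr_ge0// mean_ge0// => i t'; rewrite mulr_ge0.
- move=> t good; apply: le_trans (corrected_estimate_decomposition n_ge3 b_gt0 phi_le f_ge bias_le good) _.
  rewrite lerD2l ler_wpM2l ?invr_ge0//; apply: ler_sum => i _; rewrite ler_wpM2l//.
  have v_le : variance_estimate k t i <= 2 * X i t * r ^+ 2.
    apply: le_trans (variance_estimate_le k mu t n_ge3 i) _.
    by rewrite r2 /X le_eqVlt; apply/orP; left; apply/eqP; field; rewrite !gt_eqF.
  rewrite /V /c1 /e; have := normr_ge0 (S i t); move: `|S i t| (X i t) v_le => s x.
  move: (variance_estimate k t i) => v v_le s0.
  have h1 : v * s <= 2 * x * r ^+ 2 * s by rewrite ler_wpM2r.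
  have h2 : v * beta <= 2 * x * r ^+ 2 * beta by rewrite ler_wpM2r.
  have h3 : 0 <= r / 2 * (2 * r * x - s) ^+ 2 by nonneg.
  have h4 : 0 <= beta * r ^+ 2 / 2 * (1 - 2 * x) ^+ 2 by nonneg.
  rewrite -subr_ge0 (_ : _ - _ = (2 * x * r ^+ 2 * s - v * s) + (2 * x * r ^+ 2 * beta - v * beta)
    + r / 2 * (2 * r * x - s) ^+ 2 + beta * r ^+ 2 / 2 * (1 - 2 * x) ^+ 2); last by field.
  by rewrite -subr_ge0 in h1; rewrite -subr_ge0 in h2; nonneg.
rewrite lee_fin lerD2l ler_wpM2l ?invr_ge0 ?(ltW c0)// (expectD _ bLQ (mean_b bU)) (expectD _ bL bQ).
apply: lerD; first exact: lerD.
apply: expect_mean_le => // i; rewrite (expectZl _ _ (bV i)) ler_wpM2l//.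
rewrite (expectD _ (b0132 i) (b3 i)) (expectD _ (b013 i) (b2 i)) (expectD _ (b01 i) (bSX 3 i)).
rewrite (expectD _ (bcst c1) (b1 i)) expect_cst (expectZl _ _ (bSX 1 i)) (expectZl _ _ (bSX 2 i)) (expectZl _ _ (bX i)).
have h1 := S_moment i (isT : (0 < 1)%N); have h2 := S_moment i (isT : (0 < 2)%N).
have h3 := S_moment i (isT : (0 < 3)%N).
have hX := sum_sqr_moment nu_res n_ge3 eps_gt0 eps_le1 A_ge0 bk k_sup k_int m_eps i.
have fc0 : 0 <= fc by exact: expR_ge0.
have sc0 : 0 <= sc by exact: expR_ge0.
have r20 : 0 <= r / 2 by rewrite divr_ge0.
apply: (@le_trans _ _ (c1 + beta * (2 * fc * r) + 54 * fc * r ^+ 3 + r / 2 * (8 * fc * r ^+ 2) + e * (8 * sc))).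
  apply: lerD; last by apply: ler_wpM2l.
  apply: lerD; last first.
    apply: ler_wpM2l => //; apply: le_trans h2 _; rewrite exprVn.
    by rewrite le_eqVlt; apply/orP; left; apply/eqP; congr (_ * _); ring.
  apply: lerD; last first.
    apply: le_trans h3 _; rewrite exprVn.
    by rewrite le_eqVlt; apply/orP; left; apply/eqP; congr (_ * _); ring.
  rewrite lerD2l; apply: ler_wpM2l => //; apply: le_trans h1 _.
  by rewrite le_eqVlt; apply/orP; left; apply/eqP; rewrite !expr1 mulr1.
exact: corrected_error_le.
Qed.

End tail_bounds.

(** * Integration against a density and substitution in the kernel *)

Section integration_against_density.
Context d (T : measurableType d) (R : realType) (leb : {sigma_finite_measure set T -> \bar R}).
Variables (mu : probability T R) (f : T -> R).
Hypotheses (mf : measurable_fun setT f) (f_ge0 : forall x, 0 <= f x).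
Hypothesis muE : forall A, measurable A -> mu A = (\int[leb]_(x in A) (f x)%:E)%E.

Let mfE : measurable_fun setT (EFin \o f). Proof. exact/measurable_EFinP. Qed.

Let dom : mu `<< leb.
Proof.
apply/null_content_dominatesP => A mA A0.
rewrite (muE mA).
by apply: null_set_integral => //; exact: measurable_funTS.
Qed.

(** The density is almost everywhere the Radon-Nikodym derivative. *)
Lemma ge0_integral_density (g : T -> \bar R) : measurable_fun setT g -> (forall x, 0 <= g x)%E ->
  (\int[mu]_x g x = \int[leb]_x (g x * (f x)%:E))%E.
Proof.
move=> mg g0; set F := Radon_Nikodym_SigmaFinite.f mu leb.
rewrite -(Radon_Nikodym_SigmaFinite.change_of_variables dom)//.
have iF := Radon_Nikodym_SigmaFinite.f_integrable dom.
have mF := measurable_int _ iF.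
have Ff : ae_eq leb setT F (EFin \o f).
  apply: integral_ae_eq => // E _ mE.
  exact: etrans (esym (Radon_Nikodym_SigmaFinite.f_integral dom mE)) (muE mE).
apply: ge0_ae_eq_integral => //.
- exact: emeasurable_funM.
- exact: emeasurable_funM.
- by move=> x _; rewrite mule_ge0// Radon_Nikodym_SigmaFinite.f_ge0.
- by move=> x _; rewrite mule_ge0// lee_fin.
- by apply: filterS Ff => x h /h; rewrite /F/= => ->.
Qed.

Lemma Rintegral_density (g : T -> R) : measurable_fun setT g ->
  \int[mu]_x g x = \int[leb]_x (g x * f x).
Proof.
move=> mg; have mgE : measurable_fun setT (EFin \o g) by exact/measurable_EFinP.
rewrite /Rintegral; congr fine; rewrite integralE [in RHS]integralE.
congr (_ - _)%E; rewrite ge0_integral_density//; try exact: measurable_funepos; try exact: measurable_funeneg.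
  by apply: eq_integral => x _; rewrite !funeposE muleC maxe_pMr ?lee_fin// mule0 -EFinM mulrC.
by apply: eq_integral => x _; rewrite !funenegE muleC maxe_pMr ?lee_fin// mule0 -EFinN -EFinM mulrN mulrC.
Qed.

End integration_against_density.

Section kernel_substitution.
Context {R : realType} {d : nat}.
Local Notation V := 'rV[R]_d.
Local Notation leb := (lebesgue_rV d).

(** The positive and negative parts are transported separately, finite or not; this is why
the factor stays inside the integral. *)
Lemma Rintegral_rV_affine (x : V) (h : R) (g : V -> R) : 0 < h -> measurable_fun setT g ->
  \int[leb]_v g (x - h *: v) = \int[leb]_y (h ^- d * g y).
Proof.
move=> h0 mg; have mgE : measurable_fun setT (EFin \o g) by exact/measurable_EFinP.
have hd0 : 0 <= h ^- d by rewrite invr_ge0 exprn_ge0// ltW.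
rewrite /Rintegral; congr fine; rewrite integralE [in RHS]integralE.
congr (_ - _)%E.
  transitivity (\int[leb]_v (EFin \o g)^\+ (x - h *: v)%R)%E.
    by apply: eq_integral => v _; rewrite !funeposE.
  rewrite ge0_integral_rV_affine//; last exact: measurable_funepos.
  rewrite -ge0_integralZl//; last exact: measurable_funepos.
  by apply: eq_integral => v _; rewrite !funeposE maxe_pMr ?lee_fin// mule0.
transitivity (\int[leb]_v (EFin \o g)^\- (x - h *: v)%R)%E.
  by apply: eq_integral => v _; rewrite !funenegE.
rewrite ge0_integral_rV_affine//; last exact: measurable_funeneg.
rewrite -ge0_integralZl//; last exact: measurable_funeneg.
by apply: eq_integral => v _; rewrite !funenegE maxe_pMr ?lee_fin// mule0 muleN.
Qed.

Lemma kernel_substitution (K G : V -> R) (h : R) (x : V) : 0 < h ->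
  measurable_fun setT K -> measurable_fun setT G ->
  \int[leb]_y (h ^- d * K (h^-1 *: (x - y)) * G y) = \int[leb]_v (K v * G (x - h *: v)).
Proof.
move=> h0 mK mG.
pose g y := K (h^-1 *: (x - y)) * G y.
have hz : h != 0 by rewrite gt_eqF.
have mg : measurable_fun setT g.
  apply: measurable_funM => //; apply: (measurableT_comp mK).
  apply/measurable_fun_rVP => i; under eq_fun do rewrite !mxE.
  apply: measurable_funM => //; apply: measurable_funB => //; exact: measurable_coord.
transitivity (\int[leb]_y (h ^- d * g y)); first by apply: eq_Rintegral => y _; rewrite mulrA.
rewrite -(Rintegral_rV_affine x h0 mg); apply: eq_Rintegral => v _.
by rewrite /g opprB addrCA subrr addr0 scalerA mulVf// scale1r.
Qed.

End kernel_substitution.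

(** * Scaled kernels *)

Section scaled_kernels.
Context {R : realType} {d : nat}.
Local Notation V := 'rV[R]_d.
Local Notation leb := (lebesgue_rV d).
Variables (mu : probability V R) (phi f K : V -> R) (B b F m1 m2 : R).
Hypotheses (mf : measurable_fun setT f) (f_ge0 : forall x, 0 <= f x).
Hypothesis muE : forall A, measurable A -> mu A = (\int[leb]_(x in A) (f x)%:E)%E.
Hypotheses (F_ge0 : 0 <= F) (f_le : forall x, `|f x| <= F).
Hypotheses (b_gt0 : 0 < b) (mphi : measurable_fun setT phi) (phi_le : forall x, `|phi x| <= B).
Hypothesis f_ge : forall x, phi x != 0 -> b <= f x.
Hypotheses (mK : measurable_fun setT K) (m1_gt0 : 0 < m1) (m2_gt0 : 0 < m2).
Hypothesis K_exp : forall x, `|K x| <= m1 * expR (- (m2 * enorm x)).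
Hypothesis K_even : forall x, K x = K (- x).

Definition scaled_kernel (h : R) (x y : V) : R := h ^- d * K (h^-1 *: (x - y)).

Variable h : R.
Hypothesis h_gt0 : 0 < h.
Local Notation k := (scaled_kernel h).
Local Notation psi := (fun x => phi x / f x).

Let K_le x : `|K x| <= m1.
Proof.
apply: le_trans (K_exp x) _; rewrite ler_piMr ?(ltW m1_gt0)// -[leRHS]expR0 ler_expR.
by rewrite oppr_le0 mulr_ge0 ?enorm_ge0// ltW.
Qed.

Let eps_ge0 : 0 <= h ^- d. Proof. by rewrite invr_ge0 exprn_ge0// ltW. Qed.

Definition kernel_size : R := m1 + F * kernel_moment (fun x => `|K x|) 0.

Let absK_exp x : `| `|K x| | <= m1 * expR (- (m2 * enorm x)). Proof. by rewrite normr_id. Qed.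

Let mabsK : measurable_fun setT (fun x => `|K x|). Proof. exact: measurableT_comp. Qed.

Let moment_ge0 : 0 <= F * kernel_moment (fun x => `|K x|) 0.
Proof. by rewrite mulr_ge0// (kernel_moment_ge0 (fun x => `|K x|) 0). Qed.

Lemma kernel_size_ge0 : 0 <= kernel_size.
Proof. by rewrite addr_ge0// ltW. Qed.

Lemma scaled_kernel_sym x y : k x y = k y x.
Proof. by rewrite /scaled_kernel K_even -scalerN opprB. Qed.

Lemma scaled_kernel_le x y : `|k x y| <= kernel_size / h ^+ d.
Proof.
rewrite normrM ger0_norm// mulrC ler_wpM2r//.
by apply: le_trans (K_le _) _; rewrite lerDl.
Qed.

Lemma bounded_scaled_kernel : bounded_measurable (fun z : V * V => k z.1 z.2).
Proof.
split; last by exists (kernel_size / h ^+ d) => z; exact: scaled_kernel_le.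
apply: measurable_funM => //; apply: (measurableT_comp mK).
apply/measurable_fun_rVP => i; under eq_fun do rewrite !mxE.
apply: measurable_funM => //; apply: measurable_funB.
  exact: measurableT_comp (measurable_coord i) measurable_fst.
exact: measurableT_comp (measurable_coord i) measurable_snd.
Qed.

Let mkx x : measurable_fun setT (k x).
Proof. by case: (bounded_measurable_sectl bounded_scaled_kernel x). Qed.

Let mshift (x : V) : measurable_fun setT (fun v : V => x - h *: v).
Proof.
apply/measurable_fun_rVP => i; under eq_fun do rewrite !mxE.
by apply: measurable_funB => //; apply: measurable_funM => //; exact: measurable_coord.
Qed.

Lemma scaled_kernel_int x : \int[mu]_y `|k x y| <= kernel_size.
Proof.
have mnk : measurable_fun setT (fun y => `|k x y|) by exact: measurableT_comp.
rewrite (Rintegral_density mf f_ge0 muE mnk).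
have -> : \int[leb]_y (`|k x y| * f y) = \int[leb]_y (h ^- d * `|K (h^-1 *: (x - y))| * f y).
  by apply: eq_Rintegral => y _; rewrite normrM ger0_norm.
rewrite (kernel_substitution x h_gt0 mabsK mf); apply: le_trans (ler_norm _) _.
apply: (@le_trans _ _ (F * kernel_moment (fun x => `|K x|) 0)); last by rewrite lerDr ltW.
apply: (norm_integral_kernelM mabsK m2_gt0 absK_exp).
  exact: (measurableT_comp mf (mshift x)).
by move=> v; rewrite expr0 mulr1.
Qed.

Lemma kernel_mean_density x : kernel_mean mu k x = \int[leb]_v (K v * f (x - h *: v)).
Proof.
rewrite /kernel_mean (Rintegral_density mf f_ge0 muE (mkx x)).
exact: (kernel_substitution x h_gt0 mK mf).
Qed.

Let mpsi : measurable_fun setT psi.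
Proof. by apply: measurable_funM => //; exact: measurable_funV. Qed.

Let weight_density p x : weight phi f p.+1 x * f x = weight phi f p x.
Proof.
rewrite /weight; have [->|p0] := eqVneq (phi x) 0; first by rewrite !mul0r.
have f0 := lt_le_trans b_gt0 (f_ge p0); rewrite exprS; field.
by rewrite expf_eq0 gt_eqF// andbF.
Qed.

Lemma target_density : target mu phi f = \int[leb]_x phi x.
Proof.
have mw : measurable_fun setT (weight phi f 1).
  by rewrite (_ : weight phi f 1 = psi).
rewrite /target (Rintegral_density mf f_ge0 muE mw); apply: eq_Rintegral => x _.
by rewrite weight_density /weight expr0 divr1.
Qed.

(** Evenness of [K] is used here: the smoothing in the first variable of the kernel becomes
a smoothing of [phi / f] by [K] itself. *)
Lemma smoothed_weight_density y : smoothed_weight mu k phi f y =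
  \int[leb]_v (K v * (phi (y - h *: v) / f (y - h *: v))).
Proof.
have mw : measurable_fun setT (fun x => weight phi f 2 x * k x y).
  apply: measurable_funM; last by under eq_fun do rewrite scaled_kernel_sym; exact: mkx.
  by apply: measurable_funM => //; apply: measurable_funV; exact: measurable_funX.
rewrite /smoothed_weight (Rintegral_density mf f_ge0 muE mw).
rewrite -(kernel_substitution y h_gt0 mK mpsi); apply: eq_Rintegral => x _.
by rewrite mulrAC weight_density scaled_kernel_sym mulrC /weight expr1.
Qed.

Lemma smoothing_defect_density (D : R) :
  (\int[leb]_x ((psi x - \int[leb]_v (K v * (phi (x - h *: v) / f (x - h *: v)))) ^+ 2)%:E <= D%:E)%E ->
  \int[mu]_y ((weight phi f 1 y - smoothed_weight mu k phi f y) ^+ 2) <= F * D.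
Proof.
move=> hD; set g := fun y => _ in hD.
have bphi : bounded_measurable phi by split => //; exists B.
have bf : bounded_measurable f by split => //; exists F.
have bk := bounded_scaled_kernel.
have bw p := @bounded_weight _ _ _ _ _ _ _ b_gt0 bphi phi_le bf f_ge p.
have bsw : bounded_measurable (smoothed_weight mu k phi f).
  apply: (@bounded_measurable_expect _ _ _ _ _ mu (fun z : V * V => weight phi f 2 z.2 * k z.2 z.1)).
  apply: bounded_measurableM; first exact: bounded_measurable_comp (bw 2) measurable_snd.
  apply: (bounded_measurable_comp (F := fun z : V * V => k z.1 z.2) bk (g := fun z : V * V => (z.2, z.1))).
  by apply/measurable_fun_pairP; split; [exact: measurable_snd|exact: measurable_fst].
have bD := bounded_measurableX 2 (bounded_measurableB (bw 1) bsw).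
rewrite -lee_fin -(EFin_expect _ bD) (ge0_integral_density mf f_ge0 muE).
- rewrite EFinM; apply: (@le_trans _ _ (F%:E * \int[leb]_x ((weight phi f 1 x - smoothed_weight mu k phi f x) ^+ 2)%:E)%E).
    rewrite -ge0_integralZl//.
    + apply: ge0_le_integral => //.
      * by move=> x _; rewrite mule_ge0 ?lee_fin ?sqr_ge0.
      * by apply: emeasurable_funM; apply/measurable_EFinP => //; case: bD.
      * by apply: emeasurable_funM => //; apply/measurable_EFinP; case: bD.
      * move=> x _; rewrite muleC lee_wpmul2r ?lee_fin ?sqr_ge0//.
        exact: le_trans (ler_norm _) (f_le x).
    + by apply/measurable_EFinP; case: bD.
    + by move=> x _; rewrite lee_fin sqr_ge0.
  rewrite lee_wpmul2l ?lee_fin//; apply: le_trans hD.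
  rewrite le_eqVlt; apply/orP; left; apply/eqP; apply: eq_integral => x _.
  by rewrite smoothed_weight_density /weight expr1.
- by apply/measurable_EFinP; case: bD.
- by move=> x; rewrite lee_fin sqr_ge0.
Qed.

End scaled_kernels.

(** * Tail bounds in terms of the rates *)

Lemma sqrt_le_add3 (R : rcfType) (x a b c : R) : 0 <= a -> 0 <= b -> 0 <= c ->
  x <= a ^+ 2 + b ^+ 2 + c ^+ 2 -> Num.sqrt x <= a + b + c.
Proof.
move=> a0 b0 c0 h; have s0 : 0 <= a + b + c by rewrite !addr_ge0.
rewrite -[leRHS]ger0_norm// -sqrtr_sqr ler_wsqrtr//; apply: le_trans h _.
have := mulr_ge0 a0 b0; have := mulr_ge0 a0 c0; have := mulr_ge0 b0 c0; lra.
Qed.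

(** Rescaling of a Markov bound at a threshold proportional to the rate [rho]. *)
Lemma threshold_bound (R : realFieldType) (a rho M x y Y Z : R) : 0 < a -> 0 < rho -> 0 < M ->
  x <= y -> a * Y <= Z * rho -> x + (M * rho / a)^-1 * Y <= y + Z / M.
Proof.
move=> a0 r0 M0 xy YZ; apply: lerD => //.
rewrite (_ : (M * rho / a)^-1 * Y = a * Y / (M * rho)); last by field; rewrite !gt_eqF.
by rewrite ler_pdivrMr ?mulr_gt0// mulrA mulfVK// gt_eqF.
Qed.

Section sample_tails.
Context {R : realType} {d n : nat}.
Local Notation V := 'rV[R]_d.
Local Notation leb := (lebesgue_rV d).
Variables (mu : probability V R) (nu : probability (n.-tuple V) R).
Hypothesis nu_res : resampling mu nu.
Variables (phi f K : V -> R) (B b F m1 m2 : R).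
Hypotheses (mf : measurable_fun setT f) (f_ge0 : forall x, 0 <= f x).
Hypothesis muE : forall A, measurable A -> mu A = (\int[leb]_(x in A) (f x)%:E)%E.
Hypotheses (F_ge0 : 0 <= F) (f_le : forall x, `|f x| <= F).
Hypotheses (b_gt0 : 0 < b) (mphi : measurable_fun setT phi) (B_ge0 : 0 <= B) (phi_le : forall x, `|phi x| <= B).
Hypothesis f_ge : forall x, phi x != 0 -> b <= f x.
Hypotheses (mK : measurable_fun setT K) (m1_gt0 : 0 < m1) (m2_gt0 : 0 < m2).
Hypothesis K_exp : forall x, `|K x| <= m1 * expR (- (m2 * enorm x)).
Hypothesis K_even : forall x, K x = K (- x).
Variables (h : R) (r : nat) (s C1 C2 : R).
Hypotheses (n_ge3 : (3 <= n)%N) (h_gt0 : 0 < h) (h_le1 : h <= 1).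
Hypotheses (C1_ge0 : 0 <= C1) (C2_ge0 : 0 <= C2).
Hypothesis smoothing_le :
  (\int[leb]_x ((phi x / f x - \int[leb]_v (K v * (phi (x - h *: v) / f (x - h *: v)))) ^+ 2)%:E
   <= (C1 * (h `^ s + h ^+ r) ^+ 2)%:E)%E.
Hypothesis bias_le : forall x, `|\int[leb]_v (K v * f (x - h *: v)) - f x| <= C2 * h ^+ r.
Local Notation beta := (C2 * h ^+ r).
Hypotheses (beta_le : beta <= b / 4) (beta_le1 : beta <= 1).
Local Notation k := (scaled_kernel K h).
Local Notation A := (kernel_size K F m1).
Local Notation eps := (h ^+ d).
Local Notation m := (n%:R - 1 : R).
Let a : R := Num.sqrt n%:R.
Let e : R := Num.sqrt eps.
Hypothesis ae_ge2 : 2 <= a * e.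

Let bf : bounded_measurable f. Proof. by split => //; exists F. Qed.
Let bphi : bounded_measurable phi. Proof. by split => //; exists B. Qed.
Let bk : bounded_measurable (fun z : V * V => k z.1 z.2).
Proof. exact: (bounded_scaled_kernel F_ge0 mK m1_gt0 m2_gt0 K_exp h_gt0). Qed.
Let k_sup x y : `|k x y| <= A / eps.
Proof. exact: (scaled_kernel_le F_ge0 m1_gt0 m2_gt0 K_exp h_gt0). Qed.
Let k_int x : \int[mu]_y `|k x y| <= A.
Proof. exact: (scaled_kernel_int mf f_ge0 muE F_ge0 f_le mK m1_gt0 m2_gt0 K_exp h_gt0). Qed.
Let k_sym x y : k x y = k y x. Proof. exact: scaled_kernel_sym. Qed.
Let A_ge0 : 0 <= A. Proof. exact: kernel_size_ge0. Qed.
Let k_bias x : `|kernel_mean mu k x - f x| <= beta.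
Proof.
rewrite (kernel_mean_density mf f_ge0 muE F_ge0 mK m1_gt0 m2_gt0 K_exp h_gt0).
exact: bias_le.
Qed.
Let eps_gt0 : 0 < eps. Proof. exact: exprn_gt0. Qed.
Let eps_le1 : eps <= 1. Proof. by rewrite exprn_ile1// ltW. Qed.
Let a_ge1 : 1 <= a. Proof. by rewrite -[leLHS]sqrtr1 ler_wsqrtr// ler1n (leq_trans _ n_ge3). Qed.
Let a_gt0 : 0 < a. Proof. exact: lt_le_trans a_ge1. Qed.
Let e_gt0 : 0 < e. Proof. by rewrite sqrtr_gt0. Qed.
Let e_le1 : e <= 1. Proof. by rewrite -[leRHS]sqrtr1 ler_wsqrtr. Qed.
Let a2 : a ^+ 2 = n%:R. Proof. by rewrite sqr_sqrtr. Qed.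
Let e2 : e ^+ 2 = eps. Proof. by rewrite sqr_sqrtr// ltW. Qed.
Let n3 : 3 <= n%:R :> R. Proof. by rewrite ler_nat. Qed.
Let m_ge : a ^+ 2 / 2 <= m. Proof. by rewrite a2; have := n3; lra. Qed.
Let m_gt0 : 0 < m. Proof. by have := n3; lra. Qed.
Let m_eps : 1 <= m * eps.
Proof.
apply: (@le_trans _ _ (a ^+ 2 / 2 * e ^+ 2)); last by rewrite e2 ler_wpM2r// ltW.
have : 2 ^+ 2 <= (a * e) ^+ 2 by rewrite lerXn2r ?nnegrE ?mulr_ge0 ?(ltW a_gt0) ?(ltW e_gt0)//.
rewrite exprMn; move: (a ^+ 2) (e ^+ 2) => x y; lra.
Qed.
Let beta_ge0 : 0 <= beta. Proof. by rewrite mulr_ge0// exprn_ge0// ltW. Qed.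

Local Notation u := (h `^ s + h ^+ r).
Local Notation q := (B / b ^+ 2).
Local Notation Lc := (linear_const A B b).
Let Lc_ge0 : 0 <= Lc. Proof. by rewrite /linear_const; nonneg. Qed.
Let q_ge0 : 0 <= q. Proof. by rewrite divr_ge0// exprn_ge0// ltW. Qed.
Let u_ge0 : 0 <= u. Proof. by rewrite addr_ge0 ?powR_ge0// exprn_ge0// ltW. Qed.
Let mV : m^-1 <= 2 / a ^+ 2.
Proof. by rewrite -[leRHS]invrK lef_pV2 ?posrE ?invr_gt0 ?divr_gt0 ?exprn_gt0// invf_div. Qed.
Let aV_ge0 : 0 <= a^-1. Proof. by rewrite invr_ge0 ltW. Qed.
Let eV_ge0 : 0 <= e^-1. Proof. by rewrite invr_ge0 ltW. Qed.

(** The square root of [expect_sqr_linear_term], in terms of [a = sqrt n] and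
[e = h^(d/2)]: bias, smoothing error and degenerate part. *)
Lemma expect_linear_term : \int[nu]_t `|linear_term mu k phi f t| <=
  7 * q * beta + 3 * Num.sqrt (F * C1) * u / a + 28 * Num.sqrt Lc / (a ^+ 2 * e).
Proof.
have bL : bounded_measurable (fun t : n.-tuple V => linear_term mu k phi f t).
  exact: (@bounded_linear_term _ _ _ _ _ _ bk _ _ _ _ b_gt0 bphi phi_le bf f_ge).
apply: le_trans (expect_norm_le_sqrt _ bL) _; apply: sqrt_le_add3.
- by nonneg.
- by rewrite !mulr_ge0 ?sqrtr_ge0.
- by rewrite !mulr_ge0 ?sqrtr_ge0// invr_ge0 mulr_ge0 ?exprn_ge0// ltW.
have dlt := smoothing_defect_density mf f_ge0 muE F_ge0 f_le b_gt0 mphi phi_le f_ge mK m1_gt0 m2_gt0 K_exp K_even h_gt0 smoothing_le.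
apply: le_trans (expect_sqr_linear_term nu_res n_ge3 eps_gt0 eps_le1 A_ge0 bk k_sup k_int
  b_gt0 bphi phi_le bf f_ge k_bias dlt) _.
rewrite [leLHS](_ : _ = 3 * (q * beta) ^+ 2 + 45 * (q * beta) ^+ 2 * a^-1 ^+ 2 + 9 * (F * C1 * u ^+ 2) * a^-1 ^+ 2
   + 192 * Lc * (m^-1 ^+ 2 * e^-1 ^+ 2)); last first.
  rewrite -a2 -e2; field.
  by rewrite a2 !gt_eqF.
rewrite [leRHS](_ : _ = 49 * (q * beta) ^+ 2 + 9 * (Num.sqrt (F * C1) ^+ 2 * u ^+ 2) * a^-1 ^+ 2
   + 196 * Num.sqrt Lc ^+ 2 * ((2 / a ^+ 2) ^+ 2 * e^-1 ^+ 2)); last first.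
  by field; rewrite !gt_eqF.
rewrite (sqr_sqrtr Lc_ge0) (sqr_sqrtr (mulr_ge0 F_ge0 C1_ge0)); apply: lerD; first apply: lerD => //.
  have : a^-1 ^+ 2 <= 1 by rewrite expr_le1// invf_le1.
  by have := sqr_ge0 (q * beta); move: ((q * beta) ^+ 2) (a^-1 ^+ 2) => x y x0 y1; nra.
have mV0 : 0 <= m^-1 by rewrite invr_ge0 ltW.
apply: ler_pM.
- exact: (mulr_ge0 (ler0n _ 192) Lc_ge0).
- exact: (mulr_ge0 (sqr_ge0 _) (sqr_ge0 _)).
- by rewrite ler_wpM2r// ler_nat.
- by rewrite ler_wpM2r ?sqr_ge0// lerXn2r// nnegrE (le_trans mV0).
Qed.

(** The triple part is of order [1 / (a ^+ 3 * e ^+ 2)], which is at most the pair part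
[1 / (a ^+ 2 * e)] since there are many sample points per window. *)
Lemma expect_quadratic_term : \int[nu]_t `|quadratic_term (centered mu k) (weight phi f 3) t| <=
  89 * (B / b ^+ 3) * (2 * A) ^+ 2 / (a ^+ 2 * e).
Proof.
have bZ := bounded_centered mu bk.
have bw := bounded_weight b_gt0 bphi phi_le bf f_ge 3.
have W0 : 0 <= B / b ^+ 3 by rewrite divr_ge0// exprn_ge0// ltW.
have C0 : 0 <= 2 * A by rewrite mulr_ge0.
apply: le_trans (expect_norm_le_sqrt _ (bounded_quadratic_term n bZ bw)) _.
have L0 : 0 <= 89 * (B / b ^+ 3) * (2 * A) ^+ 2 / (a ^+ 2 * e).
  apply: divr_ge0; first by apply: mulr_ge0; [exact: mulr_ge0|exact: sqr_ge0].
  by apply: mulr_ge0; [exact: sqr_ge0|exact: ltW].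
rewrite -[leRHS](ger0_norm L0).
rewrite -sqrtr_sqr; apply: ler_wsqrtr.
have z1 x : \int[mu]_y centered mu k x y = 0 by exact: centered_mean0 bk x.
have z2 x y : `|centered mu k x y| <= 2 * A / eps by exact: (centered_sup eps_gt0).
have z3 x : \int[mu]_y `|centered mu k x y| <= 2 * A by exact: centered_intl bk k_int x.
have z4 y : \int[mu]_x `|centered mu k x y| <= 2 * A by exact: centered_intr bk k_int k_sym y.
have z5 x : \int[mu]_y (centered mu k x y ^+ 2) <= (2 * A) ^+ 2 / eps by exact: (centered_sqr eps_gt0).
have wle := weight_le b_gt0 phi_le f_ge 3.
apply: le_trans (expect_sqr_quadratic_term nu_res eps_gt0 eps_le1 C0 W0 bZ z1 z2 z3 z4 z5 bw wle n_ge3) _.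
rewrite [leRHS](_ : _ = (B / b ^+ 3) ^+ 2 * (2 * A) ^+ 4 * (7921 * (a ^- 2 * e^-1) ^+ 2)); last first.
  by field; rewrite !gt_eqF.
apply: ler_wpM2l; first by apply: mulr_ge0; [exact: sqr_ge0|exact: exprn_ge0].
have mE : n.-1%:R = m by rewrite -subn1 natrB// (leq_trans _ n_ge3).
have m1E : n.-2%:R = n%:R - 2 :> R by rewrite -subn2 natrB// (leq_trans _ n_ge3).
have m1_gt : 0 < n%:R - 2 :> R by have := n3; lra.
have m1V : (n%:R - 2)^-1 <= 3 / a ^+ 2.
  rewrite -[leRHS]invrK lef_pV2 ?posrE ?invr_gt0 ?divr_gt0 ?exprn_gt0// invf_div a2.
  by have := n3; lra.
rewrite mE m1E.
rewrite [leLHS](_ : _ = 216 * a ^+ 2 * (m^-1 * (n%:R - 2)^-1 * e^-1 ^+ 2) ^+ 2 + 8 * (m^-1 * e^-1) ^+ 2); last first.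
  by rewrite -{1}a2 -e2; field; rewrite !gt_eqF.
have p0 : 0 <= m^-1 by rewrite invr_ge0 ltW.
have p1 : 0 <= (n%:R - 2)^-1 :> R by rewrite invr_ge0 ltW.
have q0 : 0 <= 2 / a ^+ 2 by rewrite divr_ge0// sqr_ge0.
apply: (@le_trans _ _ (216 * a ^+ 2 * (2 / a ^+ 2 * (3 / a ^+ 2) * e^-1 ^+ 2) ^+ 2 + 8 * (2 / a ^+ 2 * e^-1) ^+ 2)).
  have c0 : 0 <= 216 * a ^+ 2 := mulr_ge0 (ler0n _ 216) (sqr_ge0 a).
  have sq (x y : R) : 0 <= x -> x <= y -> x ^+ 2 <= y ^+ 2.
    by move=> x0 xy; rewrite lerXn2r// nnegrE (le_trans x0).
  apply: lerD.
    apply: (ler_wpM2l c0); apply: sq; first exact: (mulr_ge0 (mulr_ge0 p0 p1) (sqr_ge0 _)).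
    exact: (ler_wpM2r (sqr_ge0 _) (ler_pM p0 p1 mV m1V)).
  apply: (ler_wpM2l (ler0n _ 8)); apply: sq; first exact: mulr_ge0.
  exact: (ler_wpM2r eV_ge0 mV).
have h1 : (a^-1 * e^-1) ^+ 2 <= 1.
  rewrite expr_le1 ?mulr_ge0// -invfM invf_le1 ?mulr_gt0//; last by rewrite mulrC; have := ae_ge2; lra.
rewrite [leLHS](_ : _ = (7776 * (a^-1 * e^-1) ^+ 2 + 32) * (a ^- 2 * e^-1) ^+ 2); last first.
  by field; rewrite !gt_eqF.
rewrite ler_wpM2r ?sqr_ge0//; lra.
Qed.

Local Notation tau := (Num.sqrt (m * eps)).
Local Notation fc := (fluctuation_const A).
Local Notation sc := (sum_sqr_const A).

Let tau_gt0 : 0 < tau. Proof. by rewrite sqrtr_gt0 (lt_le_trans ltr01). Qed.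

(* The factor [2] absorbs the difference between [n - 1] and [n]. *)
Let tauV : tau^-1 <= 2 / (a * e).
Proof.
have h0 : 0 < a * e / 2 by rewrite divr_gt0// mulr_gt0.
rewrite -[leRHS]invrK lef_pV2 ?posrE ?invr_gt0 ?divr_gt0 ?mulr_gt0// invf_div.
rewrite -[leLHS](ger0_norm (ltW h0)) -sqrtr_sqr ler_wsqrtr// -e2.
apply: le_trans (ler_wpM2r (sqr_ge0 e) m_ge).
rewrite (_ : (a * e / 2) ^+ 2 = (a ^+ 2 / 2 * e ^+ 2) / 2); last by field.
by rewrite ler_pdivrMr// ler_peMr ?ler1n// mulr_ge0 ?sqr_ge0// divr_ge0 ?sqr_ge0.
Qed.

Let tauVX p : tau^-1 ^+ p <= (2 / (a * e)) ^+ p.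
Proof.
have t0 : 0 <= tau^-1 by rewrite invr_ge0 ltW.
by rewrite lerXn2r// nnegrE (le_trans t0).
Qed.

Definition failure_const : R := 64 * ((4 / b) ^+ 6 * (2 * 6 ^+ 6 * fc)).

Let fc_ge0 : 0 <= fc. Proof. exact: expR_ge0. Qed.
Let sc_ge0 : 0 <= sc. Proof. exact: expR_ge0. Qed.

(* [64 = 2 ^ 6] comes from [tauV]. *)
Let failure_le : (4 / b) ^+ 6 * (2 * 6 ^+ 6 * fc) * (n%:R / tau ^+ 6) <=
  failure_const * (a^-1 ^+ 4 * e^-1 ^+ 6).
Proof.
have c0 : 0 <= (4 / b) ^+ 6 * (2 * 6 ^+ 6 * fc).
  apply: mulr_ge0; first by apply: exprn_ge0; rewrite divr_ge0// ltW.
  by apply: mulr_ge0 => //; apply: mulr_ge0 => //; exact: exprn_ge0.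
rewrite /failure_const (mulrC 64) -(mulrA (_ * _) 64); apply: (ler_wpM2l c0).
rewrite -exprVn -[X in X * _]a2; apply: le_trans (ler_wpM2l (sqr_ge0 a) (tauVX 6)) _.
by rewrite le_eqVlt; apply/orP; left; apply/eqP; field; rewrite !gt_eqF.
Qed.

Let beta2 : beta ^+ 2 <= beta. Proof. by rewrite expr2 ler_piMl. Qed.

Let h_pow : 0 <= h `^ s. Proof. exact: powR_ge0. Qed.
Let h_powr : 0 <= h ^+ r. Proof. by rewrite exprn_ge0// ltW. Qed.
Let ah_powr : h ^+ r <= a * h ^+ r. Proof. by rewrite ler_peMl. Qed.

Let scaled_linear (rho : R) : u <= rho -> a * h ^+ r <= rho -> (a * e)^-1 <= rho ->
  a * (7 * q * beta + 3 * Num.sqrt (F * C1) * u / a + 28 * Num.sqrt Lc / (a ^+ 2 * e)) <=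
  (7 * q * C2 + 3 * Num.sqrt (F * C1) + 28 * Num.sqrt Lc) * rho.
Proof.
move=> h1 h2 h3.
rewrite [leLHS](_ : _ = 7 * q * C2 * (a * h ^+ r) + 3 * Num.sqrt (F * C1) * u
  + 28 * Num.sqrt Lc * (a * e)^-1); last by field; rewrite !gt_eqF.
rewrite 2!(mulrDl _ _ rho); apply: lerD; first apply: lerD; apply: ler_wpM2l => //.
by apply: mulr_ge0 => //; exact: mulr_ge0.
Qed.

Section tails.
Variable M : R.
Hypothesis M_gt0 : 0 < M.

Local Notation lin_const := (7 * q * C2 + 3 * Num.sqrt (F * C1) + 28 * Num.sqrt Lc).

Let lin_const_ge0 : 0 <= lin_const.
Proof.
apply: addr_ge0; first apply: addr_ge0.
- by apply: mulr_ge0 => //; exact: mulr_ge0.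
- by rewrite mulr_ge0 ?sqrtr_ge0.
- by rewrite mulr_ge0 ?sqrtr_ge0.
Qed.

Definition plain_const : R := lin_const + 4 * B / b ^+ 3 * (32 * fc + C2).

Definition plain_rate : R := h `^ s + a * h ^+ r + (a * e ^+ 2)^-1.

Lemma plain_sample_tail :
  (nu [set t | (M * plain_rate < a * `|plain_estimate k phi t - \int[leb]_x phi x|)%R] <=
   (failure_const * plain_rate ^+ 3 + plain_const / M)%:E)%E.
Proof.
set rho := plain_rate.
have p0 : 0 < (a * e ^+ 2)^-1 by rewrite invr_gt0 mulr_gt0// exprn_gt0.
have rho0 : 0 < rho by rewrite ltr_wpDl// addr_ge0// mulr_ge0// ltW.
have h1 : u <= rho by rewrite /rho /plain_rate -addrA lerD2l (le_trans ah_powr)// lerDl ltW.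
have h2 : a * h ^+ r <= rho by rewrite /rho /plain_rate addrAC lerDr addr_ge0// ltW.
have h3 : (a * e ^+ 2)^-1 <= rho by rewrite lerDr addr_ge0// mulr_ge0// ltW.
have h4 : (a * e)^-1 <= rho.
  apply: le_trans h3; rewrite lef_pV2 ?posrE ?mulr_gt0 ?exprn_gt0//.
  by rewrite ler_wpM2l ?(ltW a_gt0)// expr2 ler_piMl// ltW.
have c0 : 0 < M * rho / a by rewrite divr_gt0// mulr_gt0.
have -> : [set t : n.-tuple V | (M * rho < a * `|plain_estimate k phi t - \int[leb]_x phi x|)%R] =
    [set t : n.-tuple V | (M * rho / a < `|plain_estimate k phi t - target mu phi f|)%R].
  rewrite (target_density mf f_ge0 muE b_gt0 mphi f_ge).
  by apply/seteqP; split=> t /=; rewrite ltr_pdivrMr// (mulrC a).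
apply: le_trans (plain_estimate_tail nu_res n_ge3 eps_gt0 eps_le1 A_ge0 bk k_sup k_int m_eps
  b_gt0 B_ge0 bphi phi_le bf f_ge k_bias beta_le expect_linear_term c0) _.
rewrite lee_fin; apply: threshold_bound => //.
  apply: le_trans failure_le _; apply: ler_wpM2l.
    apply: mulr_ge0 => //; apply: mulr_ge0; first by apply: exprn_ge0; rewrite divr_ge0// ltW.
    by apply: mulr_ge0 => //; apply: mulr_ge0 => //; exact: exprn_ge0.
  apply: (@le_trans _ _ ((a * e ^+ 2)^-1 ^+ 3)).
    rewrite [leLHS](_ : _ = (a * e ^+ 2)^-1 ^+ 3 * a^-1); last by field; rewrite !gt_eqF.
    by rewrite ler_piMr ?invf_le1// exprn_ge0// ltW.
  by rewrite lerXn2r// nnegrE ltW.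
rewrite mulrDr /plain_const (mulrDl lin_const); apply: lerD; first exact: scaled_linear.
have D0 : 0 <= 4 * B / b ^+ 3 by rewrite divr_ge0 ?mulr_ge0 ?exprn_ge0// ltW.
rewrite mulrCA -[leRHS]mulrA; apply: (ler_wpM2l D0); rewrite (mulrDr a) (mulrDl (32 * fc)); apply: lerD.
  rewrite -exprVn; apply: (@le_trans _ _ (32 * fc * (a * e ^+ 2)^-1)); last by rewrite ler_wpM2l// mulr_ge0.
  rewrite mulrA; apply: le_trans (ler_wpM2l _ (tauVX 2)) _.
    by apply: mulr_ge0; [exact: ltW|exact: mulr_ge0].
  by rewrite le_eqVlt; apply/orP; left; apply/eqP; field; rewrite !gt_eqF.
apply: le_trans (ler_wpM2l (ltW a_gt0) beta2) _.
by rewrite mulrCA ler_wpM2l.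
Qed.

Definition corrected_const : R := lin_const + 89 * (B / b ^+ 3) * (2 * A) ^+ 2 +
  (2 * B / b ^+ 3 + 14 * B / b ^+ 4) * ((3 + 58 * fc + 16 * sc) * (C2 + 8)).

Definition corrected_rate : R := h `^ s + a * h ^+ r + (a * e)^-1 + (a ^+ 2 * e ^+ 3)^-1.

Lemma corrected_sample_tail :
  (nu [set t | (M * corrected_rate < a * `|corrected_estimate k phi t - \int[leb]_x phi x|)%R] <=
   (failure_const * corrected_rate ^+ 2 + corrected_const / M)%:E)%E.
Proof.
set rho := corrected_rate.
have p0 : 0 < (a * e)^-1 by rewrite invr_gt0 mulr_gt0.
have p1 : 0 < (a ^+ 2 * e ^+ 3)^-1 by rewrite invr_gt0 mulr_gt0// exprn_gt0.
have p2 : 0 <= a * h ^+ r by rewrite mulr_ge0// ltW.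
have rho0 : 0 < rho by rewrite ltr_wpDl// !addr_ge0// ltW.
have h1 : u <= rho by rewrite /rho /corrected_rate -!addrA lerD2l (le_trans ah_powr)// lerDl addr_ge0// ltW.
have h2 : a * h ^+ r <= rho by rewrite /rho /corrected_rate -addrA addrAC lerDr !addr_ge0// ltW.
have h3 : (a ^+ 2 * e ^+ 3)^-1 <= rho by rewrite lerDr !addr_ge0// ltW.
have h4 : (a * e)^-1 <= rho by rewrite /rho /corrected_rate addrAC lerDr !addr_ge0// ltW.
have c0 : 0 < M * rho / a by rewrite divr_gt0// mulr_gt0.
have -> : [set t : n.-tuple V | (M * rho < a * `|corrected_estimate k phi t - \int[leb]_x phi x|)%R] =
    [set t : n.-tuple V | (M * rho / a < `|corrected_estimate k phi t - target mu phi f|)%R].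
  rewrite (target_density mf f_ge0 muE b_gt0 mphi f_ge).
  by apply/seteqP; split=> t /=; rewrite ltr_pdivrMr// (mulrC a).
apply: le_trans (corrected_estimate_tail nu_res n_ge3 eps_gt0 eps_le1 A_ge0 bk k_sup k_int m_eps
  b_gt0 B_ge0 bphi phi_le bf f_ge k_bias beta_ge0 beta_le expect_linear_term expect_quadratic_term c0 beta_le1) _.
rewrite lee_fin; apply: threshold_bound => //.
  apply: le_trans failure_le _; apply: ler_wpM2l.
    apply: mulr_ge0 => //; apply: mulr_ge0; first by apply: exprn_ge0; rewrite divr_ge0// ltW.
    by apply: mulr_ge0 => //; apply: mulr_ge0 => //; exact: exprn_ge0.
  rewrite [leLHS](_ : _ = (a ^+ 2 * e ^+ 3)^-1 ^+ 2); last by field; rewrite !gt_eqF.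
  by rewrite lerXn2r// nnegrE ltW.
rewrite 2!(mulrDr a) /corrected_const 2!(mulrDl _ _ rho); apply: lerD; first apply: lerD.
- exact: scaled_linear.
- rewrite [leLHS](_ : _ = 89 * (B / b ^+ 3) * (2 * A) ^+ 2 * (a * e)^-1); last by field; rewrite !gt_eqF.
  apply: ler_wpM2l => //; apply: mulr_ge0; last exact: sqr_ge0.
  by apply: mulr_ge0 => //; apply: divr_ge0 => //; rewrite exprn_ge0// ltW.
have D0 : 0 <= 2 * B / b ^+ 3 + 14 * B / b ^+ 4.
  by apply: addr_ge0; apply: divr_ge0; rewrite ?exprn_ge0 ?mulr_ge0// ltW.
have K0 : 0 <= 3 + 58 * fc + 16 * sc.
  exact: (addr_ge0 (addr_ge0 (ler0n _ 3) (mulr_ge0 (ler0n _ 58) fc_ge0)) (mulr_ge0 (ler0n _ 16) sc_ge0)).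
rewrite mulrCA -[leRHS]mulrA; apply: (ler_wpM2l D0).
rewrite mulrCA -[leRHS]mulrA; apply: (ler_wpM2l K0).
rewrite (mulrDr a) (mulrDl C2); apply: lerD; first by rewrite mulrCA ler_wpM2l.
apply: le_trans (ler_wpM2l (ltW a_gt0) (tauVX 3)) _.
rewrite [leLHS](_ : _ = 8 * (a ^+ 2 * e ^+ 3)^-1); last by field; rewrite !gt_eqF.
by rewrite ler_wpM2l.
Qed.

End tails.
End sample_tails.

(** * Rates, bandwidths and boundedness in probability *)

(** The failure probability [c1 * rate n ^+ p] vanishes with the rate, and the Markov part
[c2 / M] is small when [M] is large. *)
Lemma bounded_in_probability_of_tail d (Omega : measurableType d) (R : realType)
    (P : probability Omega R) (Z : nat -> Omega -> R) (rate : nat -> R) (p : nat) (c1 c2 rho : R) :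
  (0 < p)%N -> 0 <= c1 -> 0 <= c2 -> 0 < rho -> (forall n, 0 <= rate n) ->
  rate n @[n --> \oo] --> (0 : R) ->
  (forall M : R, 0 < M -> \forall n \near \oo, rate n <= rho ->
    (P [set w | (M * rate n < `|Z n w|)%R] <= (c1 * rate n ^+ p + c2 / M)%:E)%E) ->
  bounded_in_probability P Z rate.
Proof.
move=> p0 c10 c20 rho0 rate0 rateC tail eps eps0.
pose M := 2 * (c2 + 1) / eps.
have c21 : 0 < c2 + 1 by rewrite ltr_wpDl.
have M0 : 0 < M by rewrite divr_gt0// mulr_gt0.
exists M => //.
pose del := eps / (2 * (c1 + 1)).
have c11 : 0 < c1 + 1 by rewrite ltr_wpDl.
have del0 : 0 < del by rewrite divr_gt0// mulr_gt0.
have n1 : \forall n \near \oo, `|rate n| <= rho by exact: cvgr0_norm_le.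
have n2 : \forall n \near \oo, `|rate n| <= 1 by exact: cvgr0_norm_le.
have n3 : \forall n \near \oo, `|rate n| <= del by exact: cvgr0_norm_le.
have n4 := tail M M0.
near=> n.
have r1 : `|rate n| <= rho by near: n.
have r2 : `|rate n| <= 1 by near: n.
have r3 : `|rate n| <= del by near: n.
rewrite ger0_norm// in r1 r2 r3 *.
have : rate n <= rho -> (P [set w | (M * rate n < `|Z n w|)%R] <= (c1 * rate n ^+ p + c2 / M)%:E)%E.
  by near: n.
move=> /(_ r1)/le_trans; apply; rewrite lee_fin.
have h1 : c1 * rate n ^+ p <= eps / 2.
  apply: (@le_trans _ _ ((c1 + 1) * del)).
    apply: ler_pM => //; first exact: exprn_ge0.
      by rewrite lerDl.
    by apply: le_trans r3; rewrite -[leRHS]expr1 ler_wiXn2l.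
  by rewrite /del le_eqVlt; apply/orP; left; apply/eqP; field; rewrite gt_eqF.
have h2 : c2 / M <= eps / 2.
  rewrite ler_pdivrMr// /M (_ : eps / 2 * _ = c2 + 1); first by rewrite lerDl.
  by field; rewrite gt_eqF.
by apply: le_trans (lerD h1 h2) _; lra.
Unshelve. all: by end_near. Qed.

Section estimators_of_the_sample.
Context {R : realType} {d n : nat}.
Local Notation V := 'rV[R]_d.
Variables (K phi : V -> R) (h : R) (X : 'I_n -> V) (t : n.-tuple V).
Hypothesis tX : forall i, tnth t i = X i.

Let fhatE i : fhat K h X i (X i) = density_estimate (scaled_kernel K h) t i.
Proof.
rewrite /fhat /density_estimate /scaled_kernel invfM -mulrA big_distrr/=; congr (_ * _).
by apply: eq_bigr => j _; rewrite !tX.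
Qed.

Lemma IhatE : Ihat K h X phi = plain_estimate (scaled_kernel K h) phi t.
Proof. by congr (_ * _); apply: eq_bigr => i _; rewrite fhatE tX. Qed.

Lemma Ihat_cE : Ihat_c K h X phi = corrected_estimate (scaled_kernel K h) phi t.
Proof.
congr (_ * _); apply: eq_bigr => i _; rewrite fhatE tX; do 4! congr (_ _ _).
by rewrite /vhat /variance_estimate; congr (_ * _); apply: eq_bigr => j _; rewrite fhatE !tX.
Qed.

End estimators_of_the_sample.

Section bandwidth_regime.
Context {R : realType}.
Variables (n d r : nat) (h s : R).
Hypotheses (h_gt0 : 0 < h) (s_gt0 : 0 < s) (n_gt0 : (0 < n)%N).
Local Notation a := (Num.sqrt n%:R : R).
Local Notation e := (Num.sqrt (h ^+ d)).

Let powRNn : n%:R `^ (- (1 / 2)) = a^-1 :> R.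
Proof. by rewrite powRN div1r powR12_sqrt. Qed.

Let powRn : n%:R `^ (1 / 2) = a :> R.
Proof. by rewrite div1r powR12_sqrt. Qed.

Let hd_ge0 : 0 <= h ^+ d. Proof. by rewrite exprn_ge0// ltW. Qed.

Let powRh : h `^ (d%:R / 2) = e.
Proof. by rewrite powRrM powR_mulrn ?(ltW h_gt0)// powR12_sqrt. Qed.

Lemma plain_rateE : h `^ s + n%:R `^ (1 / 2) * h ^+ r + n%:R `^ (- (1 / 2)) * h ^- d =
  plain_rate (n := n) (d := d) h r s.
Proof. by rewrite /plain_rate powRNn powRn sqr_sqrtr// invfM. Qed.

Lemma corrected_rateE : h `^ s + n%:R `^ (1 / 2) * h ^+ r
      + n%:R `^ (- (1 / 2)) * h `^ (- (d%:R / 2))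
      + n%:R^-1 * h `^ (- (3 * d%:R / 2)) = corrected_rate (n := n) (d := d) h r s.
Proof.
rewrite /corrected_rate powRNn powRn powRN powRh -invfM; congr (_ + _).
by rewrite sqr_sqrtr// invfM powRN (mulrC 3) mulrAC powRrM powRh (powR_mulrn 3) ?sqrtr_ge0.
Qed.

Lemma plain_rate_ge0 : 0 <= plain_rate (n := n) (d := d) h r s.
Proof.
by rewrite /plain_rate !addr_ge0 ?powR_ge0 ?mulr_ge0 ?invr_ge0 ?mulr_ge0 ?sqrtr_ge0 ?exprn_ge0 ?sqrtr_ge0// ltW.
Qed.

Lemma corrected_rate_ge0 : 0 <= corrected_rate (n := n) (d := d) h r s.
Proof.
by rewrite /corrected_rate !addr_ge0 ?powR_ge0 ?mulr_ge0 ?invr_ge0 ?mulr_ge0 ?sqrtr_ge0 ?exprn_ge0 ?sqrtr_ge0// ltW.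
Qed.

Let a_ge1 : 1 <= a. Proof. by rewrite -[leLHS]sqrtr1 ler_wsqrtr// ler1n. Qed.
Let e_gt0 : 0 < e. Proof. by rewrite sqrtr_gt0 exprn_gt0. Qed.

Let le1_of_powR (rho : R) : rho <= 2^-1 -> h `^ s <= rho -> h <= 1.
Proof.
move=> rho2 hs; rewrite leNgt; apply/negP => h1.
have : 1 `^ s <= h `^ s by rewrite ge0_ler_powR ?nnegrE ?(ltW s_gt0)// ltW.
by rewrite powR1; have := le_trans hs rho2; lra.
Qed.

Let h_pow_le (rho : R) : a * h ^+ r <= rho -> h ^+ r <= rho.
Proof. by apply: le_trans; rewrite ler_peMl// exprn_ge0// ltW. Qed.

(** A small rate forces the bandwidth below one, a small bias, and many sample points per
window. *)
Lemma plain_regime (rho : R) : rho <= 2^-1 -> plain_rate (n := n) (d := d) h r s <= rho ->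
  [/\ h <= 1, h ^+ r <= rho & 2 <= a * e].
Proof.
move=> rho2; have p0 : 0 <= h `^ s := powR_ge0 _ _.
have p1 : 0 <= a * h ^+ r by rewrite mulr_ge0 ?sqrtr_ge0 ?exprn_ge0// ltW.
have p2 : 0 < (a * e ^+ 2)^-1 by rewrite invr_gt0 mulr_gt0 ?exprn_gt0// (lt_le_trans ltr01).
rewrite /plain_rate => hr.
have h1 : h <= 1 by apply: (le1_of_powR rho2); lra.
have h2 : h ^+ r <= rho by apply: h_pow_le; lra.
have h3 : (a * e ^+ 2)^-1 <= 2^-1 by lra.
split => //; apply: (@le_trans _ _ (a * e ^+ 2)).
  by rewrite -lef_pV2 ?posrE// -invr_gt0.
rewrite ler_wpM2l ?sqrtr_ge0// expr2 ler_piMl ?(ltW e_gt0)//.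
by rewrite -[leRHS]sqrtr1 ler_wsqrtr// exprn_ile1// ltW.
Qed.

Lemma corrected_regime (rho : R) : rho <= 2^-1 -> corrected_rate (n := n) (d := d) h r s <= rho ->
  [/\ h <= 1, h ^+ r <= rho & 2 <= a * e].
Proof.
move=> rho2; have p0 : 0 <= h `^ s := powR_ge0 _ _.
have p1 : 0 <= a * h ^+ r by rewrite mulr_ge0 ?sqrtr_ge0 ?exprn_ge0// ltW.
have p2 : 0 < (a * e)^-1 by rewrite invr_gt0 mulr_gt0// (lt_le_trans ltr01).
have p3 : 0 <= (a ^+ 2 * e ^+ 3)^-1 by rewrite invr_ge0 mulr_ge0 ?sqr_ge0// exprn_ge0// ltW.
rewrite /corrected_rate => hr.
have h1 : h <= 1 by apply: (le1_of_powR rho2); lra.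
have h2 : h ^+ r <= rho by apply: h_pow_le; lra.
have h3 : (a * e)^-1 <= 2^-1 by lra.
by split => //; rewrite -lef_pV2 ?posrE// -invr_gt0.
Qed.

End bandwidth_regime.

Section constants.
Context {R : realType} {d : nat}.
Variables (K : 'rV[R]_d -> R) (B b F m1 C1 C2 : R).
Hypotheses (b_gt0 : 0 < b) (B_ge0 : 0 <= B) (C2_ge0 : 0 <= C2).

Let bX_ge0 p : 0 <= b ^- p. Proof. by rewrite invr_ge0 exprn_ge0// ltW. Qed.
Let fc_ge0 (x : R) : 0 <= fluctuation_const x. Proof. exact: expR_ge0. Qed.
Let sc_ge0 (x : R) : 0 <= sum_sqr_const x. Proof. exact: expR_ge0. Qed.

Lemma failure_const_ge0 : 0 <= failure_const K b F m1.
Proof.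
apply: mulr_ge0 => //; apply: mulr_ge0; first by apply: exprn_ge0; rewrite divr_ge0// ltW.
by apply: mulr_ge0 => //; apply: mulr_ge0 => //; exact: exprn_ge0.
Qed.

Let lin_const_ge0 : 0 <= 7 * (B / b ^+ 2) * C2 + 3 * Num.sqrt (F * C1)
  + 28 * Num.sqrt (linear_const (kernel_size K F m1) B b).
Proof.
apply: addr_ge0; last by rewrite mulr_ge0 ?sqrtr_ge0.
apply: addr_ge0; last by rewrite mulr_ge0 ?sqrtr_ge0.
by apply: mulr_ge0 => //; apply: mulr_ge0 => //; exact: mulr_ge0.
Qed.

Lemma plain_const_ge0 : 0 <= plain_const K B b F m1 C1 C2.
Proof.
apply: addr_ge0; first exact: lin_const_ge0.
apply: mulr_ge0; first by apply: mulr_ge0 => //; exact: mulr_ge0.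
by apply: addr_ge0 => //; exact: mulr_ge0.
Qed.

Lemma corrected_const_ge0 : 0 <= corrected_const K B b F m1 C1 C2.
Proof.
apply: addr_ge0; first apply: addr_ge0; first exact: lin_const_ge0.
  by apply: mulr_ge0; [apply: mulr_ge0 => //; exact: mulr_ge0|exact: sqr_ge0].
apply: mulr_ge0.
  by apply: addr_ge0; apply: mulr_ge0 => //; exact: mulr_ge0.
by apply: mulr_ge0; rewrite !addr_ge0// mulr_ge0.
Qed.

End constants.

Theorem theorem1 (R : realType) (d : nat) (hd : (1 <= d)%N)
    (disp : measure_display) (Omega : measurableType disp)
    (P : probability Omega R)
    (X : nat -> {RV P >-> 'rV[R]_d})
    (X_indep : mutually_independent X)
    (X_ident : identically_distributed X)
    (h : nat -> R) (h_gt0 : forall n, 0 < h n)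
    (phi K : 'rV[R]_d -> R)
    (* (A1) *)
    (s M : R) (s_gt0 : 0 < s) (M_gt0 : 0 < M)
    (Q : set 'rV[R]_d)
    (phi_supp : closure [set x | phi x != 0] = Q) (Q_compact : compact Q)
    (phi_nikolski : nikolski s M phi)
    (* (A2) *)
    (r : nat) (r_ge1 : (1 <= r)%N)
    (f : 'rV[R]_d -> R)
    (f_density : has_density (lebesgue_rV d) (X 0%N) f)
    (f_bounded : bounded_fun f)
    (f_diff : times_differentiable r f)
    (f_diff_bounded : forall l : 'I_d -> nat, msize l = r ->
      bounded_fun (mpartial l f))
    (* (A3) *)
    (b : R) (b_gt0 : 0 < b) (f_ge : forall x, Q x -> b <= f x)
    (* (A4) *)
    (K_order : kernel_of_order r K)
    (m1 m2 : R) (m1_gt0 : 0 < m1) (m2_gt0 : 0 < m2)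
    (K_exp : forall x, `|K x| <= m1 * expR (- (m2 * enorm x)))
    (K_even : forall x, K x = K (- x)) :
  let I := \int[lebesgue_rV d]_x phi x in
  let sample (n : nat) (w : Omega) (i : 'I_n) : 'rV[R]_d := X i w in
  let rate (n : nat) : R :=
    h n `^ s + n%:R `^ (1 / 2) * h n ^+ r + n%:R `^ (- (1 / 2)) * h n ^- d in
  let rate_c (n : nat) : R :=
    h n `^ s + n%:R `^ (1 / 2) * h n ^+ r
      + n%:R `^ (- (1 / 2)) * h n `^ (- (d%:R / 2))
      + n%:R^-1 * h n `^ (- (3 * d%:R / 2)) in
  (rate n @[n --> \oo] --> (0 : R) ->
    bounded_in_probability P
      (fun n w => n%:R `^ (1 / 2) * (Ihat K (h n) (sample n w) phi - I)) rate)
  /\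
  (rate_c n @[n --> \oo] --> (0 : R) ->
    bounded_in_probability P
      (fun n w => n%:R `^ (1 / 2) * (Ihat_c K (h n) (sample n w) phi - I))
      rate_c).
Proof.
move=> I sample rate rate_c.
have [/bounded_fun_bound[B B_ge0 phi_le] mphi _] := phi_nikolski.
have [mf f_ge0 muE] := f_density.
have [F F_ge0 f_le] := bounded_fun_bound f_bounded.
have [_ mK _ _ _] := K_order.
have f_geb x : phi x != 0 -> b <= f x.
  move=> px; apply: f_ge; apply: contrapT => nQ.
  by move: px; rewrite (phi_outside phi_supp nQ) eqxx.
have [C1 C1_ge0 smoothing] := smoothing_error_quotient hd M_gt0 phi_supp Q_compact
  phi_nikolski r_ge1 mf f_diff f_diff_bounded b_gt0 f_ge K_order m2_gt0 K_exp.
have [C2 C2_ge0 bias] := kernel_bias_density r_ge1 mf f_bounded f_diff f_diff_bounded K_order m2_gt0 K_exp.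
(* When the rate is below [rho] the bias is at most [b / 4] and at most [1], and
   [plain_regime] and [corrected_regime] apply. *)
pose rho : R := Num.min 2^-1 (Num.min (b / 4) 1 / (C2 + 1)).
have C21 : 0 < C2 + 1 by rewrite ltr_wpDl.
have rho_gt0 : 0 < rho.
  by rewrite lt_min invr_gt0 ltr0n/= divr_gt0// lt_min divr_gt0//=.
have rho_le2 : rho <= 2^-1 by rewrite ge_min lexx.
have small (x : R) : 0 <= x -> x <= rho -> C2 * x <= b / 4 /\ C2 * x <= 1.
  move=> x0 xr; have : (C2 + 1) * x <= Num.min (b / 4) 1.
    by rewrite mulrC -ler_pdivlMr//; apply: le_trans xr _; rewrite ge_min lexx orbT.
  by rewrite le_min => /andP[h1 h2]; split; nra.
have mu_res n := sample_resampling X_indep X_ident (n := n).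
have n_root n : n%:R `^ (1 / 2) = Num.sqrt n%:R :> R by rewrite div1r powR12_sqrt.
have event n (est : n.-tuple 'rV[R]_d -> R) (est' : Omega -> R) (c : R) :
    (forall w, est' w = est (sample_tuple X n w)) ->
    P [set w | c < `|n%:R `^ (1 / 2) * (est' w - I)|] =
    distribution P (sample_tuple X n) [set t | c < Num.sqrt n%:R * `|est t - I|].
  move=> estE; rewrite /distribution /pushforward; congr (P _).
  by apply/seteqP; split=> w /=; rewrite estE normrM n_root ger0_norm ?sqrtr_ge0.
have powr0 n : 0 <= h n ^+ r by rewrite exprn_ge0// ltW.
split.
- move=> rateC.
  apply: (@bounded_in_probability_of_tail _ _ _ _ _ _ 3 (failure_const K b F m1)
    (plain_const K B b F m1 C1 C2) rho) => //.
  + exact: failure_const_ge0.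
  + exact: plain_const_ge0.
  + by move=> n; rewrite /rate plain_rateE// plain_rate_ge0.
  + move=> M0 M00; near=> n => rle.
    have n3 : (3 <= n)%N by near: n; exact: nbhs_infty_ge.
    have n0 : (0 < n)%N by exact: leq_trans n3.
    have rE : rate n = plain_rate (n := n) (d := d) (h n) r s by rewrite /rate plain_rateE.
    have [h1 hr ae] : [/\ h n <= 1, h n ^+ r <= rho & 2 <= Num.sqrt n%:R * Num.sqrt (h n ^+ d)].
      by apply: (plain_regime (h_gt0 n) s_gt0 n0 rho_le2); rewrite -rE.
    have h01 : 0 < h n <= 1 by rewrite h_gt0.
    have [b1 b2] := small _ (powr0 n) hr.
    rewrite (event n (plain_estimate (scaled_kernel K (h n)) phi)); last first.
      by move=> w; apply: IhatE => i; rewrite tnth_mktuple.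
    rewrite rE.
    exact: (plain_sample_tail (mu_res n) mf f_ge0 muE F_ge0 f_le b_gt0 mphi B_ge0 phi_le f_geb mK
      m1_gt0 m2_gt0 K_exp K_even n3 (h_gt0 n) h1 C1_ge0 C2_ge0 (smoothing _ h01)
      (fun x => bias x _ h01) b1 b2 ae M00).
- move=> rateC.
  apply: (@bounded_in_probability_of_tail _ _ _ _ _ _ 2 (failure_const K b F m1)
    (corrected_const K B b F m1 C1 C2) rho) => //.
  + exact: failure_const_ge0.
  + exact: corrected_const_ge0.
  + by move=> n; rewrite /rate_c corrected_rateE// corrected_rate_ge0.
  + move=> M0 M00; near=> n => rle.
    have n3 : (3 <= n)%N by near: n; exact: nbhs_infty_ge.
    have n0 : (0 < n)%N by exact: leq_trans n3.
    have rE : rate_c n = corrected_rate (n := n) (d := d) (h n) r s by rewrite /rate_c corrected_rateE.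
    have [h1 hr ae] : [/\ h n <= 1, h n ^+ r <= rho & 2 <= Num.sqrt n%:R * Num.sqrt (h n ^+ d)].
      by apply: (corrected_regime (h_gt0 n) s_gt0 n0 rho_le2); rewrite -rE.
    have h01 : 0 < h n <= 1 by rewrite h_gt0.
    have [b1 b2] := small _ (powr0 n) hr.
    rewrite (event n (corrected_estimate (scaled_kernel K (h n)) phi)); last first.
      by move=> w; apply: Ihat_cE => i; rewrite tnth_mktuple.
    rewrite rE.
    exact: (corrected_sample_tail (mu_res n) mf f_ge0 muE F_ge0 f_le b_gt0 mphi B_ge0 phi_le f_geb mK
      m1_gt0 m2_gt0 K_exp K_even n3 (h_gt0 n) h1 C1_ge0 C2_ge0 (smoothing _ h01)
      (fun x => bias x _ h01) b1 b2 ae M00).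
Unshelve. all: end_near.
Qed.
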